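(* Let $r\in\mathbb{N}^{+}\cup\{\infty,a\}$, $k\geq1$, $\Omega=(\Omega_{1},\dots,\Omega_{k})\in\mathbb{R}^{k}$, and consider the system $$\dot{x}=Ax+f_{0}(x)+\epsilon f_{1}(x,\Omega t;\epsilon),\qquad f_{0}(x)=\mathcal{O}(|x|^{2}),\qquad 0\le\epsilon\ll1,$$ where $A\in\mathbb{R}^{N\times N}$, $\mathcal{U}\subset\mathbb{R}^{N}$ is an open set containing $0$, and $f_{0}\colon\mathcal{U}\to\mathbb{R}^{N}$ and $f_{1}\colon\mathcal{U}\times\mathbb{T}^{k}\to\mathbb{R}^{N}$ (depending also on the parameter $\epsilon$) are of class $C^{r}$ in their arguments; that is, the external forcing $f_{1}$ is quasiperiodic in time with $k$ frequencies (with time-periodic forcing included as the case $k=1$). Assume that all eigenvalues $\lambda_{1},\dots,\lambda_{N}$ of $A$ satisfy $\mathrm{Re}\,\lambda_{j}<0$. Then, for $\epsilon\neq0$ small enough, there exists near $x=0$ a unique nonlinear normal mode $$x_{\epsilon}(t)=\epsilon\,\tau(\Omega_{1}t,\ldots,\Omega_{k}t;\epsilon)$$ of the system, where the function $\tau$ is $2\pi$-periodic in each of its first $k$ arguments. This nonlinear normal mode attracts all nearby trajectories and depends on $\epsilon$ in a $C^{r}$ fashion.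
   Context: $C^{a}$ denotes the class of (real) analytic functions; $\mathbb{T}^{k}=S^{1}\times\dots\times S^{1}$ is the $k$-dimensional torus with $2\pi$-periodic angular coordinates. The function $f_1$ need not vanish at $x=0$. A nonlinear normal mode (NNM) is the closure of a multi-frequency solution $x(t)=\sum_{m}x_{m}e^{i\langle m,\omega\rangle t}$ of the system, where $\omega\in\mathbb{R}^{f}$ is a vector of $f\in\mathbb{N}$ frequencies, $m$ ranges over integer multi-indices of length $f$, and $x_{m}$ are complex Fourier amplitudes of the real solution $x(t)$. It is trivial (a fixed point) if $f=0$, periodic (a periodic orbit) if $f=1$ or if $f>1$ and the frequencies are rationally commensurate, and quasiperiodic (an invariant torus) if $f>1$ and the frequencies are rationally incommensurate. For the system above, written in the extended phase space as $\dot{x}=Ax+f_0(x)+\epsilon f_1(x,\phi;\epsilon)$, $\dot\phi=\Omega$, the NNM is represented by the invariant torus $\{(\epsilon\tau(\phi;\epsilon),\phi):\phi\in\mathbb{T}^{k}\}$. ''Attracts all nearby trajectories'' means that all solutions starting sufficiently close to this torus converge to it as $t\to\infty$. *)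

(* Defs.v *)
From HB Require Import structures.
From mathcomp Require Import all_boot all_order all_algebra complex.
From mathcomp Require Import all_classical all_reals all_analysis.
Import Order.TTheory GRing.Theory Num.Theory.
Import numFieldNormedType.Exports.

Set Implicit Arguments.
Unset Strict Implicit.
Unset Printing Implicit Defensive.

Local Open Scope classical_set_scope.
Local Open Scope ring_scope.

Section Regularity.
Context {R : realType} {V W : normedModType R}.
Implicit Types (S : set V) (f : V -> W).

(* Frechet derivative relative to S: only increments that stay in S are
   tested, so it is one-sided at boundary points of S. *)
Definition derivative_within S f (x : V) (df : V -> W) : Prop :=
  linear df /\
  forall e : R, 0 < e -> \forall y \near within S (nbhs x),
    `|f y - f x - df (y - x)| <= e * `|y - x|.

(* C^n on S, for V finite-dimensional (so that linear maps are automatically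
   continuous, and a family of linear maps is C^n iff its values at each fixed
   vector are).  On an open S this is the usual class C^n; it is used here for
   open sets and for products of an open set with [0, c[, where relative
   derivatives are unique. *)
Fixpoint Cn_on (n : nat) S f : Prop :=
  match n with
  | 0 => {within S, continuous f}
  | n'.+1 => exists df : V -> V -> W,
      (forall x, S x -> derivative_within S f x (df x)) /\
      (forall v, Cn_on n' S (fun x => df x v))
  end.

Definition multilinear n (p : ('I_n -> V) -> W) : Prop :=
  forall v i, linear (fun u : V => p (dfwith v i u)).

(* f is on S, near x, the sum of a power series of positive radius of
   convergence; the n-th homogeneous term is h |-> p n (h, ..., h). *)
Definition analytic_within S f (x : V) : Prop :=
  exists p : forall n, ('I_n -> V) -> W, exists C a rho : R,
    [/\ 0 < rho,
        forall n, multilinear (p n),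
        forall n v, `|p n v| <= C * a ^+ n * \prod_(i < n) `|v i| &
        forall h, `|h| < rho -> S (x + h) ->
          series (fun n => p n (fun=> h)) @ \oo --> f (x + h)].

Definition analytic_on S f : Prop := forall x, S x -> analytic_within S f x.

End Regularity.

(* The exponents r in {0, 1, 2, ...} U {infinity, a}. *)
Inductive regularity := Finite of nat | Infinite | Analytic.

Definition regularity_pos (r : regularity) : bool :=
  if r is Finite n then (0 < n)%N else true.

Definition C_on {R : realType} {V W : normedModType R} (r : regularity)
    (S : set V) (f : V -> W) : Prop :=
  match r with
  | Finite n => Cn_on n S f
  | Infinite => forall n, Cn_on n S f
  | Analytic => analytic_on S f
  end.

(* Functions on the torus T^k are functions on R^k satisfying this. *)
Definition periodic2pi {R : realType} {k : nat} {T : Type}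
    (g : 'cV[R]_k -> T) : Prop :=
  forall (phi : 'cV[R]_k) (j : 'I_k),
    g (phi + (2 * pi) *: delta_mx j ord0) = g phi.

Section MultiFrequency.
Context {R : realType} {N : nat}.
Local Open Scope complex_scope.

Definition expi (theta : R) : R[i] := cos theta +i* sin theta.

Definition pairing f (m : {ffun 'I_f -> int}) (omega : 'cV[R]_f) : R :=
  \sum_(j < f) (m j)%:~R * omega j ord0.

(* The sum over the multi-indices m with |m_j| <= n for all j; the digit
   p_j in {0, ..., 2n} stands for m_j = p_j - n. *)
Definition fourier_sum f (omega : 'cV[R]_f)
    (c : {ffun 'I_f -> int} -> 'cV[R[i]]_N) (n : nat) (t : R) : 'cV[R[i]]_N :=
  \sum_(p : {ffun 'I_f -> 'I_(n.*2.+1)})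
    let m := [ffun j => (p j)%:Z - n%:Z] in
    expi (pairing m omega * t) *: c m.

(* x(t) = \sum_m c_m exp(i <m, omega> t), the series being summed over growing
   boxes, uniformly in t.  Pointwise convergence would be too permissive for
   incommensurate omega, and absolute convergence may fail for the restriction
   of a C^1 function on T^f to a line. *)
Definition multi_frequency (x : R -> 'cV[R]_N) : Prop :=
  exists (f : nat) (omega : 'cV[R]_f) (c : {ffun 'I_f -> int} -> 'cV[R[i]]_N),
    forall e : R, 0 < e -> \forall n \near \oo, forall t i,
      `|fourier_sum omega c n t i ord0 - (x t i ord0)%:C| < e%:C.

End MultiFrequency.

Section ForcedSystem.
Context {R : realType} {N k : nat}.
Variables (U : set 'cV[R]_N) (Omega : 'cV[R]_k).

Definition forced_field (A : 'M[R]_N) (f0 : 'cV[R]_N -> 'cV[R]_N)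
    (f1 : 'cV[R]_N -> 'cV[R]_k -> R -> 'cV[R]_N) (eps : R)
    (x : 'cV[R]_N) (phi : 'cV[R]_k) : 'cV[R]_N :=
  A *m x + f0 x + eps *: f1 x phi eps.

Variable F : 'cV[R]_N -> 'cV[R]_k -> 'cV[R]_N.

(* (x(t), phi0 + t Omega) solves x' = F x phi, phi' = Omega on the interval I,
   with values in U. *)
Definition solution (I : set R) (phi0 : 'cV[R]_k) (x : R -> 'cV[R]_N) : Prop :=
  [/\ {within I, continuous x},
      forall t, I t -> U (x t) &
      forall t, interior I t -> is_derive t 1 x (F (x t) (phi0 + t *: Omega))].

Definition multi_frequency_solution (phi0 : 'cV[R]_k) (x : R -> 'cV[R]_N) :
    Prop :=
  solution setT phi0 x /\ multi_frequency x.

(* The nonlinear normal mode carried by a multi-frequency solution. *)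
Definition nnm (x : R -> 'cV[R]_N) : set 'cV[R]_N := closure (range x).

(* M is a subset of R^N x T^k, given by its lift to R^N x R^k; for a lift
   (invariant under 2 pi Z^k) the distance to M is the one of R^N x T^k. *)
Definition attracts_nearby (M : set ('cV[R]_N * 'cV[R]_k)) : Prop :=
  exists2 rho : R, 0 < rho &
    forall x0 phi0, (edist_inf M (x0, phi0) < rho%:E)%E ->
      (exists2 x, solution `[0, +oo[ phi0 x & x 0 = x0) /\
      (forall x, solution `[0, +oo[ phi0 x -> x 0 = x0 ->
         edist_inf M (x t, phi0 + t *: Omega) @[t --> +oo] --> 0%E).

End ForcedSystem.

(* Main.v *)
Require Import Defs.
From HB Require Import structures.
From mathcomp Require Import all_boot all_order all_algebra complex.
From mathcomp Require Import all_classical all_reals all_analysis.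
From mathcomp Require Import ring lra zify.
Import Order.TTheory GRing.Theory Num.Theory.
Import numFieldNormedType.Exports.

Set Implicit Arguments.
Unset Strict Implicit.
Unset Printing Implicit Defensive.

Local Open Scope classical_set_scope.
Local Open Scope ring_scope.

(** The proof reads the normal mode as the graph of a function over the space of
phases and epsilon.  Translation by [drift Omega] = (Omega, 0) is the flow on
that space, and a function h with values in R^N such that t |-> h (p + t om)
solves the system for every p is an [invariant_section].  The torus is then
epsilon tau (phi; epsilon) = h (phi, epsilon).

Since the spectrum of A lies in the open left half plane, some quadratic form
decreases at a definite rate along x' = A x ([exists_lyapunov]).  Near x = 0 and
epsilon = 0 the remaining terms f_0 + epsilon f_1 have a small Lipschitz
constant in x, uniformly in the phase ([small_forcing]), so the whole system is
[dissipative]: any two solutions approach each other exponentially as long as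
they stay in a fixed ball.  Hence there is exactly one solution that is bounded
on the whole time axis ([bounded_solution], [bounded_solution_unique]): start at
rest at time -n and let n tend to infinity.  Its value at time 0, as a function
of the initial phase and of epsilon, is h ([forced_section]).  Uniqueness makes
it an invariant section and makes it periodic, its size is proportional to
epsilon, and dissipativity makes it attract all nearby solutions
([forced_forward], [forced_attraction]).

The regularity of h rests on one estimate: a bounded solution of a dissipative
equation is controlled by its forcing ([bounded_response]).  The derivative of h
in a fixed direction is the bounded solution of the variational equation, that
is, again an invariant section, of a system which is linear in x and one degree
less smooth.  Induction on n gives class C^n ([section_Cn]).

For analytic data the Taylor coefficients of h are constructed directly.  Along
an orbit of the section, the vector field has Taylor expansions with uniform
bounds ([taylor_series], [compact_cauchy_bound]).  Inserting an unknown power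
series into them gives, degree by degree, linear dissipative equations whose
forcing is a sum over the ways to cut the list of arguments into consecutive
blocks ([composition_sum]).  Their bounded solutions are the coefficients;
weights proportional to 1/n^2 propagate geometric bounds through the recursion
([block_bound]), and a partial sum of the series solves the true equation up to
an exponentially small error, so that it is exponentially close to the true
bounded solution ([section_analytic]).

Finally, t |-> h (phi + t Omega, epsilon) has to be a uniform limit of partial
sums of one trigonometric series.  Positive trigonometric kernels, summed over
equidistant nodes, approximate continuous periodic functions uniformly
([trigonometric_approximation]), and an additional frequency 0 turns the
sequence of approximants into the partial sums of a series
([multi_frequency_quasiperiodic]). *)

(** * Epsilon-delta forms of continuity and differentiability *)

Section EpsilonDelta.
Context {R : realType} {V W : normedModType R}.
Implicit Types (S : set V) (f : V -> W).

Lemma near_withinP S (x : V) (P : V -> Prop) :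
  (\forall y \near within S (nbhs x), P y) <->
  exists2 d : R, 0 < d & forall y, S y -> `|y - x| < d -> P y.
Proof.
rewrite near_withinE; split => [/nbhs_normP[d /= d0 H]|[d d0 H]].
  by exists d => // y Sy yx; apply: H => //=; rewrite distrC.
by apply/nbhs_normP; exists d => // y /= yx Sy; apply: H; rewrite // distrC.
Qed.

Lemma within_continuousP S f : {within S, continuous f} <->
  forall x, S x -> forall e : R, 0 < e -> exists2 d : R, 0 < d &
    forall y, S y -> `|y - x| < d -> `|f y - f x| <= e.
Proof.
rewrite subspace_continuousP; split=> H x Sx.
  move=> e e0; have /cvgrPdist_le/(_ e e0) := H x Sx.
  by move=> /near_withinP[d d0 K]; exists d => // y Sy yx; rewrite distrC; exact: K.
apply/cvgrPdist_le => e e0; apply/near_withinP.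
by have [d d0 K] := H x Sx e e0; exists d => // y Sy yx; rewrite distrC; exact: K.
Qed.

Lemma derivative_withinP S f x df : derivative_within S f x df <->
  linear df /\ forall e : R, 0 < e -> exists2 d : R, 0 < d &
    forall y, S y -> `|y - x| < d -> `|f y - f x - df (y - x)| <= e * `|y - x|.
Proof.
split=> -[L H]; split=> // e e0; first by apply/near_withinP; exact: H.
by apply/near_withinP; exact: H.
Qed.

End EpsilonDelta.

Section RealVariable.
Context {R : realType} {V : normedModType R}.
Implicit Types f : R -> V.

Lemma is_derive1P f (t : R) (v : V) : is_derive t 1 f v <->
  forall e : R, 0 < e -> exists2 d : R, 0 < d &
    forall h, `|h| < d -> `|f (t + h) - f t - h *: v| <= e * `|h|.
Proof.
split=> [Hf e e0|H].
  have df : derivable f t 1 by exact: ex_derive.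
  have : h^-1 *: (f (h *: 1 + t) - f t) @[h --> 0^'] --> v.
    by rewrite -(@derive_val _ _ _ _ _ _ _ Hf); exact: df.
  move=> /cvgrPdist_le/(_ e e0); rewrite near_withinE => /nbhs_normP[d /= d0 K].
  exists d => // h hd; have [->|h0] := eqVneq h 0.
    by rewrite addr0 subrr scale0r subrr !normr0 mulr0.
  have /K : `|0 - h| < d by rewrite sub0r normrN.
  move=> /(_ h0); rewrite -(ler_pM2l (_ : 0 < `|h|)) ?normr_gt0// -normrZ.
  by rewrite scalerBr scalerA divff// scale1r -normrN opprB scaler1 addrC [h + t]addrC mulrC -addrA addrC -addrA.
have K : h^-1 *: (f (h *: 1 + t) - f t) @[h --> 0^'] --> v.
  apply/cvgrPdist_le => e e0; rewrite near_withinE; apply/nbhs_normP.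
  have [d d0 K] := H e e0; exists d => // h /=; rewrite sub0r normrN => hd h0.
  rewrite -(ler_pM2l (_ : 0 < `|h|)) ?normr_gt0// -normrZ mulrC.
  have := K h hd; rewrite scalerBr scalerA divff// scale1r -normrN opprB.
  by rewrite scaler1 [h + t]addrC.
apply: DeriveDef; first by apply/cvg_ex; exists v.
by rewrite /derive; apply: cvg_lim.
Qed.

Lemma is_derive_near f g (t : R) (v : V) : (\forall s \near t, f s = g s) ->
  is_derive t 1 f v -> is_derive t 1 g v.
Proof.
move=> /nbhs_normP[r /= r0 fg] /is_derive1P H; apply/is_derive1P => e e0.
have [d d0 K] := H e e0; exists (Num.min d r); first by rewrite lt_min d0.
move=> h; rewrite lt_min => /andP[hd hr].
rewrite -!fg ?K//= ?subrr ?normr0//.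
by rewrite opprD addrA subrr sub0r normrN.
Qed.

Lemma is_derive_continuous f (t : R) (v : V) : is_derive t 1 f v ->
  {for t, continuous f}.
Proof.
by move=> ?; apply: differentiable_continuous; apply/derivable1_diffP.
Qed.

End RealVariable.

Section VectorValued.
Context {R : realType} {n : nat}.
Implicit Types f : R -> 'cV[R]_n.

Lemma cV_norm_le (x : 'cV[R]_n) (c : R) : 0 <= c ->
  (forall i, `|x i 0| <= c) -> `|x| <= c.
Proof.
move=> c0 H; rewrite [`|x|]mx_normrE; apply: bigmax_le => // -[i j] _ /=.
by rewrite (ord1 j); exact: H.
Qed.

Lemma cV_norm_lt (x : 'cV[R]_n) (c : R) : 0 < c ->
  (forall i, `|x i 0| < c) -> `|x| < c.
Proof.
move=> c0 H; rewrite [`|x|]mx_normrE; apply: bigmax_lt => // -[i j] _ /=.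
by rewrite (ord1 j); exact: H.
Qed.

Lemma cV_coord_le (x : 'cV[R]_n) i : `|x i 0| <= `|x|.
Proof.
rewrite [`|x|]mx_normrE.
by rewrite (le_bigmax _ (fun ij : 'I_n * 'I_1 => `|x ij.1 ij.2|) (i, 0)).
Qed.

Lemma is_derive_coordP f (t : R) v : is_derive t 1 f v <->
  forall i, is_derive t 1 (fun s => f s i 0) (v i 0).
Proof.
split=> [/is_derive1P H i|H].
  apply/is_derive1P => e e0; have [d d0 K] := H e e0; exists d => // h hd.
  apply: le_trans (K h hd); rewrite (le_trans _ (cV_coord_le _ i))//.
  by rewrite !mxE.
have D : derivable f t 1 by apply/derivable_mxP => i j; rewrite (ord1 j); case: (H i).
apply: DeriveDef => //; rewrite derive_mx//; apply/matrixP => i j.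
by rewrite (ord1 j) mxE; case: (H i).
Qed.

End VectorValued.

Lemma cvg_finsum (K : numFieldType) (W : normedModType K) (T I : Type)
    (F : set_system T) (r : seq I) (f : I -> T -> W) (l : I -> W) : Filter F ->
  (forall i, f i x @[x --> F] --> l i) ->
  \sum_(i <- r) f i x @[x --> F] --> \sum_(i <- r) l i.
Proof.
move=> FF H; elim: r => [|i r IH].
  by rewrite big_nil; under eq_fun do rewrite big_nil; exact: cvg_cst.
by rewrite big_cons; under eq_fun do rewrite big_cons; apply: cvgD.
Qed.

(** * Differential inequalities *)

Section ScalarInequality.
Context {R : realType}.

(** The function e^(al t) (v t - be / al) is nonincreasing. *)
Lemma decay_estimate (v dv : R -> R) (al be a b : R) : 0 < al -> 0 <= be -> a <= b ->
  {within `[a, b], continuous v} ->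
  (forall t, a < t < b -> is_derive t 1 v (dv t)) ->
  (forall t, a < t < b -> dv t <= - al * v t + be) ->
  v b <= expR (- al * (b - a)) * v a + be / al.
Proof.
move=> al0 be0 ab cv Dv Hv.
pose w t := expR (al * (t - a)) * (v t - be / al).
have Dw t : a < t < b -> is_derive t 1 w
    (expR (al * (t - a)) * (al * (v t - be / al) + dv t)).
  move=> tab; have ? := Dv t tab.
  rewrite /w; apply: is_derive_eq.
  by rewrite /GRing.scale/=; ring.
have cw : {within `[a, b], continuous w}.
  apply/subspace_continuousP => x xab; apply: cvgM.
    apply: cvg_within_filter; apply: continuous_comp; last exact: continuous_expR.
    by apply: cvgM; [exact: cvg_cst|apply: cvgB; [exact: cvg_id|exact: cvg_cst]].
  by apply: cvgB; [move/subspace_continuousP : cv; exact|exact: cvg_cst].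
have {cw} : w b <= w a.
  have D1 x : x \in `]a, b[ -> derivable w x 1.
    by rewrite in_itv/= => /Dw ?; exact: ex_derive.
  have D2 x : x \in `]a, b[ -> derive1 w x <= 0.
    rewrite in_itv/= => xab; have ? := Dw x xab.
    rewrite derive1E derive_val pmulr_rle0 ?expR_gt0//.
    have := Hv x xab; rewrite mulrBr mulrCA divff ?gt_eqF// mulr1; lra.
  by apply: (ler0_derive1_le_cc D1 D2 cw); rewrite // in_itv/= lexx ab.
rewrite /w subrr mulr0 expR0 mul1r -(ler_pM2l (expR_gt0 (- al * (b - a)))).
rewrite mulrA -expRD mulNr addNr expR0 mul1r mulrBr.
have : 0 <= expR (- (al * (b - a))) * (be / al).
  by rewrite mulr_ge0 ?expR_ge0// divr_ge0// ltW.
lra.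
Qed.

(** A function that decays at a uniform exponential rate up to a constant and is
bounded in the past is bounded by that constant. *)
Lemma decay_past_le (u c : R) (K al : R) : 0 < al ->
  (forall T : R, 0 <= T -> u <= expR (- al * T) * K + c) -> u <= c.
Proof.
move=> al0 H; apply/ler_addgt0Pr => /= e e0.
pose K' : R := `|K| + 1; have K0 : 0 < K' by rewrite ltr_pwDr.
pose T : R := K' / (al * e).
have T0 : 0 <= T by rewrite divr_ge0 ?mulr_ge0 ?ltW.
apply: le_trans (H T T0) _; rewrite addrC lerD2l.
have E1 : 1 + al * T <= expR (al * T) by exact: expR_ge1Dx.
have E2 : al * T = K' / e by rewrite /T; field; rewrite !gt_eqF.
rewrite mulNr expRN.
have E3 : K <= e * expR (al * T).
  apply: (@le_trans _ _ (e * (K' / e))); last first.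
    by rewrite ler_pM2l// -E2; apply: le_trans E1; rewrite lerDr.
  by rewrite mulrCA divff ?gt_eqF// mulr1 /K' (le_trans (ler_norm _))// lerDl.
by rewrite mulrC ler_pdivrMr ?expR_gt0.
Qed.
End ScalarInequality.

(** * A quadratic Lyapunov function for a stable matrix *)

Section QuadraticForm.
Context {R : realType} {m N : nat} (C : 'M[R]_(m, N)).
Implicit Types x y z : 'cV[R]_N.

(** The form x^T C^T C y. Keeping the factor C makes positivity and Young's
inequality those of the standard inner product. *)
Definition lform x y : R := \sum_i (C *m x) i 0 * (C *m y) i 0.

Lemma lformDl x y z : lform (x + y) z = lform x z + lform y z.
Proof.
rewrite /lform -big_split; apply: eq_bigr => i _ /=.
by rewrite mulmxDr mxE mulrDl.
Qed.

Lemma lformC x y : lform x y = lform y x.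
Proof. by apply: eq_bigr => i _; rewrite mulrC. Qed.

Lemma lformDr x y z : lform z (x + y) = lform z x + lform z y.
Proof. by rewrite lformC lformDl !(lformC z). Qed.

Lemma lformZl a x y : lform (a *: x) y = a * lform x y.
Proof.
rewrite /lform mulr_sumr; apply: eq_bigr => i _.
by rewrite -scalemxAr mxE mulrA.
Qed.

Lemma lformZr a x y : lform x (a *: y) = a * lform x y.
Proof. by rewrite lformC lformZl lformC. Qed.

Lemma lform_ge0 x : 0 <= lform x x.
Proof. by apply: sumr_ge0 => i _; rewrite -expr2 sqr_ge0. Qed.

Lemma lform_young a x y : 0 < a ->
  2 * lform x y <= a * lform x x + lform y y / a.
Proof.
move=> a0; rewrite /lform !mulr_sumr mulr_suml -big_split; apply: ler_sum => i _ /=.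
set u := (C *m x) i 0; set v := (C *m y) i 0.
have -> : a * (u * u) + v * v / a = 2 * (u * v) + (a * u - v) ^+ 2 / a.
  by field; rewrite gt_eqF.
by rewrite lerDl divr_ge0 ?sqr_ge0// ltW.
Qed.

Lemma lform_le : exists2 c : R, 0 < c & forall x, lform x x <= c * `|x| ^+ 2.
Proof.
pose r i := \sum_j `|C i j|.
exists (1 + \sum_i r i ^+ 2).
  by rewrite ltr_pwDl// sumr_ge0// => i _; exact: sqr_ge0.
move=> x; rewrite mulrDl mul1r mulr_suml (@le_trans _ _ (\sum_i r i ^+ 2 * `|x| ^+ 2))//; last first.
  by rewrite lerDr sqr_ge0.
apply: ler_sum => i _; rewrite -expr2 -exprMn -real_normK ?num_real//.
rewrite ler_sqr ?nnegrE// ?mulr_ge0 ?sumr_ge0// mxE.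
apply: le_trans (ler_norm_sum _ _ _) _; rewrite /r mulr_suml; apply: ler_sum => j _.
by rewrite normrM ler_wpM2l// cV_coord_le.
Qed.

Lemma is_derive_lform (w : R -> 'cV[R]_N) (t : R) v : is_derive t 1 w v ->
  is_derive t 1 (fun s => lform (w s) (w s)) (2 * lform (w t) v).
Proof.
move=> /is_derive_coordP H.
have D i : is_derive t 1 (fun s => (C *m w s) i 0) ((C *m v) i 0).
  have -> : (fun s => (C *m w s) i 0) = \sum_(j < N) (fun s => C i j * w s j 0).
    by apply/funext => s; rewrite mxE fct_sumE.
  rewrite mxE; apply: is_derive_sum => j; have ? := H j.
have -> : (fun s => lform (w s) (w s)) =
    \sum_(i < m) (fun s => (C *m w s) i 0 * (C *m w s) i 0).
  by apply/funext => s; rewrite fct_sumE.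
rewrite /lform mulr_sumr; apply: is_derive_sum => i.
apply: is_derive_eq; rewrite /GRing.scale/=; ring.
Qed.

Lemma continuous_lform (S : set R) (w : R -> 'cV[R]_N) :
  {within S, continuous w} -> {within S, continuous (fun s => lform (w s) (w s))}.
Proof.
move=> /subspace_continuousP H; apply/subspace_continuousP => t St.
have cw i : (C *m w s) i 0 @[s --> within S (nbhs t)] --> (C *m w t) i 0.
  rewrite mxE; under eq_fun do rewrite mxE; apply: cvg_finsum => j.
  apply: cvgM; first exact: cvg_cst.
  apply: (@cvg_comp _ _ _ w (fun x : 'cV[R]_N => x j 0) _ (nbhs (w t))).
    exact: H.
  exact: coord_continuous.
by apply: cvg_finsum => i; apply: cvgM.
Qed.

End QuadraticForm.

(** For z = u + i v and w = p + i q the left side is the real part of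
conj(z) (s + i t) w. The two real coefficients s and t are estimated separately. *)
Lemma re_mul_le (R : realType) (mu u v p q s t : R) : `|s| <= mu -> `|t| <= mu ->
  u * (s * p - t * q) + v * (s * q + t * p) <= mu * (u ^+ 2 + v ^+ 2 + p ^+ 2 + q ^+ 2).
Proof.
rewrite !ler_norml => /andP[s1 s2] /andP[t1 t2].
set S := u ^+ 2 + v ^+ 2 + p ^+ 2 + q ^+ 2.
have H (a X : R) : - mu <= a -> a <= mu -> - (S / 2) <= X -> X <= S / 2 ->
    a * X <= mu * (S / 2).
  move=> a1 a2 X1 X2.
  have : 0 <= (mu - a) * (S / 2 + X) by apply: mulr_ge0; lra.
  have : 0 <= (mu + a) * (S / 2 - X) by apply: mulr_ge0; lra.
  lra.
have -> : u * (s * p - t * q) + v * (s * q + t * p) =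
  s * (u * p + v * q) + t * (v * p - u * q) by ring.
have -> : mu * S = mu * (S / 2) + mu * (S / 2) by field.
have := (sqr_ge0 (u + p), sqr_ge0 (u - p), sqr_ge0 (v + q), sqr_ge0 (v - q)).
have := (sqr_ge0 (v + p), sqr_ge0 (v - p), sqr_ge0 (u + q), sqr_ge0 (u - q)).
by move=> [[[e1 e2] e3] e4] [[[e5 e6] e7] e8]; apply: lerD; apply: H => //; rewrite /S; nra.
Qed.

Section Lyapunov.
Local Open Scope complex_scope.
Context {R : realType}.

Lemma trig_diag_eigenvalue (n : nat) (F : fieldType) (A T P : 'M[F]_n) i :
  P \in unitmx -> P *m A = T *m P -> is_trig_mx T -> eigenvalue A (T i i).
Proof.
move=> Pu PA Tt.
have : eigenvalue T (T i i).
  rewrite eigenvalue_root_char char_poly_trig// rootE horner_prod.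
  by rewrite (bigD1 i)//= hornerXsubC subrr mul0r.
move=> /eigenvalueP[v vT v0]; apply/eigenvalueP; exists (v *m P).
  by rewrite -mulmxA PA mulmxA vT scalemxAl.
by apply: contraNneq v0 => vP; rewrite -[v]mulmx1 -(mulmxV Pu) mulmxA vP mul0mx.
Qed.

Lemma exists_trigonal (n : nat) (A : 'M[R[i]]_n) : exists P T : 'M[R[i]]_n,
  [/\ P \in unitmx, P *m A = T *m P & is_trig_mx T].
Proof.
case: n => [|n] in A *.
  exists 1%:M, A; split; rewrite ?unitmx1 ?mul1mx ?mulmx1//.
  by apply/is_trig_mxP => -[].
have [P Pu PT] := @Schur _ n.+1 A isT.
have Pun := unitarymx_unit Pu.
exists P, (P *m A *m invmx P); split => //; first by rewrite mulmxKV.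
by move: PT; rewrite /similar_to /= conjumx.
Qed.

Lemma map_Re_mulmx n p q (A : 'M[R[i]]_(n, p)) (B : 'M[R[i]]_(p, q)) :
  map_mx (@complex.Re R) (A *m B) = map_mx (@complex.Re R) A *m map_mx (@complex.Re R) B
    - map_mx (@complex.Im R) A *m map_mx (@complex.Im R) B.
Proof.
apply/matrixP => i j; rewrite !mxE -sumrB.
rewrite (big_morph (@complex.Re R) (id1 := 0) (op1 := +%R))//; last by move=> [? ?] [? ?].
by apply: eq_bigr => k _; rewrite !mxE; case: (A i k) (B k j) => [? ?] [? ?].
Qed.

Lemma map_Im_mulmx n p q (A : 'M[R[i]]_(n, p)) (B : 'M[R[i]]_(p, q)) :
  map_mx (@complex.Im R) (A *m B) = map_mx (@complex.Re R) A *m map_mx (@complex.Im R) B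
    + map_mx (@complex.Im R) A *m map_mx (@complex.Re R) B.
Proof.
apply/matrixP => i j; rewrite !mxE -big_split/=.
rewrite (big_morph (@complex.Im R) (id1 := 0) (op1 := +%R))//; last by move=> [? ?] [? ?].
by apply: eq_bigr => k _; rewrite !mxE; case: (A i k) (B k j) => [? ?] [? ?].
Qed.

Lemma cV_norm_sqr_le n (x : 'cV[R]_n) : `|x| ^+ 2 <= \sum_i x i 0 ^+ 2.
Proof.
have S0 : 0 <= \sum_i x i 0 ^+ 2 by apply: sumr_ge0 => i _; exact: sqr_ge0.
rewrite -[leRHS]sqr_sqrtr// ler_sqr ?nnegrE ?sqrtr_ge0//.
apply: cV_norm_le; first exact: sqrtr_ge0.
move=> i; rewrite -sqrtr_sqr ler_sqrt// (bigD1 i)//= lerDl.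
by apply: sumr_ge0 => j _; exact: sqr_ge0.
Qed.

(** A left inverse of C recovers x from C x, so C x cannot be small unless x is. *)
Lemma lform_ge m n (C : 'M[R]_(m, n)) (L : 'M[R]_(n, m)) : L *m C = 1%:M ->
  exists2 c : R, 0 < c & forall x, c * `|x| ^+ 2 <= lform C x x.
Proof.
move=> LC; have [c c0 H] := lform_le L.
exists c^-1; first by rewrite invr_gt0.
move=> x; rewrite mulrC ler_pdivrMr//.
have -> : `|x| = `|L *m (C *m x)| by rewrite mulmxA LC mul1mx.
apply: le_trans (cV_norm_sqr_le _) _.
have -> : \sum_i (L *m (C *m x)) i 0 ^+ 2 = lform L (C *m x) (C *m x).
  by apply: eq_bigr => i _; rewrite expr2.
apply: le_trans (H _) _; rewrite mulrC ler_pM2r//.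
by apply: le_trans (cV_norm_sqr_le _) _; apply: ler_sum => i _; rewrite expr2.
Qed.

(** For a triangular matrix, rescaling the coordinates geometrically makes the
off-diagonal part as small as desired, so that the Euclidean norm of the
rescaled triangularizing coordinates decreases along the linear flow. *)
Lemma exists_lyapunov (N : nat) (A : 'M[R]_N) :
  (forall lambda : R[i], eigenvalue (map_mx (real_complex R) A) lambda ->
       complex.Re lambda < 0) ->
  exists (C : 'M[R]_(N + N, N)) (a c : R), [/\ 0 < a, 0 < c,
    forall x, lform C x (A *m x) <= - a * lform C x x &
    forall x, c * `|x| ^+ 2 <= lform C x x].
Proof.
move=> hA; have [P [T [Pu PA Tt]]] := exists_trigonal (map_mx (real_complex R) A).
have ReT i : complex.Re (T i i) < 0 by apply/hA/(trig_diag_eigenvalue _ Pu PA).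
pose RP := map_mx (@complex.Re R) P; pose IP := map_mx (@complex.Im R) P.
pose RT := map_mx (@complex.Re R) T; pose IT := map_mx (@complex.Im R) T.
have RA : map_mx (@complex.Re R) (map_mx (real_complex R) A) = A by apply/matrixP => i j; rewrite !mxE.
have IA : map_mx (@complex.Im R) (map_mx (real_complex R) A) = 0 by apply/matrixP => i j; rewrite !mxE.
have RPA : RP *m A = RT *m RP - IT *m IP.
  by have := map_Re_mulmx P (map_mx (real_complex R) A); rewrite RA IA mulmx0 subr0 PA map_Re_mulmx.
have IPA : IP *m A = RT *m IP + IT *m RP.
  by have := map_Im_mulmx P (map_mx (real_complex R) A); rewrite RA IA mulmx0 add0r PA map_Im_mulmx.
have [a a0 Ta] : exists2 a : R, 0 < a & forall i, RT i i <= - (2 * a).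
  exists ((\big[Num.min/1]_i (- RT i i)) / 2).
    by rewrite divr_gt0//; apply: lt_bigmin => // i _; rewrite mxE oppr_gt0.
  move=> i; rewrite mulrC divfK// lerNr.
  exact: bigmin_le.
pose M : R := 1 + \sum_i \sum_j (`|RT i j| + `|IT i j|).
have M0 : 0 < M by rewrite ltr_pwDl// !sumr_ge0// => i _; rewrite sumr_ge0// => j _; rewrite addr_ge0.
have MT i j : `|RT i j| <= M /\ `|IT i j| <= M.
  have : `|RT i j| + `|IT i j| <= M.
    rewrite /M (bigD1 i)//= (bigD1 j)//=.
    have h1 : 0 <= \sum_(k < N | k != j) (`|RT i k| + `|IT i k|).
      by rewrite sumr_ge0// => k _; rewrite addr_ge0.
    have h2 : 0 <= \sum_(k < N | k != i) \sum_(l < N) (`|RT k l| + `|IT k l|).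
      by rewrite sumr_ge0// => k _; rewrite sumr_ge0// => l _; rewrite addr_ge0.
    lra.
  by move=> H; split; apply: le_trans H; rewrite ?lerDl ?lerDr.
(* each off-diagonal entry carries a factor eta; together they cost at most half
   of the rate 2 a of the diagonal *)
pose eta := Num.min 1 (a / (2 * N%:R * M + 1)).
have K0 : 0 < 2 * N%:R * M + 1 by rewrite ltr_wpDl// !mulr_ge0// ltW.
have eta0 : 0 < eta by rewrite lt_min ltr01/= divr_gt0.
have eta1 : eta <= 1 by rewrite ge_min lexx.
have etaM : 2 * N%:R * (M * eta) <= a.
  have : eta <= a / (2 * N%:R * M + 1) by rewrite ge_min lexx orbT.
  rewrite ler_pdivlMr// => H; apply: le_trans H; nra.
pose D := diag_mx (\row_(i < N) eta ^+ i).
pose D' := diag_mx (\row_(i < N) (eta ^+ i)^-1).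
have DD : D' *m D = 1%:M.
  rewrite /D /D' mulmx_diag -[RHS]diag_const_mx; congr diag_mx.
  by apply/rowP => i; rewrite !mxE mulVf// expf_neq0// gt_eqF.
pose C := col_mx (D *m RP) (D *m IP).
have CE x y : lform C x y = \sum_(i < N) (eta ^+ i * (RP *m x) i 0 * (eta ^+ i * (RP *m y) i 0) +
    eta ^+ i * (IP *m x) i 0 * (eta ^+ i * (IP *m y) i 0)).
  rewrite /lform big_split_ord [RHS]big_split /=; congr (_ + _); apply: eq_bigr => i _;
  by rewrite /C !mul_col_mx ?col_mxEu ?col_mxEd -!mulmxA /D !mul_diag_mx !mxE.
have [c c0 Hc] : exists2 c : R, 0 < c & forall x, c * `|x| ^+ 2 <= lform C x x.
  pose Q := invmx P.
  apply: (@lform_ge _ _ _ (row_mx (map_mx (@complex.Re R) Q *m D') (- map_mx (@complex.Im R) Q *m D'))).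
  rewrite /C mul_row_col !mulmxA -!(mulmxA _ D') DD !mulmx1 mulNmx.
  rewrite -map_Re_mulmx mulVmx//; apply/matrixP => i j; rewrite !mxE.
  by case: (i == j).
exists C, a, c; split=> // x.
pose p (i : 'I_N) : R := (RP *m x) i 0; pose q (i : 'I_N) : R := (IP *m x) i 0.
pose nz (i : 'I_N) : R := (eta ^+ i * p i) ^+ 2 + (eta ^+ i * q i) ^+ 2.
have -> : lform C x x = \sum_i nz i.
  by rewrite CE; apply: eq_bigr => i _; rewrite /nz !expr2.
have term (i j : 'I_N) : eta ^+ i * p i * (eta ^+ i * (RT i j * p j - IT i j * q j)) +
     eta ^+ i * q i * (eta ^+ i * (RT i j * q j + IT i j * p j))
   <= (if i == j then - (2 * a) * nz i else 0) + (M * eta) * (nz i + nz j).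
  have nz0 k : 0 <= nz k by rewrite addr_ge0 ?sqr_ge0.
  have Me0 k : 0 <= (M * eta) * (nz i + nz k) by apply: mulr_ge0; [apply: mulr_ge0; exact: ltW|apply: addr_ge0].
  case: eqVneq => [<-|ij].
    apply: (@le_trans _ _ (RT i i * nz i)); last first.
      apply: (@le_trans _ _ (- (2 * a) * nz i)); last by rewrite lerDl.
      exact: ler_wpM2r (nz0 i) _ _ (Ta i).
    by rewrite /nz le_eqVlt; apply/orP; left; apply/eqP; ring.
  have [lij|] := ltnP i j.
    have T0 : T i j = 0 by have /is_trig_mxP := Tt; apply.
    have -> : RT i j = 0 by rewrite mxE T0.
    have -> : IT i j = 0 by rewrite mxE T0.
    by rewrite !mul0r subrr addr0 !mulr0 addr0 add0r.
  rewrite leq_eqVlt => /orP[/eqP e|lji]; first by rewrite (val_inj e) eqxx in ij.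
  have -> : nz i + nz j = (eta ^+ i * p i) ^+ 2 + (eta ^+ i * q i) ^+ 2 +
     (eta ^+ j * p j) ^+ 2 + (eta ^+ j * q j) ^+ 2 by rewrite /nz; ring.
  rewrite add0r.
  have E : eta ^+ i = eta ^+ (i - j) * eta ^+ j by rewrite -exprD subnK// ltnW.
  have -> : eta ^+ i * p i * (eta ^+ i * (RT i j * p j - IT i j * q j)) +
     eta ^+ i * q i * (eta ^+ i * (RT i j * q j + IT i j * p j)) =
     eta ^+ i * p i * (eta ^+ (i - j) * RT i j * (eta ^+ j * p j) - eta ^+ (i - j) * IT i j * (eta ^+ j * q j)) +
     eta ^+ i * q i * (eta ^+ (i - j) * RT i j * (eta ^+ j * q j) + eta ^+ (i - j) * IT i j * (eta ^+ j * p j)).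
     rewrite E; ring.
  have Hm (t : R) : `|t| <= M -> `|eta ^+ (i - j) * t| <= M * eta.
    move=> tM; rewrite normrM mulrC ler_pM//.
    rewrite ger0_norm; last by apply: exprn_ge0; exact: ltW.
    by rewrite -[leRHS]expr1 ler_wiXn2l// ?subn_gt0//; exact: ltW.
  by apply: re_mul_le; apply: Hm; have [] := MT i j.
rewrite CE !mulmxA RPA IPA !(mulmxDl, mulNmx) -!mulmxA.
apply: (@le_trans _ _ (\sum_i \sum_j ((if i == j then - (2 * a) * nz i else 0) + (M * eta) * (nz i + nz j)))).
  apply: ler_sum => i _.
  apply: (@le_trans _ _ (\sum_(j < N) (eta ^+ i * p i * (eta ^+ i * (RT i j * p j - IT i j * q j)) +
     eta ^+ i * q i * (eta ^+ i * (RT i j * q j + IT i j * p j))))).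
    rewrite big_split/= -!mulr_sumr le_eqVlt; apply/orP; left; apply/eqP.
    have row1 (X : 'M[R]_N) (y : 'cV[R]_N) : (X *m y) i 0 = \sum_(j < N) X i j * y j 0.
      by rewrite mxE.
    have addE (y z : 'cV[R]_N) : (y + z) i 0 = y i 0 + z i 0 by rewrite mxE.
    have oppE (y : 'cV[R]_N) : (- y) i 0 = - y i 0 by rewrite mxE.
    by rewrite sumrB big_split /= -/(p i) -/(q i) !addE !oppE !row1.
  by apply: ler_sum => j _; exact: term.
have sumj (i : 'I_N) : \sum_(j < N) ((if i == j then - (2 * a) * nz i else 0) + M * eta * (nz i + nz j)) =
    - (2 * a) * nz i + M * eta * (nz i *+ N + \sum_(j < N) nz j).
  rewrite big_split/= -big_mkcond/= (big_pred1 i); last by move=> j; rewrite /= eq_sym.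
  by rewrite -mulr_sumr big_split/= sumr_const card_ord.
under eq_bigr do rewrite sumj.
have -> : \sum_(i < N) (- (2 * a) * nz i + M * eta * (nz i *+ N + \sum_(j < N) nz j)) =
    - (2 * a) * (\sum_i nz i) + M * eta * ((\sum_i nz i) *+ N + (\sum_i nz i) *+ N).
  rewrite big_split/= -mulr_sumr; congr (_ + _).
  rewrite -mulr_sumr big_split/=; congr (_ * (_ + _)).
    by rewrite sumrMnl.
  by rewrite sumr_const card_ord.
rewrite -[_ *+ N]mulr_natr.
have : 0 <= \sum_i nz i by apply: sumr_ge0 => i _; rewrite addr_ge0 ?sqr_ge0.
nra.
Qed.
End Lyapunov.

(** * Energy estimates *)

Section Energy.
Context {R : realType} {m N : nat} (C : 'M[R]_(m, N)) (a : R) (a0 : 0 < a).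
Implicit Types w dw r : R -> 'cV[R]_N.

(** Young's inequality gives up half of the decay to absorb the forcing; what
remains is a scalar linear differential inequality. *)
Lemma energy_estimate w dw r (M s t : R) : s <= t ->
  {within `[s, t], continuous w} ->
  (forall u, s < u < t -> is_derive u 1 w (dw u)) ->
  (forall u, s < u < t -> lform C (w u) (dw u) <=
     - a * lform C (w u) (w u) + lform C (w u) (r u)) ->
  (forall u, s < u < t -> lform C (r u) (r u) <= M ^+ 2) ->
  lform C (w t) (w t) <= expR (- a * (t - s)) * lform C (w s) (w s) + (M / a) ^+ 2.
Proof.
move=> st cw Dw Hw Hr.
have -> : (M / a) ^+ 2 = (M ^+ 2 / a) / a by field; rewrite gt_eqF.
apply: (@decay_estimate _ (fun u => lform C (w u) (w u)) (fun u => 2 * lform C (w u) (dw u)));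
  rewrite ?(divr_ge0 (sqr_ge0 _) (ltW a0))//.
- exact: continuous_lform.
- by move=> u sut; apply: is_derive_lform; exact: Dw.
- move=> u sut; have h1 := Hw u sut; have h2 := Hr u sut.
  have h3 := lform_young C (w u) (r u) a0.
  have h4 : lform C (r u) (r u) / a <= M ^+ 2 / a by rewrite ler_pM2r ?invr_gt0.
  lra.
Qed.

(** On the whole line there is no initial value to remember, so a bounded
function is controlled by its forcing alone. *)
Lemma bounded_energy_estimate w dw r (M K : R) :
  (forall u, `|w u| <= K) ->
  (forall u : R, is_derive u 1 w (dw u)) ->
  (forall u, lform C (w u) (dw u) <=
     - a * lform C (w u) (w u) + lform C (w u) (r u)) ->
  (forall u, lform C (r u) (r u) <= M ^+ 2) ->
  forall t, lform C (w t) (w t) <= (M / a) ^+ 2.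
Proof.
move=> wK Dw Hw Hr t; have [c c0 Hc] := lform_le C.
apply: (@decay_past_le _ _ _ (c * K ^+ 2) a) => // T T0.
have st : t - T <= t by rewrite lerBlDr lerDl.
have cw : {within `[t - T, t], continuous w}.
  by apply: continuous_subspaceT => u; exact: is_derive_continuous.
have := @energy_estimate w dw r M (t - T) t st cw.
rewrite subKr => H.
apply: le_trans (H (fun u _ => Dw u) (fun u _ => Hw u) (fun u _ => Hr u)) _.
rewrite lerD2r ler_wpM2l ?expR_ge0//; apply: le_trans (Hc _) _.
rewrite ler_wpM2l ?(ltW c0)// ler_sqr ?nnegrE//.
exact: le_trans (wK t).
Qed.

End Energy.

(** * Global solutions of Lipschitz equations *)

Section Primitive.
Context {R : realType}.

Lemma continuous_primitive_near (f : R -> R) (n : nat) : continuous f ->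
  exists F : R -> R, F 0 = 0 /\ forall t : R, - n.+1%:R < t -> is_derive t 1 F (f t).
Proof.
move=> cf; pose a : R := - n.+1%:R.
pose F x := (\int[lebesgue_measure]_(t in [set` Interval (BLeft a) (BRight x)]) f t)%R.
have DF t : a < t -> is_derive t 1 F (f t).
  move=> nt.
  have := @continuous_FTC1 R f (BLeft a) t (t + 1).
  have -> : t < t + 1 by rewrite ltrDl.
  rewrite /= lte_fin => /(_ isT _ nt (cf t)) [].
    by apply: continuous_compact_integrable; [exact: segment_compact|exact: continuous_subspaceT].
  by rewrite derive1E => ? ?; exact: DeriveDef.
exists (fun x => F x - F 0); split; first by rewrite subrr.
by move=> t nt; have ? := DF t nt; apply: is_derive_eq; rewrite subr0.
Qed.

Lemma same_derive_eq (f g df : R -> R) (a b : R) :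
  (forall t, Num.min a b <= t <= Num.max a b -> is_derive t 1 f (df t)) ->
  (forall t, Num.min a b <= t <= Num.max a b -> is_derive t 1 g (df t)) ->
  f b - g b = f a - g a.
Proof.
wlog ab : a b / a <= b.
  move=> H Hf Hg; have [|/ltW] := leP a b; first by move=> /H; apply.
  by move=> /H H1; symmetry; apply: H1; rewrite minC maxC.
rewrite min_l// max_r// => Hf Hg; apply/eqP; rewrite -subr_eq0.
have D t : t \in `[a, b] -> is_derive t 1 (f \- g) 0.
  rewrite in_itv/= => tab; have ? := Hf t tab; have ? := Hg t tab.
  by apply: is_derive_eq; rewrite subrr.
have [|c _] := @MVT_segment _ (f \- g) (fun=> 0) a b ab (fun x h => D x (subset_itv_oo_cc h)).
  apply: derivable_within_continuous => x /D ?; exact: ex_derive.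
by rewrite /= mul0r => ->.
Qed.

(** Primitives on the half lines ]-n, +oo[ that vanish at 0 agree where two of
them are defined, and glue together. *)
Lemma continuous_primitive (f : R -> R) (s : R) : continuous f ->
  exists F : R -> R, F s = 0 /\ forall t : R, is_derive t 1 F (f t).
Proof.
move=> cf; have H n := continuous_primitive_near n cf.
have [F HF] := choice H.
have FE n p t : (n <= p)%N -> - n.+1%:R < t -> F n t = F p t.
  move=> np nt; have n0 : - n.+1%:R < 0 :> R by rewrite oppr_lt0.
  have npR : - p.+1%:R <= - n.+1%:R :> R by rewrite lerN2 ler_nat ltnS.
  suff: F p t - F n t = F p 0 - F n 0.
    by rewrite (HF n).1 (HF p).1 subrr => /eqP; rewrite subr_eq0 => /eqP.
  apply: (@same_derive_eq _ _ f).
  - move=> u /andP[u1 _]; apply: (HF p).2; apply: lt_le_trans u1.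
    by rewrite lt_min !(le_lt_trans npR).
  - move=> u /andP[u1 _]; apply: (HF n).2; apply: lt_le_trans u1.
    by rewrite lt_min n0.
have FE' n p t : - n.+1%:R < t -> - p.+1%:R < t -> F n t = F p t.
  by have [np|/ltnW pn] := leqP n p; [move=> h _|move=> _ h; symmetry]; apply: FE.
pose b (t : R) := Num.bound `|t|.
have bt (t : R) : - (b t).+1%:R < t.
  have : `|t| < (b t)%:R by apply: archi_boundP.
  by rewrite ltr_norml => /andP[+ _]; apply: le_lt_trans; rewrite lerN2 ler_nat.
pose G (t : R) := F (b t) t.
have DG (t : R) : is_derive t 1 G (f t).
  have bt1 u : `|t - u| < 1 -> - (b t).+1%:R < u.
    have : `|t| < (b t)%:R by apply: archi_boundP.
    rewrite !ltr_norml => /andP[h1 h2] /andP[h3 h4].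
    by rewrite -[(b t).+1]addn1 natrD; lra.
  have D : is_derive t 1 (F (b t)) (f t) by apply: (HF _).2; exact: bt.
  apply: is_derive_near D; apply/nbhs_normP; exists 1 => //= u ut.
  by rewrite /G; apply: FE'; [exact: bt1|exact: bt].
exists (fun t => G t - G s); split; first by rewrite subrr.
by move=> t; have ? := DG t; apply: is_derive_eq; rewrite subr0.
Qed.

End Primitive.

Section CauchyLimit.
Context {R : realType}.

Lemma cauchy_limit_real (u : nat -> R) (b : nat -> R) :
  (forall n m, (n <= m)%N -> `|u m - u n| <= b n) -> b n @[n --> \oo] --> 0 ->
  exists l : R, forall n, `|l - u n| <= b n.
Proof.
move=> H b0.
have cu : cvgn u.
  apply: cauchy_cvg; apply/cauchy_ballP => e e0.
  have [n0 _ Hn0] : \forall n \near \oo, b n < e / 2.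
    have /cvgrPdist_lt/(_ (e / 2)) := b0; rewrite divr_gt0// => /(_ isT).
    by apply: filterS => n; rewrite sub0r normrN; apply: le_lt_trans; exact: ler_norm.
  pose B := [set x | `|x - u n0| < e / 2].
  have BB : \forall x \near u n @[n --> \oo], B x.
    by exists n0 => // n n0n; apply: le_lt_trans (H _ _ n0n) (Hn0 _ _) => /=.
  exists (B, B) => //= -[x y] [/= Bx By]; rewrite -ball_normE/=.
  have -> : x - y = (x - u n0) - (y - u n0) by rewrite opprB addrA subrK.
  by apply: le_lt_trans (ler_normB _ _) _; rewrite [e]splitr ltrD.
exists (limn u) => n; apply/ler_addgt0Pr => e e0.
have /cvgrPdist_le/(_ e e0) [n0 _ Hn0] := cu.
have := Hn0 (maxn n n0) (leq_maxr _ _); have := H n (maxn n n0) (leq_maxl _ _).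
have -> : limn u - u n = (u (maxn n n0) - u n) + (limn u - u (maxn n n0)).
  by rewrite [RHS]addrC addrA subrK.
by move=> h1 h2; apply: le_trans (ler_normD _ _) _; apply: lerD.
Qed.

(** The modulus b is kept as a rate of convergence; it makes limits of functions
uniform where b does not depend on the point. *)
Lemma cauchy_limit (N : nat) (u : nat -> 'cV[R]_N) (b : nat -> R) :
  (forall n m, (n <= m)%N -> `|u m - u n| <= b n) -> b n @[n --> \oo] --> 0 ->
  exists l : 'cV[R]_N, forall n, `|l - u n| <= b n.
Proof.
move=> H b0.
have Hi i : exists l : R, forall n, `|l - u n i 0| <= b n.
  apply: cauchy_limit_real b0 => n m nm; apply: le_trans (H n m nm).
  by have := cV_coord_le (u m - u n) i; rewrite !mxE.
have [l Hl] := choice Hi; exists (\col_i l i) => n.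
apply: cV_norm_le => [|i]; last by rewrite !mxE.
exact: le_trans (normr_ge0 _) (H n n (leqnn n)).
Qed.

End CauchyLimit.

Section Picard.
Context {R : realType} {N : nat}.
Implicit Types (x y : R -> 'cV[R]_N).

Lemma vector_primitive (f : R -> 'cV[R]_N) (s : R) : continuous f ->
  exists F : R -> 'cV[R]_N, F s = 0 /\ forall t : R, is_derive t 1 F (f t).
Proof.
move=> cf.
have H i : exists F : R -> R, F s = 0 /\ forall t : R, is_derive t 1 F (f t i 0).
  apply: continuous_primitive => t.
  by apply: (@continuous_comp _ _ _ f (fun v : 'cV[R]_N => v i 0)); [exact: cf|exact: coord_continuous].
have [F HF] := choice H; exists (fun t => \col_i F i t); split.
  by apply/colP => i; rewrite !mxE (HF i).1.
by move=> t; apply/is_derive_coordP => i; under eq_fun do rewrite mxE; exact: (HF i).2.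
Qed.

Lemma exp_growth_scalar (g dg : R -> R) (B ka s : R) : 0 < ka -> 0 <= B -> g s = 0 ->
  (forall t : R, is_derive t 1 g (dg t)) -> (forall t, s <= t -> dg t <= B * expR (ka * (t - s))) ->
  forall t, s <= t -> g t <= B / ka * expR (ka * (t - s)).
Proof.
move=> ka0 B0 gs Dg Hg t st.
pose w u := g u - B / ka * expR (ka * (u - s)).
have Dw (u : R) : is_derive u 1 w (dg u - B * expR (ka * (u - s))).
  have ? := Dg u; apply: is_derive_eq; rewrite /GRing.scale/=; field.
  by rewrite gt_eqF.
have D1 u : u \in `]s, t[ -> derivable w u 1 by move=> _; have ? := Dw u; exact: ex_derive.
have D2 u : u \in `]s, t[ -> derive1 w u <= 0.
  rewrite in_itv/= => /andP[su _]; have ? := Dw u; rewrite derive1E derive_val.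
  by rewrite subr_le0; apply: Hg; exact: ltW.
have cw : {within `[s, t], continuous w}.
  by apply: continuous_subspaceT => u; have ? := Dw u; apply: is_derive_continuous.
have := ler0_derive1_le_cc D1 D2 cw.
move=> /(_ t s); rewrite !in_itv/= !lexx !st => /(_ isT isT isT).
rewrite /w gs subrr mulr0 expR0 mulr1 sub0r => h.
have : 0 <= B / ka by rewrite divr_ge0// ltW.
lra.
Qed.

(** The weight e^(ka |t - s|) loses a factor ka under integration, on both sides
of s; this makes the integral operator of the equation contracting below. *)
Lemma exp_growth (x dx : R -> 'cV[R]_N) (B ka s : R) : 0 < ka -> 0 <= B -> x s = 0 ->
  (forall t : R, is_derive t 1 x (dx t)) ->
  (forall t, `|dx t| <= B * expR (ka * `|t - s|)) ->
  forall t, `|x t| <= B / ka * expR (ka * `|t - s|).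
Proof.
move=> ka0 B0 xs Dx Hx t.
have main (y dy : R -> R) (u : R) : y s = 0 -> (forall t : R, is_derive t 1 y (dy t)) ->
    (forall t, `|dy t| <= B * expR (ka * `|t - s|)) -> y u <= B / ka * expR (ka * `|u - s|).
  move=> ys Dy Hy; have [su|/ltW us] := leP s u.
    rewrite ger0_norm ?subr_ge0//.
    apply: (@exp_growth_scalar y dy) => // v sv; apply: le_trans (ler_norm _) _.
    by have := Hy v; rewrite (ger0_norm (_ : 0 <= v - s)) ?subr_ge0.
  have D (v : R) : is_derive v 1 (fun v => y (2 * s - v)) (- dy (2 * s - v)).
    have ? := Dy (2 * s - v).
    apply/is_derive1P => e e0; have /is_derive1P/(_ e e0)[d d0 K] := Dy (2 * s - v).
    exists d => // h hd; rewrite -normrN in hd; have := K _ hd; rewrite normrN.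
    have -> : 2 * s - (v + h) = 2 * s - v - h by ring.
    by rewrite scalerN scaleNr.
  have := @exp_growth_scalar (fun v => y (2 * s - v)) (fun v => - dy (2 * s - v)) B ka s ka0 B0.
  have -> : 2 * s - s = s by ring.
  move=> /(_ ys D) H; have := H _ (2 * s - u).
  have -> : 2 * s - (2 * s - u) = u by ring.
  have -> : 2 * s - u - s = s - u by ring.
  rewrite ler0_norm ?subr_le0// opprB; apply.
    move=> v sv; apply: le_trans (ler_norm _) _; rewrite normrN; apply: le_trans (Hy _) _.
    have -> : 2 * s - v - s = - (v - s) by ring.
    by rewrite normrN ger0_norm// subr_ge0.
  lra.
have xD i (u : R) : is_derive u 1 (fun u => x u i 0) (dx u i 0).
  by have /is_derive_coordP := Dx u; apply.
have Hi i u : `|dx u i 0| <= B * expR (ka * `|u - s|).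
  exact: le_trans (cV_coord_le _ _) (Hx u).
apply: cV_norm_le => [|i]; first by rewrite mulr_ge0 ?expR_ge0// divr_ge0// ltW.
rewrite ler_norml; apply/andP; split; last first.
  by apply: (@main _ (fun u => dx u i 0)) => //; rewrite xs mxE.
rewrite lerNl; apply: (@main (fun u => - x u i 0) (fun u => - dx u i 0)) => //.
- by rewrite xs mxE oppr0.
- by move=> u; rewrite normrN.
Qed.

Lemma geometric_telescope (V : normedModType R) (u : nat -> V) (c : R) :
  (forall j, `|u j.+1 - u j| <= c * 2^-1 ^+ j) ->
  forall n m, (n <= m)%N -> `|u m - u n| <= 2 * c * 2^-1 ^+ n.
Proof.
move=> H n m nm.
have c0 : 0 <= c by have := le_trans (normr_ge0 _) (H 0); rewrite expr0 mulr1.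
suff : `|u m - u n| <= 2 * c * (2^-1 ^+ n - 2^-1 ^+ m).
  move=> /le_trans; apply; rewrite ler_wpM2l ?mulr_ge0// gerBl.
  by rewrite exprn_ge0// invr_ge0.
elim: m nm => [|m IH]; first by rewrite leqn0 => /eqP ->; rewrite !subrr normr0 mulr0.
rewrite leq_eqVlt => /orP[/eqP->|]; first by rewrite !subrr normr0 mulr0.
rewrite ltnS => /IH {}IH; have -> : u m.+1 - u n = (u m.+1 - u m) + (u m - u n).
  by rewrite addrA subrK.
apply: le_trans (ler_normD _ _) _; apply: le_trans (lerD (H m) IH) _.
rewrite exprS le_eqVlt; apply/orP; left; apply/eqP.
set a := _ ^+ m; set b := _ ^+ n.
by field.
Qed.

Lemma cvg_half (c : R) : (fun n => c * 2^-1 ^+ n) @ \oo --> 0.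
Proof.
rewrite -(mulr0 c); apply: cvgM; first exact: cvg_cst.
by apply: cvg_expr; rewrite ger0_norm ?invr_ge0// invf_lt1// ltr1n.
Qed.

Lemma half_small (u c : R) : (forall n, u <= c * 2^-1 ^+ n) -> u <= 0.
Proof.
move=> H; apply/ler_addgt0Pr => e e0.
have /cvgrPdist_le/(_ e e0)[n _ Hn] := cvg_half c.
have := Hn n (leqnn n); rewrite sub0r normrN => h.
by rewrite add0r (le_trans (H n))// (le_trans (ler_norm _)).
Qed.

Context (F : R -> 'cV[R]_N -> 'cV[R]_N) (L M : R)
  (FL : forall t (u v : 'cV[R]_N), `|F t u - F t v| <= L * `|u - v|)
  (F0 : forall t, `|F t 0| <= M)
  (Fc : forall u : 'cV[R]_N, continuous (F ^~ u)).

Lemma continuous_along x : continuous x -> continuous (fun t => F t (x t)).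
Proof.
move=> cx t; apply/cvgrPdist_le => e e0.
have L1 : 0 < `|L| + 1 by rewrite ltr_wpDl.
have e1 : 0 < e / 2 / (`|L| + 1) by rewrite !divr_gt0.
have /cvgrPdist_le/(_ _ e1) h1 := cx t.
have /cvgrPdist_le/(_ (e / 2)) := @Fc (x t) t; rewrite divr_gt0// => /(_ isT) h2.
apply: filterS2 h1 h2 => s h1 h2.
have -> : F t (x t) - F s (x s) = (F t (x t) - F s (x t)) + (F s (x t) - F s (x s)).
  by rewrite addrA subrK.
rewrite [e]splitr; apply: le_trans (ler_normD _ _) _; apply: lerD => //.
apply: le_trans (FL _ _ _) _.
apply: (@le_trans _ _ ((`|L| + 1) * `|x t - x s|)).
  by rewrite ler_wpM2r// (le_trans (ler_norm _))// lerDl.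
by rewrite mulrC -ler_pdivlMr.
Qed.

(** Picard iteration; in the norm weighted by an exponential the integral
operator is a contraction on the whole line at once. *)
Theorem global_solution (s : R) (x0 : 'cV[R]_N) :
  exists x, x s = x0 /\ forall t : R, is_derive t 1 x (F t (x t)).
Proof.
have [P HP] : exists P : (R -> 'cV[R]_N) -> R -> 'cV[R]_N, forall f, continuous f ->
    P f s = 0 /\ forall t : R, is_derive t 1 (P f) (f t).
  have H f : exists G : R -> 'cV[R]_N, continuous f ->
      G s = 0 /\ forall t : R, is_derive t 1 G (f t).
    have [cf|ncf] := pselect (continuous f); last by exists (fun=> 0).
    by have [G HG] := vector_primitive s cf; exists G.
  by have [P HP] := choice H; exists P.
pose step x t := x0 + P (fun t => F t (x t)) t.
have Dstep x : continuous x -> forall t : R, is_derive t 1 (step x) (F t (x t)).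
  move=> cx t; have [_ H] := HP _ (continuous_along cx); have ? := H t.
  by apply: is_derive_eq; rewrite add0r.
have stepc x : continuous x -> continuous (step x).
  by move=> cx t; have ? := Dstep x cx t; apply: is_derive_continuous.
have steps x : continuous x -> step x s = x0.
  by move=> cx; rewrite /step (HP _ (continuous_along cx)).1 addr0.
pose L' : R := `|L|.
have FL' t (y z : 'cV[R]_N) : `|F t y - F t z| <= L' * `|y - z|.
  by apply: le_trans (FL _ _ _) _; rewrite ler_wpM2r// ler_norm.
pose ka : R := 2 * L' + 1; have L0 : 0 <= L' by exact: normr_ge0.
have ka0 : 0 < ka by rewrite ltr_wpDl// mulr_ge0.
pose E (t : R) : R := expR (ka * `|t - s|).
have E0 t : 0 <= E t by exact: expR_ge0.
have stepL x y c : continuous x -> continuous y -> (forall t, `|x t - y t| <= c * E t) ->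
    forall t, `|step x t - step y t| <= c / 2 * E t.
  move=> cx cy H t.
  have c0 : 0 <= c by have := le_trans (normr_ge0 _) (H s); rewrite pmulr_lge0// expR_gt0.
  apply: (@le_trans _ _ (L' * c / ka * E t)); last first.
    rewrite ler_wpM2r// ler_pdivrMr// mulrAC ler_pdivlMr// -mulrA mulrC -mulrA ler_wpM2l//.
    by rewrite /ka lerDl.
  apply: (@exp_growth (fun t => step x t - step y t) (fun t => F t (x t) - F t (y t)) (L' * c) ka s) => //.
  - by rewrite mulr_ge0.
  - by rewrite !steps// subrr.
  - by move=> u; have ? := Dstep x cx u; have ? := Dstep y cy u; apply: is_derive_eq.
  - move=> u; apply: le_trans (FL' _ _ _) _; rewrite -mulrA ler_wpM2l//.
pose xs j := iter j step (fun=> x0).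
have cxs j : continuous (xs j).
  by elim: j => [|j IH]; [move=> t; exact: cvg_cst|exact: stepc].
pose B : R := (M + L' * `|x0|) / ka.
have M0 : 0 <= M := le_trans (normr_ge0 _) (F0 0).
have B0 : 0 <= B by rewrite divr_ge0 ?addr_ge0 ?mulr_ge0// ltW.
have d1 t : `|xs 1 t - xs 0 t| <= B * E t.
  apply: (@exp_growth (fun t => xs 1 t - xs 0 t) (fun t => F t x0) (M + L' * `|x0|) ka s) => //.
  - by rewrite addr_ge0// mulr_ge0.
  - by rewrite /= steps ?subrr// => t'; exact: cvg_cst.
  - move=> u; have ? := Dstep _ (cxs 0) u.
    by apply: is_derive_eq; rewrite subr0.
  - move=> u; apply: (@le_trans _ _ (M + L' * `|x0|)).
      have -> : F u x0 = F u 0 + (F u x0 - F u 0) by rewrite addrC subrK.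
      apply: le_trans (ler_normD _ _) _; rewrite lerD ?F0//.
      by apply: le_trans (FL' _ _ _) _; rewrite subr0.
    rewrite ler_peMr ?addr_ge0 ?mulr_ge0// -expR0 ler_expR mulr_ge0//.
    exact: ltW.
have dj j t : `|xs j.+1 t - xs j t| <= B * E t * 2^-1 ^+ j.
  have -> : B * E t * 2^-1 ^+ j = B * 2^-1 ^+ j * E t by rewrite mulrAC.
  elim: j t => [|j IH] t; first by rewrite expr0 mulr1; exact: d1.
  apply: le_trans (stepL _ _ _ (cxs _) (cxs _) IH t) _.
  by rewrite exprSr mulrA.
have dnm t := geometric_telescope (fun j => dj j t).
have [x Hx] := choice (fun t => @cauchy_limit R N (fun n => xs n t) _ (dnm t) (cvg_half (2 * (B * E t)))).
have cx : continuous x.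
  move=> t; apply/cvgrPdist_le => e e0.
  pose Em : R := expR (ka * (`|t - s| + 1)).
  have [n Hn] : exists n, 2 * (B * Em) * 2^-1 ^+ n <= e / 3.
    have /cvgrPdist_le/(_ (e / 3)) := cvg_half (2 * (B * Em)).
    rewrite divr_gt0// => /(_ isT)[n _ Hn]; exists n.
    by have := Hn n (leqnn n); rewrite sub0r normrN; apply: le_trans; exact: ler_norm.
  have close u : `|t - u| < 1 -> `|x u - xs n u| <= e / 3.
    move=> tu; apply: le_trans (Hx u n) _; apply: le_trans Hn.
    rewrite ler_wpM2r ?exprn_ge0 ?invr_ge0// ler_wpM2l// ler_wpM2l// ler_expR ler_wpM2l ?(ltW ka0)//.
    have -> : u - s = (t - s) - (t - u) by ring.
    by apply: le_trans (ler_normB _ _) _; rewrite lerD2l ltW.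
  have /cvgrPdist_le/(_ (e / 3)) := cxs n t; rewrite divr_gt0// => /(_ isT) h1.
  have h2 : \forall u \near t, `|t - u| < 1 by apply/nbhs_normP; exists 1 => //=.
  apply: filterS2 h1 h2 => u h1 h2.
  have h3 := close u h2; have h4 : `|x t - xs n t| <= e / 3 by apply: close; rewrite subrr normr0.
  have -> : x t - x u = (x t - xs n t) + (xs n t - xs n u) - (x u - xs n u).
    by rewrite addrA subrK opprB addrA subrK.
  have := ler_normB ((x t - xs n t) + (xs n t - xs n u)) (x u - xs n u).
  have := ler_normD (x t - xs n t) (xs n t - xs n u).
  lra.
exists x; suff xE : x = step x.
  by split=> [|t]; [rewrite xE steps|rewrite {1}xE; exact: Dstep].
apply/funext => t; apply/eqP; rewrite -subr_eq0 -normr_le0.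
apply: (@half_small _ (2 * (B * E t))) => n.
have h1 := Hx t n.+1.
have h2 : `|step x t - xs n.+1 t| <= 2 * B * 2^-1 ^+ n / 2 * E t.
  apply: (@stepL x (xs n)) => // u; apply: le_trans (Hx u n) _.
  by rewrite le_eqVlt; apply/orP; left; apply/eqP; ring.
have -> : x t - step x t = (x t - xs n.+1 t) - (step x t - xs n.+1 t).
  by rewrite opprB addrA subrK.
apply: le_trans (ler_normB _ _) _; apply: le_trans (lerD h1 h2) _.
by rewrite exprS le_eqVlt; apply/orP; left; apply/eqP; field.
Qed.
End Picard.

(** * Bounded solutions of dissipative equations *)

Section Dissipative.
Context {R : realType} {m N : nat} (C : 'M[R]_(m, N)) (a c : R).
Context (a0 : 0 < a) (c0 : 0 < c)
  (CL : forall x : 'cV[R]_N, c * `|x| ^+ 2 <= lform C x x).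
Implicit Types x y : R -> 'cV[R]_N.

Lemma lform0 (u : 'cV[R]_N) : lform C u 0 = 0.
Proof. by rewrite -(scale0r u) lformZr mul0r. Qed.

Lemma norm_le_lform (u : 'cV[R]_N) (K : R) : 0 <= K -> lform C u u <= c * K ^+ 2 -> `|u| <= K.
Proof.
move=> K0 H; rewrite -ler_sqr ?nnegrE// -(ler_pM2l c0).
exact: le_trans (CL u) H.
Qed.

Lemma lform_eq0 (u : 'cV[R]_N) : lform C u u <= 0 -> u = 0.
Proof.
move=> H; apply/eqP; rewrite -normr_le0; apply: norm_le_lform => //.
by rewrite expr0n mulr0.
Qed.

(** The energy estimate for the difference of two solutions, which satisfies an
equation without forcing. *)
Lemma contraction_estimate x y dx dy (s t : R) : s <= t ->
  {within `[s, t], continuous x} -> {within `[s, t], continuous y} ->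
  (forall u : R, s < u < t -> is_derive u 1 x (dx u)) ->
  (forall u : R, s < u < t -> is_derive u 1 y (dy u)) ->
  (forall u, s < u < t -> lform C (x u - y u) (dx u - dy u)
     <= - a * lform C (x u - y u) (x u - y u)) ->
  lform C (x t - y t) (x t - y t) <=
    expR (- a * (t - s)) * lform C (x s - y s) (x s - y s).
Proof.
move=> st cx cy Dx Dy H.
have := @energy_estimate _ _ _ C a a0 (fun u => x u - y u) (fun u => dx u - dy u) (fun=> 0) 0 s t st.
rewrite mul0r expr0n addr0; apply.
- apply/subspace_continuousP => u su; apply: cvgB.
    by move/subspace_continuousP : cx; apply.
  by move/subspace_continuousP : cy; apply.
- by move=> u su; have ? := Dx u su; have ? := Dy u su; apply: is_derive_eq.
- by move=> u su; rewrite lform0 addr0; exact: H.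
- by move=> u su; rewrite lform0.
Qed.

(** Two bounded solutions have been contracting towards each other since time
-oo. *)
Lemma bounded_solution_unique x y dx dy (K : R) :
  (forall t, `|x t| <= K) -> (forall t, `|y t| <= K) ->
  (forall u : R, is_derive u 1 x (dx u)) -> (forall u : R, is_derive u 1 y (dy u)) ->
  (forall u, lform C (x u - y u) (dx u - dy u) <= - a * lform C (x u - y u) (x u - y u)) ->
  x = y.
Proof.
move=> xK yK Dx Dy H; apply/funext => t; apply/eqP; rewrite -subr_eq0; apply/eqP.
apply: lform_eq0.
have := @bounded_energy_estimate _ _ _ C a a0 (fun u => x u - y u) (fun u => dx u - dy u) (fun=> 0) 0 (K + K).
rewrite mul0r expr0n; apply.
- by move=> u; apply: le_trans (ler_normB _ _) _; apply: lerD.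
- by move=> u; rewrite lform0 addr0.
- by move=> u; rewrite lform0.
Qed.

Context (F : R -> 'cV[R]_N -> 'cV[R]_N) (L M : R)
  (FL : forall t (u v : 'cV[R]_N), `|F t u - F t v| <= L * `|u - v|)
  (F0 : forall t, `|F t 0| <= M)
  (Fc : forall u : 'cV[R]_N, continuous (F ^~ u))
  (FD : forall t (u v : 'cV[R]_N), lform C (u - v) (F t u - F t v) <= - a * lform C (u - v) (u - v)).

(** Starting from rest at ever earlier times gives solutions that forget their
starting time exponentially fast; their limit exists for all times. *)
Theorem bounded_solution : exists x K,
  (forall t : R, is_derive t 1 x (F t (x t))) /\ forall t, `|x t| <= K.
Proof.
have [c' c'0 CU] := lform_le C.
have M0 : 0 <= M := le_trans (normr_ge0 _) (F0 0).
pose M' : R := Num.sqrt (c' * M ^+ 2).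
have c'M : 0 <= c' * M ^+ 2 by rewrite mulr_ge0 ?sqr_ge0 ?(ltW c'0).
have F0' t : lform C (F t 0) (F t 0) <= M' ^+ 2.
  rewrite sqr_sqrtr//; apply: le_trans (CU _) _; rewrite ler_wpM2l ?(ltW c'0)//.
  by rewrite ler_sqr ?nnegrE.
have [xs Hxs] := choice (fun n : nat => global_solution FL F0 Fc (- n%:R) 0).
have Dxs n (t : R) : is_derive t 1 (xs n) (F t (xs n t)) by exact: (Hxs n).2.
have cts x : (forall t : R, is_derive t 1 x (F t (x t))) -> forall s t, {within `[s, t], continuous x}.
  by move=> Dx s t; apply: continuous_subspaceT => u; have ? := Dx u; apply: is_derive_continuous.
have two x y s t : s <= t -> (forall t : R, is_derive t 1 x (F t (x t))) ->
    (forall t : R, is_derive t 1 y (F t (y t))) ->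
    lform C (x t - y t) (x t - y t) <= expR (- a * (t - s)) * lform C (x s - y s) (x s - y s).
  move=> st Dx Dy.
  by apply: (contraction_estimate st (cts _ Dx s t) (cts _ Dy s t) (fun u _ => Dx u) (fun u _ => Dy u)).
pose Q : R := (M' / a) ^+ 2.
have Q0 : 0 <= Q by exact: sqr_ge0.
have xsQ n t : - n%:R <= t -> lform C (xs n t) (xs n t) <= Q.
  move=> nt; have := @energy_estimate _ _ _ C a a0 (xs n) (fun u => F u (xs n u)) (F^~ 0) M' (- n%:R) t nt.
  rewrite (Hxs n).1 lform0 mulr0 add0r; apply => //; first exact: cts.
  move=> u _; have := FD u (xs n u) 0; rewrite subr0 => h.
  by rewrite -[F u (xs n u)](subrK (F u 0)) lformDr lerD2r.
pose q : R := expR (- a).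
have q0 : 0 <= q by exact: expR_ge0.
have q1 : q < 1 by rewrite /q -expR0 ltr_expR oppr_lt0.
have qn i : 0 <= q ^+ i by exact: exprn_ge0.
pose b i : R := Num.sqrt (Q / c * q ^+ i).
have Qc0 : 0 <= Q / c by rewrite divr_ge0// ltW.
have b2 i : b i ^+ 2 = Q / c * q ^+ i by rewrite sqr_sqrtr// mulr_ge0.
have b0 i : 0 <= b i by exact: sqrtr_ge0.
have bcvg : b i @[i --> \oo] --> 0.
  rewrite -(sqrtr0 R); apply: continuous_cvg; first exact: sqrt_continuous.
  rewrite -(mulr0 (Q / c)); apply: cvgM; first exact: cvg_cst.
  by apply: cvg_expr; rewrite ger0_norm.
have bmono i j : (i <= j)%N -> b j <= b i.
  move=> ij; apply: ler_wsqrtr; rewrite ler_wpM2l// ler_wiXn2l//; exact: ltW.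
pose n0 (t : R) := Num.bound `|t|.
have n0t t : - (n0 t)%:R <= t.
  have : `|t| < (n0 t)%:R by apply: archi_boundP.
  by rewrite ltr_norml => /andP[/ltW].
have diff t i j : (i <= j)%N -> `|xs (n0 t + j)%N t - xs (n0 t + i)%N t| <= b i.
  move=> ij; apply: norm_le_lform => //; rewrite b2 mulrA mulrCA divff ?gt_eqF// mulr1.
  have h1 : - (n0 t + i)%:R <= t.
    by apply: le_trans (n0t t); rewrite lerN2 ler_nat leq_addr.
  apply: le_trans (two _ _ _ _ h1 (Dxs _) (Dxs _)) _.
  rewrite (Hxs (n0 t + i)%N).1 subr0 mulrC; apply: ler_pM; rewrite ?lform_ge0 ?expR_ge0//.
    by apply: xsQ; rewrite lerN2 ler_nat leq_add2l.
  rewrite /q -expRM_natl ler_expR [leRHS]mulrC ler_wnM2l ?oppr_le0 ?(ltW a0)//.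
  by rewrite natrD opprK; have := n0t t; lra.
have [x Hx] := choice (fun t => cauchy_limit (diff t) bcvg).
(* from t - 1 on, the limit is the solution through its value at t - 1, because
   solutions depend continuously on that value *)
have Dx (t : R) : is_derive t 1 x (F t (x t)).
  have [y [ys Dy]] := global_solution FL F0 Fc (t - 1) (x (t - 1)).
  have yx u : t - 1 <= u -> x u = y u.
    move=> tu; apply/eqP; rewrite -subr_eq0 -normr_le0.
    pose e : R := Num.sqrt (c' / c).
    have bound i : `|x u - y u| <= (1 + e) * b i.
      pose n := (n0 (t - 1)%R + (n0 u + i))%N.
      have h1 : `|x u - xs n u| <= b i.
        have -> : n = (n0 u + (n0 (t - 1)%R + i))%N by rewrite /n addnCA.
        by apply: le_trans (Hx u _) _; apply: bmono; exact: leq_addl.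
      have h2 : `|x (t - 1) - xs n (t - 1)| <= b i.
        by apply: le_trans (Hx _ _) _; apply: bmono; exact: leq_addl.
      have h3 : `|y u - xs n u| <= e * b i.
        apply: norm_le_lform; first by rewrite mulr_ge0 ?sqrtr_ge0.
        apply: le_trans (two _ _ _ _ tu Dy (Dxs n)) _.
        rewrite ys; apply: (@le_trans _ _ (lform C (x (t - 1) - xs n (t - 1)) (x (t - 1) - xs n (t - 1)))).
          apply: ler_piMl; first exact: lform_ge0.
          by rewrite -[leRHS](@expR0 R) ler_expR mulNr oppr_le0; apply: mulr_ge0; [exact: ltW|rewrite subr_ge0].
        apply: le_trans (CU _) _; rewrite exprMn sqr_sqrtr ?divr_ge0 ?(ltW c0) ?(ltW c'0)//.
        have -> : c * (c' / c * b i ^+ 2) = c' * b i ^+ 2 by field; rewrite gt_eqF.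
        rewrite ler_wpM2l ?(ltW c'0)//.
        by rewrite ler_sqr ?nnegrE.
      have -> : x u - y u = (x u - xs n u) - (y u - xs n u) by rewrite opprB addrA subrK.
      apply: le_trans (ler_normB _ _) _; rewrite mulrDl mul1r; exact: lerD.
    have /cvgrPdist_le H : (fun i => (1 + e) * b i) @ \oo --> (1 + e) * 0.
      by apply: cvgM; [exact: cvg_cst|exact: bcvg].
    apply/ler_addgt0Pr => d d0; have [i _ Hi] := H d d0.
    have := Hi i (leqnn i); rewrite mulr0 sub0r normrN => hi.
    by rewrite add0r; apply: le_trans (bound i) _; apply: le_trans hi; exact: ler_norm.
  have := Dy t; rewrite -(yx t); last by rewrite lerBlDr lerDl.
  apply: is_derive_near; apply/nbhs_normP; exists 1 => //= u ut; rewrite yx//.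
  by have := le_lt_trans (ler_norm (t - u)) ut; lra.
exists x, (Num.sqrt (Q / c) + b 0); split=> // t.
have -> : x t = xs (n0 t) t + (x t - xs (n0 t) t) by rewrite addrC subrK.
apply: le_trans (ler_normD _ _) _; apply: lerD; last by have := Hx t 0; rewrite addn0.
apply: norm_le_lform; first exact: sqrtr_ge0.
rewrite sqr_sqrtr// mulrCA divff ?gt_eqF// mulr1.
exact: xsQ.
Qed.

End Dissipative.

(** * Relative derivatives *)

Section FiniteDimension.
Context {R : realType}.

Definition scalar_linear (V : normedModType R) (f : V -> R) : Prop :=
  (forall a u v, f (a *: u + v) = a * f u + f v) /\
  exists2 K : R, 0 <= K & forall v, `|f v| <= K * `|v|.

Lemma scalar_linearP (V : normedModType R) (f : V -> R) : scalar_linear f -> linear f.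
Proof. by move=> [L _] a u v; exact: L. Qed.

(** A spanning family with bounded linear coordinates. It makes linear maps
bounded and reduces statements about all vectors to finitely many. *)
Definition fin_dim (V : normedModType R) : Prop :=
  exists (n : nat) (b : 'I_n -> V) (c : 'I_n -> V -> R),
    (forall i, scalar_linear (c i)) /\ forall v, v = \sum_i c i v *: b i.

Lemma linear0' (V W : lmodType R) (f : V -> W) : linear f -> f 0 = 0.
Proof. by move=> L; have := L (-1) 0 0; rewrite scaler0 addr0 scaleN1r addNr. Qed.

Lemma linearZ' (V W : lmodType R) (f : V -> W) a u : linear f -> f (a *: u) = a *: f u.
Proof. by move=> L; rewrite -[a *: u]addr0 L linear0'// addr0. Qed.

Lemma linearD' (V W : lmodType R) (f : V -> W) u v : linear f -> f (u + v) = f u + f v.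
Proof. by move=> L; rewrite -[u]scale1r L !scale1r. Qed.

Lemma linearB' (V W : lmodType R) (f : V -> W) u v : linear f -> f (u - v) = f u - f v.
Proof. by move=> L; rewrite -scaleN1r addrC L scaleN1r addrC. Qed.

Lemma linear_sum' (V W : lmodType R) (f : V -> W) I (r : seq I) (k : I -> R) (b : I -> V) :
  linear f -> f (\sum_(i <- r) k i *: b i) = \sum_(i <- r) k i *: f (b i).
Proof.
move=> L; elim: r => [|i r IH]; first by rewrite !big_nil linear0'.
by rewrite !big_cons L IH.
Qed.

Lemma linear_bounded (V W : normedModType R) (f : V -> W) : fin_dim V -> linear f ->
  exists2 K : R, 0 < K & forall v, `|f v| <= K * `|v|.
Proof.
move=> [n [b [c [cL bc]]]] L.
have [K HK] : exists K : 'I_n -> R, forall i, 0 <= K i /\ forall v, `|c i v| <= K i * `|v|.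
  suff /choice[K HK] : forall i, exists K : R, 0 <= K /\ forall v, `|c i v| <= K * `|v|.
    by exists K.
  by move=> i; have [_ [K K0 HK]] := cL i; exists K.
exists (1 + \sum_i K i * `|f (b i)|).
  by rewrite ltr_pwDl// sumr_ge0// => i _; rewrite mulr_ge0// (HK i).1.
move=> v; rewrite {1}(bc v) linear_sum'// mulrDl mul1r.
apply: (@le_trans _ _ ((\sum_i K i * `|f (b i)|) * `|v|)); last by rewrite lerDr.
rewrite mulr_suml; apply: le_trans (ler_norm_sum _ _ _) _; apply: ler_sum => i _.
by rewrite normrZ mulrAC ler_wpM2r// (HK i).2.
Qed.

Lemma fin_dim_real : fin_dim (R : normedModType R).
Proof.
exists 1%N, (fun=> 1), (fun=> id); split.
  by move=> _; split=> // ; exists 1 => // v; rewrite mul1r.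
by move=> v; rewrite big_ord1 /GRing.scale/= mulr1.
Qed.

Lemma fin_dim_cV N : fin_dim ('cV[R]_N : normedModType R).
Proof.
exists N, (fun i => delta_mx i 0), (fun i (v : 'cV[R]_N) => v i 0); split.
  move=> i; split; first by move=> a u v; rewrite !mxE.
  by exists 1 => // v; rewrite mul1r cV_coord_le.
move=> v; apply/colP => i; rewrite summxE (bigD1 i)//= !mxE !eqxx mulr1.
rewrite big1 ?addr0// => j ji; rewrite !mxE eq_sym (negbTE ji)/= mulr0//.
Qed.

Lemma fin_dim_pair (V W : normedModType R) : fin_dim V -> fin_dim W ->
  fin_dim (V * W : normedModType R)%type.
Proof.
move=> [n [b [c [cL bc]]]] [m [d [e [eL de]]]].
exists (n + m)%N,
  (fun i => match fintype.split i with inl j => (b j, 0) | inr j => (0, d j) end),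
  (fun i (v : V * W) => match fintype.split i with inl j => c j v.1 | inr j => e j v.2 end); split.
  move=> i; case: (fintype.split i) => j.
    have [h [K K0 HK]] := cL j; split; first by move=> a u v; exact: h.
    exists K => // v; apply: le_trans (HK _) _; rewrite ler_wpM2l//.
    by rewrite prod_normE le_max lexx.
  have [h [K K0 HK]] := eL j; split; first by move=> a u v; exact: h.
  exists K => // v; apply: le_trans (HK _) _; rewrite ler_wpM2l//.
  by rewrite prod_normE le_max lexx orbT.
move=> [v w]; rewrite big_split_ord /=.
under eq_bigr => i _ do rewrite (unsplitK (inl i)).
under [X in _ + X]eq_bigr => i _ do rewrite (unsplitK (inr i)).
rewrite [v in LHS]bc [w in LHS]de [RHS]surjective_pairing /=.
rewrite !(big_morph fst (id1 := 0) (op1 := +%R))// !(big_morph snd (id1 := 0) (op1 := +%R))//=.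
congr (_, _).
  by rewrite [X in _ = _ + X]big1 ?addr0// => i _; rewrite scaler0.
by rewrite [X in _ = X + _]big1 ?add0r// => i _; rewrite scaler0.
Qed.

End FiniteDimension.

Section Derivative.
Context {R : realType} {V W : normedModType R}.
Implicit Types (S : set V) (f g : V -> W) (df dg : V -> W).

Lemma derivative_within_subset S S' f x df : S' `<=` S ->
  derivative_within S f x df -> derivative_within S' f x df.
Proof.
move=> SS /derivative_withinP[L H]; apply/derivative_withinP; split=> // e e0.
by have [d d0 K] := H e e0; exists d => // y /SS; exact: K.
Qed.

Lemma derivative_within_ext S f g x df : S x -> (forall y, S y -> f y = g y) ->
  derivative_within S f x df -> derivative_within S g x df.
Proof.
move=> Sx fg /derivative_withinP[L H]; apply/derivative_withinP; split=> // e e0.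
by have [d d0 K] := H e e0; exists d => // y Sy; rewrite -!fg//; exact: K.
Qed.

Lemma derivative_within_continuous S f (df : V -> V -> W) : fin_dim V ->
  (forall x, S x -> derivative_within S f x (df x)) -> {within S, continuous f}.
Proof.
move=> fV H; apply/within_continuousP => x Sx e e0.
have /derivative_withinP[L D] := H x Sx.
have [K K0 HK] := linear_bounded fV L.
have [d d0 Hd] := D 1 ltr01.
exists (Num.min d (e / (K + 1))); first by rewrite lt_min d0 divr_gt0// addr_gt0.
move=> y Sy; rewrite lt_min => /andP[yd ye].
have -> : f y - f x = (f y - f x - df x (y - x)) + df x (y - x) by rewrite subrK.
apply: le_trans (ler_normD _ _) _; apply: le_trans (lerD (Hd y Sy yd) (HK _)) _.
by rewrite -mulrDl addrC mulrC -ler_pdivlMr ?addr_gt0//; exact: ltW.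
Qed.

Lemma derivative_within_cst S (w : W) x : derivative_within S (fun=> w) x (fun=> 0).
Proof.
apply/derivative_withinP; split; first by move=> a u v; rewrite scaler0 addr0.
move=> e e0; exists 1 => // y _ _; rewrite subrr subr0 normr0.
by rewrite mulr_ge0 ?(ltW e0).
Qed.

Lemma derivative_within_linear S f x : linear f -> derivative_within S f x f.
Proof.
move=> L; apply/derivative_withinP; split=> // e e0; exists 1 => // y _ _.
by rewrite (linearB' _ _ L) addrN normr0 mulr_ge0 ?(ltW e0).
Qed.

Lemma derivative_withinD S f g x df dg :
  derivative_within S f x df -> derivative_within S g x dg ->
  derivative_within S (fun y => f y + g y) x (fun v => df v + dg v).
Proof.
move=> /derivative_withinP[L1 H1] /derivative_withinP[L2 H2].
apply/derivative_withinP; split.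
  by move=> a u v; rewrite L1 L2 scalerDr addrACA.
move=> e e0; have e2 : 0 < e / 2 by rewrite divr_gt0.
have [d1 d10 K1] := H1 _ e2; have [d2 d20 K2] := H2 _ e2.
exists (Num.min d1 d2); first by rewrite lt_min d10.
move=> y Sy; rewrite lt_min => /andP[y1 y2].
rewrite [e]splitr mulrDl; apply: le_trans (lerD (K1 y Sy y1) (K2 y Sy y2)).
by rewrite -[X in `|X|](_ : (f y - f x - df (y - x)) + (g y - g x - dg (y - x)) = _) ?ler_normD// !opprD addrACA [f y - f x + _]addrACA.
Qed.

(** * Uniqueness of relative derivatives *)

Definition feasible S (x v : V) : Prop :=
  exists2 t0 : R, 0 < t0 & forall t, 0 < t < t0 -> S (x + t *: v).

(** On a product of an open set with [0, e0] every direction or its opposite is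
feasible, also at the boundary. This is what makes relative derivatives unique. *)
Definition thick_at S (x : V) : Prop := forall v, feasible S x v \/ feasible S x (- v).

(** Along a direction that stays in S, a bound on the increments of f is a bound
on its derivative. *)
Lemma derivative_within_feasible S f x df (v : V) (B : R) :
  derivative_within S f x df -> feasible S x v -> 0 <= B ->
  (exists2 t0 : R, 0 < t0 & forall t, 0 < t < t0 -> S (x + t *: v) -> `|f (x + t *: v) - f x| <= B * t) ->
  `|df v| <= B.
Proof.
move=> /derivative_withinP[L D] [t1 t10 F] B0 [t2 t20 H].
apply/ler_addgt0Pr => e e0.
have v0 : 0 < `|v| + 1 by rewrite ltr_wpDl.
have [d d0 K] := D (e / (`|v| + 1)) (divr_gt0 e0 v0).
pose m : R := Num.min (Num.min t1 t2) (d / (`|v| + 1)).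
have m0 : 0 < m by rewrite !lt_min t10 t20 divr_gt0.
pose t : R := m / 2.
have t0 : 0 < t by rewrite divr_gt0.
have tm : t < m by rewrite ltr_pdivrMr// ltr_pMr// ltr1n.
have [tt1 tt2 td] : [/\ t < t1, t < t2 & t < d / (`|v| + 1)].
  by move: tm; rewrite !lt_min => /andP[/andP[-> ->] ->].
have St : S (x + t *: v) by apply: F; rewrite t0.
have tvd : t * `|v| < d.
  by apply: le_lt_trans (_ : t * (`|v| + 1) < _); rewrite ?ler_pM2l ?lerDl// -ltr_pdivlMr.
have xt : x + t *: v - x = t *: v by rewrite addrC addKr.
have := K _ St; rewrite xt normrZ (gtr0_norm t0) => /(_ tvd) h1.
have := H t; rewrite t0 tt2 => /(_ isT St) h2.
set y := f _ - f x in h1 h2.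
have : `|df (t *: v)| <= t * (B + e).
  have -> : df (t *: v) = y - (y - df (t *: v)) by rewrite subKr.
  apply: le_trans (ler_normB _ _) _; rewrite mulrDr [t * B]mulrC; apply: lerD => //.
  apply: le_trans h1 _; rewrite mulrCA ler_pM2l// mulrAC ler_pdivrMr// ler_pM2l//.
  by rewrite lerDl.
by rewrite linearZ'// normrZ (gtr0_norm t0) ler_pM2l.
Qed.

Lemma derivative_within_unique S f x df dg : thick_at S x ->
  derivative_within S f x df -> derivative_within S f x dg -> df = dg.
Proof.
move=> tS D1 D2.
have [L1 _] := D1; have [L2 _] := D2.
have main v : feasible S x v -> df v = dg v.
  move=> Fv; apply/eqP; rewrite -subr_eq0 -normr_le0.
  have D : derivative_within S (fun=> 0 : W) x (fun v => df v - dg v).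
    move: D1 D2 => /derivative_withinP[_ D1] /derivative_withinP[_ D2].
    apply/derivative_withinP; split.
      by move=> a u w; rewrite L1 L2 scalerBr opprD addrACA.
    move=> e e0; have e2 : 0 < e / 2 by rewrite divr_gt0.
    have [d1 d10 K1] := D1 _ e2; have [d2 d20 K2] := D2 _ e2.
    exists (Num.min d1 d2); first by rewrite lt_min d10.
    move=> y Sy; rewrite lt_min => /andP[y1 y2]; rewrite subrr sub0r.
    rewrite [e]splitr mulrDl; apply: le_trans (lerD (K1 y Sy y1) (K2 y Sy y2)).
    apply: le_trans (ler_normB _ _); set p := f y - f x.
    rewrite -normrN opprK; set u1 := df _; set u2 := dg _.
    have -> : p - u1 - (p - u2) = - (u1 - u2) by rewrite opprB [LHS]addrC addrA subrK opprB.
    by rewrite normrN.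
  apply: (derivative_within_feasible D Fv) => //.
  by exists 1 => // t _ _; rewrite subrr normr0 mul0r.
apply/funext => v; have [/main//|/main] := tS v.
by rewrite -scaleN1r !linearZ'// !scaleN1r => /oppr_inj.
Qed.

End Derivative.

Section Calculus.
Context {R : realType}.

Lemma derivative_within_comp (U V W : normedModType R) (S : set U) (T : set V)
    (f : V -> W) (g : U -> V) x df dg : fin_dim U -> fin_dim V ->
  (forall y, S y -> T (g y)) ->
  derivative_within T f (g x) df -> derivative_within S g x dg ->
  derivative_within S (f \o g) x (df \o dg).
Proof.
move=> fU fV ST Df Dg; have [L1 _] := Df; have [L2 _] := Dg.
move: Df Dg => /derivative_withinP[_ Hf] /derivative_withinP[_ Hg].
apply/derivative_withinP; split; first by move=> a u v /=; rewrite L2 L1.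
move=> e e0; have [K1 K10 HK1] := linear_bounded fV L1.
have [K2 K20 HK2] := linear_bounded fU L2.
have K21 : 0 < K2 + 1 by rewrite addr_gt0.
have [d1 d10 H1] := Hf _ (divr_gt0 (divr_gt0 e0 (ltr0n _ 2)) K21).
have [d2 d20 H2] := Hg _ ltr01.
have [d3 d30 H3] := Hg _ (divr_gt0 (divr_gt0 e0 (ltr0n _ 2)) K10).
exists (Num.min (Num.min d2 d3) (d1 / (K2 + 1))); first by rewrite !lt_min d20 d30 divr_gt0.
move=> y Sy; rewrite !lt_min => /andP[/andP[y2 y3] y1].
have gy : `|g y - g x| <= (K2 + 1) * `|y - x|.
  have -> : g y - g x = (g y - g x - dg (y - x)) + dg (y - x) by rewrite subrK.
  apply: le_trans (ler_normD _ _) _; apply: le_trans (lerD (H2 y Sy y2) (HK2 _)) _.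
  by rewrite -mulrDl addrC.
have gd : `|g y - g x| < d1 by apply: le_lt_trans gy _; rewrite mulrC -ltr_pdivlMr.
have h1 := H1 _ (ST _ Sy) gd; have h3 := H3 _ Sy y3.
have -> : (f \o g) y - (f \o g) x - (df \o dg) (y - x) =
    (f (g y) - f (g x) - df (g y - g x)) + df (g y - g x - dg (y - x)).
  by rewrite /= [X in _ = _ + X](linearB' _ _ L1) addrA subrK.
apply: le_trans (ler_normD _ _) _; rewrite [e in leRHS]splitr mulrDl; apply: lerD.
  apply: le_trans h1 _; apply: le_trans (ler_wpM2l _ gy) _.
    by rewrite !divr_ge0// ltW.
  by rewrite mulrA divfK// gt_eqF.
apply: le_trans (HK1 _) _; apply: le_trans (ler_wpM2l (ltW K10) h3) _.
by rewrite mulrA [K1 * _]mulrC divfK// gt_eqF.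
Qed.

Lemma derivative_within_scale (V W : normedModType R) (S : set V) (k : V -> R)
    (f : V -> W) x (dk : V -> R) df : fin_dim V ->
  derivative_within S k x dk -> derivative_within S f x df ->
  derivative_within S (fun y => k y *: f y) x (fun v => dk v *: f x + k x *: df v).
Proof.
move=> fV Dk Df; have [L1 _] := Dk; have [L2 _] := Df.
move: Dk Df => /derivative_withinP[_ Hk] /derivative_withinP[_ Hf].
apply/derivative_withinP; split.
  move=> a u v; rewrite L1 L2 scalerDl !scalerDr addrACA; congr (_ + _).
  by rewrite -[a *: dk u]/(a * dk u) !scalerA [k x * a]mulrC.
move=> e e0; have [K1 K10 HK1] := linear_bounded fV L1.
have [K2 K20 HK2] := linear_bounded fV L2.
pose A : R := 3 * (`|k x| + `|f x| + K1 + K2 + 1).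
have A0 : 0 < A by rewrite /A; have := normr_ge0 (f x); have := normr_ge0 (k x); lra.
pose e' : R := Num.min 1 (e / A).
have e'0 : 0 < e' by rewrite lt_min ltr01/= divr_gt0.
have e'A : A * e' <= e by rewrite mulrC -ler_pdivlMr// ge_min lexx orbT.
have e'1 : e' <= 1 by rewrite ge_min lexx.
have [d1 d10 H1] := Hk _ e'0; have [d2 d20 H2] := Hf _ e'0.
pose d3 : R := e' / (K1 + 1) / (K2 + 1).
have d30 : 0 < d3 by rewrite !divr_gt0// addr_gt0.
exists (Num.min (Num.min d1 d2) d3); first by rewrite !lt_min d10 d20.
move=> y Sy; rewrite !lt_min => /andP[/andP[y1 y2] y3].
have h1 := H1 y Sy y1; have h2 := H2 y Sy y2.
set h := y - x in h1 h2 y3 *.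
have -> : k y *: f y - k x *: f x - (dk h *: f x + k x *: df h) =
    k y *: (f y - f x - df h) + (k y - k x) *: df h + (k y - k x - dk h) *: f x.
  rewrite [k y *: (_ - df h)]scalerBr [(k y - k x) *: df h]scalerBl.
  rewrite [k y *: _ - _ + (_ - _)]addrA subrK scalerBr !scalerBl.
  rewrite [RHS]addrAC -[k y *: f x - _ - _]addrA -opprD addrA subrK.
  by rewrite !opprD !addrA.
have kk : `|k y - k x| <= (K1 + 1) * `|h|.
  have -> : k y - k x = (k y - k x - dk h) + dk h by rewrite subrK.
  apply: le_trans (ler_normD _ _) _; apply: le_trans (lerD h1 (HK1 _)) _.
  by rewrite -mulrDl ler_wpM2r// addrC lerD2l.
have kke : `|k y - k x| * (K2 + 1) <= e'.
  rewrite -ler_pdivlMr ?addr_gt0//; apply: le_trans kk _.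
  by rewrite mulrC -ler_pdivlMr ?addr_gt0// mulrAC ltW.
have ky : `|k y| <= `|k x| + 1.
  have -> : k y = k x + (k y - k x) by rewrite addrC subrK.
  apply: le_trans (ler_normD _ _) _; rewrite lerD2l.
  by have := normr_ge0 (k y - k x); nra.
have n0 := normr_ge0 h.
have b1 : `|k y *: (f y - f x - df h)| <= (`|k x| + 1) * (e' * `|h|).
  by rewrite normrZ; apply: ler_pM.
have b2 : `|(k y - k x) *: df h| <= e' * `|h|.
  rewrite normrZ; apply: le_trans (ler_wpM2l _ (HK2 h)) _ => //.
  rewrite mulrA ler_wpM2r//; apply: le_trans kke.
  by rewrite ler_wpM2l// lerDl.
have b3 : `|(k y - k x - dk h) *: f x| <= e' * `|h| * `|f x|.
  by rewrite normrZ ler_wpM2r.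
have b4 : A * e' * `|h| <= e * `|h| by rewrite ler_wpM2r.
have := ler_normD (k y *: (f y - f x - df h) + (k y - k x) *: df h) ((k y - k x - dk h) *: f x).
have := ler_normD (k y *: (f y - f x - df h)) ((k y - k x) *: df h).
have eh : 0 <= e' * `|h| by rewrite mulr_ge0// ltW.
have : 0 <= `|k x| * (e' * `|h|) by rewrite mulr_ge0.
have : 0 <= `|f x| * (e' * `|h|) by rewrite mulr_ge0.
have : 0 <= K1 * (e' * `|h|) by rewrite mulr_ge0// ltW.
have : 0 <= K2 * (e' * `|h|) by rewrite mulr_ge0// ltW.
move: b1 b2 b3 b4; rewrite /A.
move: (`|k y *: _|) (`|(k y - k x) *: _|) (`|(k y - k x - _) *: _|) (`|_ + _ + _|) (`|_ + _|).
move=> *; lra.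
Qed.

Lemma derivative_within_pair (V W W' : normedModType R) (S : set V) (f : V -> W)
    (g : V -> W') x df dg :
  derivative_within S f x df -> derivative_within S g x dg ->
  derivative_within S (fun y => (f y, g y)) x (fun v => (df v, dg v)).
Proof.
move=> /derivative_withinP[L1 Hf] /derivative_withinP[L2 Hg].
apply/derivative_withinP; split; first by move=> a u v; rewrite L1 L2.
move=> e e0; have [d1 d10 H1] := Hf _ e0; have [d2 d20 H2] := Hg _ e0.
exists (Num.min d1 d2); first by rewrite lt_min d10.
move=> y Sy; rewrite lt_min => /andP[y1 y2].
by rewrite prod_normE ge_max/= H1//= H2.
Qed.

End Calculus.

(** * The class C^n on a set *)

Section ClassCn.
Context {R : realType}.

Lemma Cn_on_ext (V W : normedModType R) n (S : set V) (f g : V -> W) :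
  (forall x, S x -> f x = g x) -> Cn_on n S f -> Cn_on n S g.
Proof.
case: n => [|n] fg /=.
  move=> /within_continuousP H; apply/within_continuousP => x Sx e e0.
  by have [d d0 K] := H x Sx e e0; exists d => // y Sy; rewrite -!fg//; exact: K.
move=> [df [D H]]; exists df; split=> // x Sx.
by apply: derivative_within_ext (D x Sx).
Qed.

Lemma Cn_on_subset (V W : normedModType R) n (S S' : set V) (f : V -> W) :
  S' `<=` S -> Cn_on n S f -> Cn_on n S' f.
Proof.
move=> SS; elim: n f => [|n IH] f /=.
  move=> /within_continuousP H; apply/within_continuousP => x Sx e e0.
  by have [d d0 K] := H x (SS _ Sx) e e0; exists d => // y /SS; exact: K.
move=> [df [D H]]; exists df; split=> [x Sx|v]; last exact: IH.
exact: derivative_within_subset (D x (SS _ Sx)).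
Qed.

Lemma Cn_on_le (V W : normedModType R) n (S : set V) (f : V -> W) : fin_dim V ->
  Cn_on n.+1 S f -> Cn_on n S f.
Proof.
move=> fV; elim: n f => [|n IH] f [df [D H]].
  exact: derivative_within_continuous D.
by exists df; split=> // v; apply: IH; exact: H.
Qed.

Lemma Cn_on_continuous (V W : normedModType R) n (S : set V) (f : V -> W) :
  fin_dim V -> Cn_on n S f -> {within S, continuous f}.
Proof. by move=> fV; elim: n => [//|n IH] /(Cn_on_le fV)/IH. Qed.

Lemma Cn_on_cst (V W : normedModType R) n (S : set V) (w : W) :
  Cn_on n S (fun=> w).
Proof.
elim: n w => [|n IH] w /=; first exact/continuous_subspaceT/cst_continuous.
exists (fun _ _ => 0); split=> [x _|_]; last exact: IH.
exact: derivative_within_cst.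
Qed.

Lemma Cn_on_linear (V W : normedModType R) n (S : set V) (f : V -> W) :
  fin_dim V -> linear f -> Cn_on n S f.
Proof.
move=> fV L; have D x : S x -> derivative_within S f x f.
  by move=> _; exact: derivative_within_linear.
case: n => [|n]; first exact: (derivative_within_continuous (df := fun=> f)).
by exists (fun=> f); split=> // v; exact: Cn_on_cst.
Qed.

Lemma Cn_onD (V W : normedModType R) n (S : set V) (f g : V -> W) :
  Cn_on n S f -> Cn_on n S g -> Cn_on n S (fun x => f x + g x).
Proof.
elim: n f g => [|n IH] f g /=.
  move=> /subspace_continuousP H1 /subspace_continuousP H2.
  by apply/subspace_continuousP => x Sx; apply: cvgD; [exact: H1|exact: H2].
move=> [df [D1 H1]] [dg [D2 H2]]; exists (fun x v => df x v + dg x v); split.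
  by move=> x Sx; apply: derivative_withinD; [exact: D1|exact: D2].
by move=> v; apply: IH.
Qed.

Lemma Cn_on_sum (V W : normedModType R) n (S : set V) I (r : seq I) (f : I -> V -> W) :
  (forall i, Cn_on n S (f i)) -> Cn_on n S (fun x => \sum_(i <- r) f i x).
Proof.
move=> H; elim: r => [|i r IH].
  by apply: Cn_on_ext (Cn_on_cst n S 0) => x _; rewrite big_nil.
by apply: Cn_on_ext (Cn_onD (H i) IH) => x _; rewrite big_cons.
Qed.

Lemma Cn_on_scale (V W : normedModType R) n (S : set V) (k : V -> R) (f : V -> W) :
  fin_dim V -> Cn_on n S k -> Cn_on n S f -> Cn_on n S (fun x => k x *: f x).
Proof.
move=> fV; elim: n k f => [|n IH] k f.
  move=> /subspace_continuousP H1 /subspace_continuousP H2.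
  by apply/subspace_continuousP => x Sx; apply: cvgZ; [exact: H1|exact: H2].
move=> /[dup] Hk [dk [D1 H1]] /[dup] Hf [df [D2 H2]].
exists (fun x v => dk x v *: f x + k x *: df x v); split.
  by move=> x Sx; apply: derivative_within_scale => //; [exact: D1|exact: D2].
by move=> v; apply: Cn_onD; [exact: IH (H1 v) (Cn_on_le fV Hf)|exact: IH (Cn_on_le fV Hk) (H2 v)].
Qed.

Lemma Cn_on_linear_comp (V W W' : normedModType R) n (S : set V) (f : V -> W) (l : W -> W') :
  fin_dim V -> fin_dim W -> linear l -> Cn_on n S f -> Cn_on n S (l \o f).
Proof.
move=> fV fW L; elim: n f => [|n IH] f.
  have [K K0 HK] := linear_bounded fW L.
  move=> /within_continuousP H; apply/within_continuousP => x Sx e e0.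
  have [d d0 Hd] := H x Sx _ (divr_gt0 e0 K0); exists d => // y Sy yx.
  rewrite /= -(linearB' _ _ L); apply: le_trans (HK _) _.
  by rewrite mulrC -ler_pdivlMr//; exact: Hd.
move=> [df [D H]]; exists (fun x v => l (df x v)); split; last by move=> v; exact: IH _ (H v).
move=> x Sx; apply: (derivative_within_comp (T := setT) (dg := df x)) => //.
- exact: derivative_within_linear.
- exact: D.
Qed.

(** The derivative of the composite at x is expanded over a finite family of
vectors: a sum of products of functions of one degree less. *)
Lemma Cn_on_comp (U V W : normedModType R) n (S : set U) (T : set V)
    (f : V -> W) (g : U -> V) : fin_dim U -> fin_dim V ->
  (forall y, S y -> T (g y)) ->
  Cn_on n T f -> Cn_on n S g -> Cn_on n S (f \o g).
Proof.
move=> fU fV ST; have [m [b [c [cL bc]]]] := fV.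
elim: n f => [|n IH] f.
  move=> /within_continuousP H1 /within_continuousP H2.
  apply/within_continuousP => x Sx e e0.
  have [d d0 Hd] := H1 _ (ST _ Sx) e e0.
  have [d' d'0 Hd'] := H2 _ Sx (d / 2) (divr_gt0 d0 (ltr0n _ 2)).
  exists d' => // y Sy yx; apply: Hd; first exact: ST.
  by apply: le_lt_trans (Hd' _ Sy yx) _; rewrite ltr_pdivrMr// ltr_pMr// ltr1n.
move=> [df [D1 H1]] /[dup] Hg [dg [D2 H2]].
exists (fun x u => df (g x) (dg x u)); split.
  by move=> x Sx; apply: (derivative_within_comp fU fV ST (D1 _ (ST _ Sx)) (D2 _ Sx)).
move=> u; apply: (@Cn_on_ext _ _ _ _ (fun x => \sum_i c i (dg x u) *: df (g x) (b i))).
  move=> x Sx; have [L _] := D1 _ (ST _ Sx).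
  by rewrite {2}(bc (dg x u)) linear_sum'.
apply: Cn_on_sum => i; apply: Cn_on_scale => //.
  by apply: (@Cn_on_linear_comp _ _ _ _ _ (fun x => dg x u) (c i)) => //; [exact: scalar_linearP|exact: H2].
by apply: (IH (fun y => df y (b i))); [exact: H1|exact: Cn_on_le].
Qed.

Lemma Cn_on_pair (V W W' : normedModType R) n (S : set V) (f : V -> W) (g : V -> W') :
  Cn_on n S f -> Cn_on n S g -> Cn_on n S (fun x => (f x, g x)).
Proof.
elim: n f g => [|n IH] f g /=.
  move=> /subspace_continuousP H1 /subspace_continuousP H2.
  by apply/subspace_continuousP => x Sx; apply: cvg_pair; [exact: H1|exact: H2].
move=> [df [D1 H1]] [dg [D2 H2]]; exists (fun x v => (df x v, dg x v)); split.
  by move=> x Sx; apply: derivative_within_pair; [exact: D1|exact: D2].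
by move=> v; apply: IH.
Qed.

End ClassCn.

(** * Mean value inequality and compactness *)

Section MeanValue.
Context {R : realType}.

Lemma path_majorant_scalar (g dg b db : R -> R) :
  {within `[0, 1], continuous g} -> (forall s : R, 0 < s < 1 -> is_derive s 1 g (dg s)) ->
  (forall s : R, is_derive s 1 b (db s)) -> (forall s, 0 < s < 1 -> dg s <= db s) ->
  forall s, 0 <= s <= 1 -> g s - g 0 <= b s - b 0.
Proof.
move=> gc Dg Db Hd s s01.
pose w u := g u - b u.
have Dw (u : R) : 0 < u < 1 -> is_derive u 1 w (dg u - db u).
  by move=> u01; have ? := Dg u u01; have ? := Db u; apply: is_derive_eq.
have D1 u : u \in `]0, 1[ -> derivable w u 1.
  by rewrite in_itv/= => u01; have ? := Dw u u01; exact: ex_derive.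
have D2 u : u \in `]0, 1[ -> derive1 w u <= 0.
  rewrite in_itv/= => u01; have ? := Dw u u01; rewrite derive1E derive_val.
  by rewrite subr_le0; apply: Hd.
have cw : {within `[0, 1], continuous w}.
  move=> u; apply: continuousB; first exact: gc.
  by apply: continuous_subspaceT => {}u; have ? := Db u; apply: is_derive_continuous.
have /andP[s0 s1] := s01.
have := ler0_derive1_le_cc D1 D2 cw.
by move=> /(_ s 0); rewrite !in_itv/= lexx s01 ler01 s0 => /(_ isT isT isT); rewrite /w; lra.
Qed.

(** The drift D is subtracted so that the same inequality yields Lipschitz bounds
(D = 0) and first order expansions. *)
Lemma path_majorant (N : nat) (g dg : R -> 'cV[R]_N) (D : 'cV[R]_N) (b db : R -> R) :
  {within `[0, 1], continuous g} -> (forall s : R, 0 < s < 1 -> is_derive s 1 g (dg s)) ->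
  (forall s : R, is_derive s 1 b (db s)) -> (forall s, 0 < s < 1 -> `|dg s - D| <= db s) ->
  (forall s, 0 <= s <= 1 -> b 0 <= b s) ->
  forall s, 0 <= s <= 1 -> `|g s - g 0 - s *: D| <= b s - b 0.
Proof.
move=> gc Dg Db Hd bm s s01; apply: cV_norm_le => [|i]; first by rewrite subr_ge0 bm.
have Dgi (u : R) : 0 < u < 1 -> is_derive u 1 (fun s => g s i 0) (dg u i 0).
  by move=> u01; have /is_derive_coordP := Dg u u01; apply.
have cgi : {within `[0, 1], continuous (fun s => g s i 0)}.
  move/within_continuousP : gc => gc; apply/within_continuousP => u u01 e e0.
  have [d d0 H] := gc u u01 e e0; exists d => // t t01 ts.
  by apply: le_trans (H t t01 ts); have := cV_coord_le (g t - g u) i; rewrite !mxE.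
have Hi u : 0 < u < 1 -> `|dg u i 0 - D i 0| <= db u.
  by move=> u01; apply: le_trans (Hd u u01); have := cV_coord_le (dg u - D) i; rewrite !mxE.
have lin_c (c : R) : {within `[0, 1], continuous (fun u : R => c * u)}.
  by apply: continuous_subspaceT => u; apply: mulrl_continuous.
rewrite !mxE ler_norml; apply/andP; split.
  have := @path_majorant_scalar (fun u => D i 0 * u - g u i 0) (fun u => D i 0 - dg u i 0) b db.
  move=> /(_ _ _ Db _ s s01); rewrite mulr0 sub0r => H.
  suff : D i 0 * s - g s i 0 - - g 0 i 0 <= b s - b 0 by lra.
  apply: H.
  - by move=> u; apply: continuousB; [exact: lin_c | exact: cgi].
  - move=> u u01; have ? := Dgi u u01; apply: is_derive_eq.
    by rewrite /GRing.scale/= mulr1.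
  - by move=> u u01; have := Hi u u01; rewrite ler_norml => /andP[+ _]; lra.
have := @path_majorant_scalar (fun u => g u i 0 - D i 0 * u) (fun u => dg u i 0 - D i 0) b db.
move=> /(_ _ _ Db _ s s01); rewrite mulr0 subr0 => H.
suff : g s i 0 - D i 0 * s - g 0 i 0 <= b s - b 0 by lra.
apply: H.
- by move=> u; apply: continuousB; [exact: cgi | exact: lin_c].
- move=> u u01; have ? := Dgi u u01; apply: is_derive_eq.
  by rewrite /GRing.scale/= mulr1.
- by move=> u u01; have := Hi u u01; rewrite ler_norml => /andP[_ +]; lra.
Qed.

Context {V : normedModType R} {N : nat}.

Lemma segment_path (S : set V) (f : V -> 'cV[R]_N) df (x y : V) : fin_dim V ->
  (forall s, 0 <= s <= 1 -> S (x + s *: (y - x))) ->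
  (forall z, S z -> derivative_within S f z (df z)) ->
  {within `[0, 1], continuous (fun s : R => f (x + s *: (y - x)))} /\
  forall s : R, 0 < s < 1 ->
    is_derive s 1 (fun s : R => f (x + s *: (y - x))) (df (x + s *: (y - x)) (y - x)).
Proof.
move=> fV seg Df; set v := y - x in seg *.
have diff s h : x + (s + h) *: v - (x + s *: v) = h *: v.
  by rewrite [X in x + X]scalerDl addrA [x + _ + _]addrC addrK.
split.
  apply/within_continuousP => s /=; rewrite in_itv/= => s01 e e0.
  have cf : {within S, continuous f} := derivative_within_continuous fV Df.
  have /within_continuousP/(_ _ (seg s s01) e e0)[d d0 Hd] := cf.
  have v0 : 0 < `|v| + 1 by rewrite ltr_wpDl.
  exists (d / (`|v| + 1)); first by rewrite divr_gt0.
  move=> t; rewrite in_itv/= => t01 h1; apply: Hd; first exact: seg.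
  have -> : t = s + (t - s) by rewrite addrC subrK.
  rewrite diff normrZ; move: h1; rewrite ltr_pdivlMr//; apply: le_lt_trans.
  by rewrite ler_wpM2l// lerDl.
move=> s /andP[s0 s1].
have Ss : S (x + s *: v) by apply: seg; rewrite !ltW.
have /derivative_withinP[L H] := Df _ Ss.
apply/is_derive1P => e e0.
have v0 : 0 < `|v| + 1 by rewrite ltr_wpDl.
have [d d0 Hd] := H _ (divr_gt0 e0 v0).
exists (Num.min (d / (`|v| + 1)) (Num.min s (1 - s))).
  by rewrite !lt_min s0 subr_gt0 s1 divr_gt0.
move=> h; rewrite !lt_min => /and3P[hd hs h1].
have Ssh : S (x + (s + h) *: v).
  apply: seg; move: hs h1; rewrite !ltr_norml => /andP[? ?] /andP[? ?]; lra.
have := Hd _ Ssh; rewrite diff normrZ (linearZ' _ _ L).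
have hv : `|h| * `|v| <= `|h| * (`|v| + 1) by rewrite ler_wpM2l// lerDl.
have hd' : `|h| * `|v| < d by apply: le_lt_trans hv _; rewrite -ltr_pdivlMr.
move=> /(_ hd') K; apply: le_trans K _.
apply: le_trans (ler_wpM2l _ hv) _; first by rewrite divr_ge0// ltW.
by rewrite [`|h| * _]mulrC mulrA divfK ?gt_eqF.
Qed.

Lemma segment_mean_value (S : set V) (f : V -> 'cV[R]_N) df (x y : V) (D : 'cV[R]_N) (B : R) :
  fin_dim V ->
  (forall s, 0 <= s <= 1 -> S (x + s *: (y - x))) ->
  (forall z, S z -> derivative_within S f z (df z)) ->
  0 <= B ->
  (forall s, 0 < s < 1 -> `|df (x + s *: (y - x)) (y - x) - D| <= B) ->
  `|f y - f x - D| <= B.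
Proof.
move=> fV seg Df B0 HB; have [gc Dg] := segment_path fV seg Df.
have Db (s : R) : is_derive s 1 (fun s => B * s) B.
  by apply: is_derive_eq; rewrite /GRing.scale/= mulr1.
have Bm s : 0 <= s <= 1 -> B * 0 <= B * s.
  by move=> /andP[s0 _]; rewrite mulr0 mulr_ge0.
have := path_majorant gc Dg Db HB Bm; move=> /(_ 1); rewrite ler01 lexx => /(_ isT); have -> : x + 1 *: (y - x) = y by rewrite scale1r addrC subrK.
by rewrite scale1r scale0r addr0 mulr0 mulr1 subr0.
Qed.

End MeanValue.

Section Compactness.
Context {R : realType}.

Lemma compact_cluster_seq (V : normedModType R) (Q : set V) (u : nat -> V) :
  compact Q -> (forall n, Q (u n)) ->
  exists2 c, Q c & forall d : R, 0 < d -> forall n0, exists2 n, (n0 <= n)%N & `|u n - c| < d.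
Proof.
move=> cQ uQ; have [|c [Qc Hc]] := cQ (u @ \oo) _; first by exists 0%N => // n _; exact: uQ.
exists c => // d d0 n0.
have [||z [[n /= n0n <-] /= uc]] := Hc (u @` [set n | (n0 <= n)%N]) [set z | `|z - c| < d].
- by exists n0 => // n /= n0n; exists n.
- by apply/nbhs_normP; exists d => // z /=; rewrite distrC.
by exists n.
Qed.

(** Heine's theorem for a function that is continuous relative to a set which
need not be compact. *)
Lemma compact_uniform (V W : normedModType R) (A Q : set V) (g : V -> W) :
  compact Q -> Q `<=` A -> {within A, continuous g} -> forall e : R, 0 < e ->
  exists2 d : R, 0 < d & forall x y, Q x -> Q y -> `|x - y| < d -> `|g x - g y| <= e.
Proof.
move=> cQ QA cg e e0; apply: contrapT => H.
have Hn (n : nat) : exists z : V * V, [/\ Q z.1, Q z.2, `|z.1 - z.2| < n.+1%:R^-1 &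
    e < `|g z.1 - g z.2| ].
  apply: contrapT => Hn; apply: H; exists n.+1%:R^-1; first by rewrite invr_gt0.
  move=> x y Qx Qy xy; rewrite leNgt; apply/negP => gxy; apply: Hn.
  by exists (x, y).
have [z Hz] := choice Hn.
have [c Qc Hc] := compact_cluster_seq cQ (u := fun n => (z n).1) (fun n => (let: And4 h _ _ _ := Hz n in h) : Q (z n).1).
move/within_continuousP : cg => /(_ c (QA _ Qc) (e / 2) (divr_gt0 e0 (ltr0n _ 2)))[d d0 Hd].
have [n0 Hn0] : exists n0 : nat, n0.+1%:R^-1 < d / 2.
  have [n0 h] := ltr_add_invr (divr_gt0 d0 (ltr0n R 2)).
  by exists n0; move: h; rewrite add0r.
have [n n0n uc] := Hc (d / 2) (divr_gt0 d0 (ltr0n _ 2)) n0.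
have [q1 q2 z12 gz] := Hz n.
have h1 : `|g (z n).1 - g c| <= e / 2.
  by apply: Hd; [exact: QA|apply: lt_le_trans uc _; rewrite ler_pdivrMr// ler_pMr// ler1n].
have h2 : `|g (z n).2 - g c| <= e / 2.
  apply: Hd; first exact: QA.
  have -> : (z n).2 - c = ((z n).1 - c) - ((z n).1 - (z n).2).
    by rewrite opprB [RHS]addrC addrA subrK.
  apply: le_lt_trans (ler_normB _ _) _; rewrite [d]splitr ltrD//.
  apply: lt_trans z12 _; apply: le_lt_trans Hn0.
  by rewrite lef_pV2 ?posrE// ler_nat ltnS.
have : `|g (z n).1 - g (z n).2| <= e.
  have -> : g (z n).1 - g (z n).2 = (g (z n).1 - g c) - (g (z n).2 - g c).
    by rewrite opprB addrA subrK.
  by apply: le_trans (ler_normB _ _) _; rewrite [e]splitr lerD.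
by rewrite leNgt gz.
Qed.

Lemma compact_norm_bounded (V W : normedModType R) (A Q : set V) (g : V -> W) :
  compact Q -> Q `<=` A -> {within A, continuous g} ->
  exists2 M : R, 0 < M & forall x, Q x -> `|g x| <= M.
Proof.
move=> cQ QA cg; apply: contrapT => H.
have Hn (n : nat) : exists2 z : V, Q z & n%:R < `|g z|.
  apply: contrapT => Hn; apply: H; exists n.+1%:R => // x Qx.
  rewrite leNgt; apply/negP => gx; apply: Hn; exists x => //.
  by apply: le_lt_trans gx; rewrite ler_nat.
have [z Hz Hgz] : exists2 z : nat -> V, (forall n, Q (z n)) & forall n, n%:R < `|g (z n)|.
  have /choice[z Hz] : forall n : nat, exists z : V, Q z /\ n%:R < `|g z|.
    by move=> n; have [z h1 h2] := Hn n; exists z.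
  by exists z => n; have [] := Hz n.
have [c Qc Hc] := compact_cluster_seq cQ Hz.
move/within_continuousP : cg => /(_ c (QA _ Qc) 1 ltr01)[d d0 Hd].
have [n n0n uc] := Hc d d0 (Num.bound (`|g c| + 1)).
have : `|g (z n)| <= `|g c| + 1.
  have -> : g (z n) = g c + (g (z n) - g c) by rewrite addrC subrK.
  apply: le_trans (ler_normD _ _) _; rewrite lerD2l.
  by apply: Hd => //; exact: QA.
have : `|g c| + 1 < (Num.bound (`|g c| + 1))%:R by apply: archi_boundP; rewrite addr_ge0.
have : (Num.bound (`|g c| + 1))%:R <= n%:R :> R by rewrite ler_nat.
have := Hgz n; lra.
Qed.

Lemma cV_box_compact (N : nat) (a b : R) :
  compact [set x : 'cV[R]_N | forall i, a <= x i 0 <= b].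
Proof.
have cr := @rV_compact R N (fun=> `[a, b]%classic) (fun=> @segment_compact R a b).
have -> : [set x : 'cV[R]_N | forall i, a <= x i 0 <= b] =
    trmx @` [set v : 'rV[R]_N | forall i, `[a, b]%classic (v ord0 i)].
  apply/seteqP; split => x /=.
    by move=> H; exists x^T; rewrite ?trmxK// => i; rewrite mxE in_itv/=; exact: H.
  by move=> [v H <-] i; rewrite mxE; have := H i; rewrite in_itv.
apply: continuous_compact => //.
apply/(@within_continuousP R 'rV[R]_N 'cV[R]_N) => v _ e e0; exists e => // w _ /ltW vw.
apply: cV_norm_le; first exact: ltW.
move=> i; rewrite !mxE; apply: le_trans vw.
rewrite [`|w - v|]mx_normrE.
have := @le_bigmax _ _ _ 0 (fun ij : 'I_1 * 'I_N => `|(w - v) ij.1 ij.2|) (0, i).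
by rewrite /= !mxE.
Qed.

End Compactness.

(** * Functions on the extended phase space *)

Section Torus.
Context {R : realType} {k : nat} (Omega : 'cV[R]_k) (e0 : R) (e00 : 0 < e0).
Local Notation Lam := ('cV[R]_k * R)%type.

(** The parameters of the system are the phase and epsilon; time acts on them by
translation along [drift]. *)
Definition drift : Lam := (Omega, 0).
Definition params : set Lam := setT `*` `[0, e0].
Definition period (j : 'I_k) : Lam := ((2 * pi) *: delta_mx j 0, 0).

Lemma params_drift p t : params p -> params (p + t *: drift).
Proof. by move=> [_ h]; split=> //=; rewrite scaler0 addr0. Qed.

Lemma params_period p j : params p -> params (p + period j).
Proof. by move=> [_ h]; split=> //=; rewrite addr0. Qed.

Lemma params_convex p q s : params p -> params q -> 0 <= s <= 1 ->
  params (p + s *: (q - p)).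
Proof.
move=> [_ hp] [_ hq] /andP[s0 s1]; split=> //=; move: hp hq; rewrite /= !in_itv/=.
move=> /andP[p0 p1] /andP[q0 q1]; rewrite /GRing.scale/=; apply/andP; split; nra.
Qed.

Lemma thick_params {V : normedModType R} (U : set V) (z : V * Lam) : open U ->
  (U `*` params) z -> thick_at (U `*` params) z.
Proof.
move=> oU [Uz Pz].
have fe (v : V * Lam) : feasible `[0, e0]%classic z.2.2 v.2.2 -> feasible (U `*` params) z v.
  move=> [t0 t00 Ht].
  have /nbhs_normP[r /= r0 Hr] : nbhs z.1 U by apply: open_nbhs_nbhs; split.
  have v0 : 0 < `|v.1| + 1 by rewrite ltr_wpDl.
  exists (Num.min t0 (r / (`|v.1| + 1))); first by rewrite lt_min t00 divr_gt0.
  move=> t; rewrite lt_min => /and3P[tp tt0 tr]; split; last first.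
    by split=> //; apply: Ht; rewrite tp.
  apply: Hr => /=; rewrite opprD addrA subrr sub0r normrN normrZ gtr0_norm//.
  apply: le_lt_trans (_ : t * (`|v.1| + 1) < _); first by rewrite ler_pM2l// lerDl.
  by rewrite -ltr_pdivlMr.
have main (x v : R) : x \in `[0, e0] -> feasible `[0, e0]%classic x v \/ feasible `[0, e0]%classic x (- v).
  wlog v0 : v / 0 <= v.
    move=> H; have [|/ltW v0] := leP 0 v; first exact: H.
    by have := H (- v); rewrite oppr_ge0 opprK => /(_ v0) h /h[]; [right|left].
  rewrite in_itv/= => /andP[x0 x1].
  have v1 : 0 < v + 1 by rewrite ltr_wpDl.
  have [xe|ex] := ltP x e0; [left|right].
    exists ((e0 - x) / (v + 1)); first by rewrite divr_gt0// subr_gt0.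
    move=> t /andP[t0]; rewrite ltr_pdivlMr// => tx; rewrite /= in_itv/= /GRing.scale/=.
    apply/andP; split; nra.
  exists (x / (v + 1)); first by rewrite divr_gt0//; apply: lt_le_trans ex.
  move=> t /andP[t0]; rewrite ltr_pdivlMr// => tx; rewrite /= in_itv/= /GRing.scale/=.
  apply/andP; split; nra.
by move=> v; have [h|h] := main _ v.2.2 Pz.2; [left|right]; exact: fe.
Qed.

Section PeriodicFunctions.
Context {V : normedModType R} (U : set V).

Definition torus_periodic {W : Type} (g : V * Lam -> W) : Prop :=
  forall x p j, U x -> params p -> g (x, p + period j) = g (x, p).

Definition lattice (m : 'I_k -> int) : 'cV[R]_k := \col_j ((m j)%:~R * (2 * pi)).

Lemma torus_periodic_lattice {W : Type} (g : V * Lam -> W) x p m : torus_periodic g ->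
  U x -> params p -> g (x, p + (lattice m, 0)) = g (x, p).
Proof.
move=> gP Ux.
have nat1 j (n : nat) q : params q -> g (x, q + period j *+ n) = g (x, q).
  elim: n q => [|n IH] q Sq; first by rewrite addr0.
  by rewrite mulrS addrA IH ?gP//; exact: params_period.
have paramsE (q : Lam) (v : 'cV[R]_k) : params q -> params (q + (v, 0)).
  by move=> [_ h]; split=> //=; rewrite addr0.
have perE j (n : nat) : period j *+ n = (n%:R *: ((2 * pi) *: delta_mx j 0), 0).
  elim: n => [|n IH]; first by rewrite mulr0n scale0r.
  by rewrite mulrS IH /period -[n.+1]add1n natrD scalerDl scale1r; congr (_, _); rewrite /= addr0.
have int1 j (z : int) q : params q -> g (x, q + (z%:~R *: ((2 * pi) *: delta_mx j 0), 0)) = g (x, q).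
  move=> Sq; case: z => n; first by rewrite -[RHS](nat1 j n q)// perE.
  rewrite NegzE -[in RHS](subrK (period j *+ n.+1) q) nat1; last first.
    by rewrite perE -[- _]/(- _, - _) oppr0; exact: paramsE.
  by rewrite perE mulrNz scaleNr -[- _ in RHS]/(- _, - _) oppr0.
have sumE : (lattice m, 0 : R) = \sum_j (((m j)%:~R *: ((2 * pi) *: delta_mx j 0), 0) : Lam).
  rewrite [RHS]surjective_pairing.
  rewrite !(big_morph fst (id1 := 0) (op1 := +%R))// !(big_morph snd (id1 := 0) (op1 := +%R))//=.
  congr (_, _); last by rewrite big1.
  apply/colP => i; rewrite summxE (bigD1 i)//= big1 ?addr0 => [|j ji].
    by rewrite !mxE !eqxx mulr1.
  by rewrite !mxE eq_sym (negbTE ji) !mulr0.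
rewrite sumE; elim: (index_enum _) p => [|j r IH] p Sp; first by rewrite big_nil addr0.
by rewrite big_cons addrA IH ?int1//; exact: paramsE.
Qed.

Lemma lattice_reduce (phi : 'cV[R]_k) : exists m, forall i,
  0 <= (phi + lattice m) i 0 <= 2 * pi.
Proof.
exists (fun j => - Num.floor (phi j 0 / (2 * pi))) => i; rewrite !mxE.
have p0 : 0 < 2 * pi :> R by rewrite mulr_gt0// pi_gt0.
have /andP[h1 h2] := floor_itv (phi i 0 / (2 * pi)).
rewrite mulrNz mulNr; move: h1 h2; rewrite ler_pdivlMr// ltr_pdivrMr// intrD mulrDl mul1r.
by move=> h1 h2; apply/andP; split; lra.
Qed.

End PeriodicFunctions.

Section PeriodicCompactness.
Context {N : nat} (U : set 'cV[R]_N) (rho : R) (rhoU : forall x : 'cV[R]_N, `|x| <= rho -> U x).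
Context {W : normedModType R} (g : 'cV[R]_N * Lam -> W).
Context (gc : {within U `*` params, continuous g}) (gP : torus_periodic U g).

Let Q : set ('cV[R]_N * Lam) := [set x : 'cV[R]_N | forall i, - rho <= x i 0 <= rho] `*`
  ([set phi : 'cV[R]_k | forall i, - 1 <= phi i 0 <= 2 * pi + 1] `*` `[0, e0]%classic).

Let cQ : compact Q.
Proof.
apply: compact_setX; first exact: cV_box_compact.
apply: compact_setX; first exact: cV_box_compact.
exact: segment_compact.
Qed.

Lemma box_norm (x : 'cV[R]_N) : 0 <= rho ->
  (forall i, - rho <= x i 0 <= rho) <-> `|x| <= rho.
Proof.
move=> r0; split=> [H|H i]; last first.
  by rewrite -ler_norml; apply: le_trans H; exact: cV_coord_le.
by apply: cV_norm_le => // i; rewrite ler_norml.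
Qed.

Let QU : 0 <= rho -> Q `<=` U `*` params.
Proof. by move=> r0 z [z1 [z2 z3]]; split=> //; apply: rhoU; apply/box_norm. Qed.

(** A period moves the phase of p into a compact box. The box has a margin of 1
on each side, so that the same period moves the nearby phase of q into it. *)
Lemma periodic_uniform (e : R) : 0 < e -> exists2 d : R, 0 < d &
  forall x y p q, `|x| <= rho -> `|y| <= rho -> params p -> params q ->
    `|x - y| < d -> `|p - q| < d -> `|g (x, p) - g (y, q)| <= e.
Proof.
move=> e_0; have [r0|r0] := leP 0 rho; last first.
  by exists 1 => // x y p q xr; have := le_trans (normr_ge0 x) xr; rewrite leNgt r0.
have [d d0 Hd] := compact_uniform cQ (QU r0) gc e_0.
exists (Num.min d 1); first by rewrite lt_min d0 ltr01.
move=> x y p q xr yr Sp Sq; rewrite !lt_min => /andP[xd _] /andP[pd p1].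
have [m Hm] := lattice_reduce p.1.
rewrite -(torus_periodic_lattice m gP (rhoU xr) Sp) -(torus_periodic_lattice m gP (rhoU yr) Sq).
apply: Hd.
- split; [exact/box_norm|split=> /=; last by rewrite addr0; exact: Sp.2].
  by move=> i; have := Hm i; have := pi_gt0 R; lra.
- split; [exact/box_norm|split=> /=; last by rewrite addr0; exact: Sq.2].
  move=> i; have /andP[h1 h2] := Hm i.
  have : `|(p.1 - q.1) i 0| < 1.
    by apply: le_lt_trans (cV_coord_le _ _) _; apply: le_lt_trans p1; rewrite [leRHS]prod_normE le_max lexx.
  rewrite ltr_norml => /andP[]; move: h1 h2; rewrite !mxE; lra.
- have -> : (x, p + (lattice m, 0)) - (y, q + (lattice m, 0)) = (x - y, p - q).
    by congr (_, _); rewrite /= opprD addrACA subrr addr0.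
  by rewrite prod_normE gt_max/= xd pd.
Qed.

Lemma periodic_bounded : exists2 M : R, 0 < M &
  forall x p, `|x| <= rho -> params p -> `|g (x, p)| <= M.
Proof.
have [r0|r0] := leP 0 rho; last first.
  by exists 1 => // x p xr; have := le_trans (normr_ge0 x) xr; rewrite leNgt r0.
have [M M0 HM] := compact_norm_bounded cQ (QU r0) gc.
exists M => // x p xr Sp; have [m Hm] := lattice_reduce p.1.
rewrite -(torus_periodic_lattice m gP (rhoU xr) Sp); apply: HM.
split; [exact/box_norm|split=> /=; last by rewrite addr0; exact: Sp.2].
by move=> i; have := Hm i; have := pi_gt0 R; lra.
Qed.

End PeriodicCompactness.

(** Translation by a period maps the domain onto itself, and relative derivatives
are unique. *)
Lemma torus_periodic_derivative {V W : normedModType R} (U : set V)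
    (g : V * Lam -> W) dg : open U -> torus_periodic U g ->
  (forall z, (U `*` params) z -> derivative_within (U `*` params) g z (dg z)) ->
  torus_periodic U dg.
Proof.
move=> oU gP Dg x p j Ux Sp.
have Sz : (U `*` params) (x, p) by [].
have Sz' : (U `*` params) (x, p + period j) by split=> //; exact: params_period.
apply: (derivative_within_unique (thick_params oU Sz) _ (Dg _ Sz)).
have /derivative_withinP[L H] := Dg _ Sz'.
apply/derivative_withinP; split=> // e e_0; have [d d0 K] := H e e_0.
exists d => // -[y q] [/= Uy Sq] yd.
have E : (y, q) - (x, p) = (y, q + period j) - (x, p + period j).
  by congr (_, _); rewrite /= opprD addrACA subrr addr0.
rewrite -(gP y q j)// -(gP x p j)// E; apply: K; last by rewrite -E.
by split=> //; exact: params_period.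
Qed.

End Torus.

(** * Regularity of the bounded solution in the parameters *)

Lemma continuous_in_domain (R : realType) (V W : normedModType R) (D : set V)
    (g : V -> W) (c : R -> V) : {within D, continuous g} -> continuous c ->
  (forall t, D (c t)) -> continuous (g \o c).
Proof.
move=> /within_continuousP gc cc Dc t; apply/cvgrPdist_le => e e0.
have [d d0 Hd] := gc _ (Dc t) e e0.
have /cvgrPdist_lt/(_ d d0) := cc t.
by apply: filterS => s ts; rewrite distrC; apply: Hd => //; rewrite distrC.
Qed.

Section OperatorFamilies.
Context {R : realType} {k N : nat} (e0 : R) (U : set 'cV[R]_N) (rho : R)
  (rhoU : forall x : 'cV[R]_N, `|x| <= rho -> U x).
Local Notation Lam := ('cV[R]_k * R)%type.
Local Notation E := ('cV[R]_N * Lam)%type.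
Local Notation params := (@params R k e0).
Context {V W : normedModType R} (fV : fin_dim V) (dG : E -> V -> W)
  (Lin : forall z, (U `*` params) z -> linear (dG z))
  (dGc : forall u, {within U `*` params, continuous (dG^~ u)})
  (dGP : torus_periodic e0 U dG).

Let dGP' u : torus_periodic e0 U (dG^~ u).
Proof. by move=> x p j Ux Sp; rewrite dGP. Qed.

Lemma operator_bounded : exists2 L : R, 0 < L &
  forall x p u, `|x| <= rho -> params p -> `|dG (x, p) u| <= L * `|u|.
Proof.
have [n [b [c [cL bc]]]] := fV.
have [M HM] : exists M : 'I_n -> R, forall i, 0 < M i /\
    forall x p, `|x| <= rho -> params p -> `|dG (x, p) (b i)| <= M i.
  suff /choice[M HM] : forall i, exists M : R, 0 < M /\
      forall x p, `|x| <= rho -> params p -> `|dG (x, p) (b i)| <= M by exists M.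
  by move=> i; have [M M0 HM] := periodic_bounded rhoU (@dGc (b i)) (@dGP' (b i)); exists M.
have [K HK] : exists K : 'I_n -> R, forall i, 0 <= K i /\ forall v, `|c i v| <= K i * `|v|.
  suff /choice[K HK] : forall i, exists K : R, 0 <= K /\ forall v, `|c i v| <= K * `|v|.
    by exists K.
  by move=> i; have [_ [K K0 HK]] := cL i; exists K.
have S0 : 0 <= \sum_i K i * M i.
  by rewrite sumr_ge0// => i _; rewrite mulr_ge0 ?(HK i).1// ltW ?(HM i).1.
exists (1 + \sum_i K i * M i); first by rewrite ltr_pwDl.
move=> x p u xr Sp; rewrite {1}(bc u) linear_sum'//; last by apply: Lin; split=> //; exact: rhoU.
apply: (@le_trans _ _ ((\sum_i K i * M i) * `|u|)); last by rewrite ler_wpM2r// lerDr.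
rewrite mulr_suml; apply: le_trans (ler_norm_sum _ _ _) _; apply: ler_sum => i _.
by rewrite normrZ mulrAC; apply: ler_pM => //; [exact: (HK i).2|exact: (HM i).2].
Qed.

(** Periodicity gives uniformity over all phases, a finite spanning family gives
uniformity over u. *)
Lemma operator_uniform (e : R) : 0 < e -> exists2 d : R, 0 < d &
  forall x y p q u, `|x| <= rho -> `|y| <= rho -> params p -> params q ->
    `|x - y| < d -> `|p - q| < d -> `|dG (x, p) u - dG (y, q) u| <= e * `|u|.
Proof.
move=> e_0; have [n [b [c [cL bc]]]] := fV.
have [K HK] : exists K : 'I_n -> R, forall i, 0 <= K i /\ forall v, `|c i v| <= K i * `|v|.
  suff /choice[K HK] : forall i, exists K : R, 0 <= K /\ forall v, `|c i v| <= K * `|v|.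
    by exists K.
  by move=> i; have [_ [K K0 HK]] := cL i; exists K.
pose T : R := 1 + \sum_i K i.
have T0 : 0 < T by rewrite ltr_pwDl// sumr_ge0// => i _; exact: (HK i).1.
have [d Hd] : exists d : 'I_n -> R, forall i, 0 < d i /\
    forall x y p q, `|x| <= rho -> `|y| <= rho -> params p -> params q ->
    `|x - y| < d i -> `|p - q| < d i -> `|dG (x, p) (b i) - dG (y, q) (b i)| <= e / T.
  suff /choice[d Hd] : forall i, exists d : R, 0 < d /\
    forall x y p q, `|x| <= rho -> `|y| <= rho -> params p -> params q ->
    `|x - y| < d -> `|p - q| < d -> `|dG (x, p) (b i) - dG (y, q) (b i)| <= e / T by exists d.
  move=> i; have [d d0 Hd] := periodic_uniform rhoU (@dGc (b i)) (@dGP' (b i)) (divr_gt0 e_0 T0).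
  by exists d.
exists (\big[Num.min/1]_i d i); first by apply: lt_bigmin => // i _; exact: (Hd i).1.
move=> x y p q u xr yr Sp Sq xy pq.
have Dx : (U `*` params) (x, p) by split=> //; exact: rhoU.
have Dy : (U `*` params) (y, q) by split=> //; exact: rhoU.
have dE z : (U `*` params) z -> dG z u = \sum_i c i u *: dG z (b i).
  by move=> /Lin L; rewrite {1}(bc u) linear_sum'.
rewrite (dE _ Dx) (dE _ Dy) -sumrB; apply: (@le_trans _ _ ((\sum_i K i) * (e / T) * `|u|)).
  rewrite !mulr_suml; apply: le_trans (ler_norm_sum _ _ _) _; apply: ler_sum => i _.
  rewrite -scalerBr normrZ mulrAC; apply: ler_pM => //; first exact: (HK i).2.
  apply: (Hd i).2 => //; first by apply: lt_le_trans xy _; exact: bigmin_le.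
  by apply: lt_le_trans pq _; exact: bigmin_le.
rewrite ler_wpM2r// mulrCA ger_pMr// ler_pdivrMr// mul1r /T lerDr//.
Qed.

End OperatorFamilies.

Section Response.
Context {R : realType} {m N : nat} (C : 'M[R]_(m, N)) (a c : R).
Context (a0 : 0 < a) (c0 : 0 < c)
  (CL : forall x : 'cV[R]_N, c * `|x| ^+ 2 <= lform C x x).

Definition response_gain (kap : R) : Prop :=
  forall (w dw r : R -> 'cV[R]_N) (B K : R),
  (forall u, `|w u| <= K) -> (forall u : R, is_derive u 1 w (dw u)) ->
  (forall u, lform C (w u) (dw u) <= - a * lform C (w u) (w u) + lform C (w u) (r u)) ->
  (forall u, `|r u| <= B) -> forall t, `|w t| <= kap * B.

(** The response to a bounded forcing is at most proportional to it. All
regularity of the invariant section comes from this estimate. *)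
Lemma bounded_response : exists2 kap : R, 0 < kap & response_gain kap.
Proof.
have [c' c'0 CU] := lform_le C.
exists (Num.sqrt (c' / c) / a); first by rewrite divr_gt0// sqrtr_gt0 divr_gt0.
move=> w dw r B K wK Dw Hw rB t.
have B0 : 0 <= B := le_trans (normr_ge0 _) (rB 0).
pose M : R := Num.sqrt c' * B.
apply: (norm_le_lform c0 CL); first by rewrite mulr_ge0// divr_ge0 ?sqrtr_ge0// ltW.
have rM u : lform C (r u) (r u) <= M ^+ 2.
  apply: le_trans (CU _) _; rewrite exprMn sqr_sqrtr ?(ltW c'0)// ler_wpM2l ?(ltW c'0)//.
  by rewrite ler_sqr ?nnegrE.
apply: le_trans (bounded_energy_estimate a0 wK Dw Hw rM t) _.
rewrite /M !exprMn !sqr_sqrtr ?divr_ge0 ?(ltW c'0) ?(ltW c0)//.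
by rewrite le_eqVlt; apply/orP; left; apply/eqP; field; rewrite !gt_eqF.
Qed.

End Response.

Section Regularity.
Context {R : realType} {m N k : nat} (C : 'M[R]_(m, N)) (a c : R).
Context (a0 : 0 < a) (c0 : 0 < c)
  (CL : forall x : 'cV[R]_N, c * `|x| ^+ 2 <= lform C x x).
Context (Omega : 'cV[R]_k) (e0 : R) (e00 : 0 < e0).
Local Notation Lam := ('cV[R]_k * R)%type.
Local Notation E := ('cV[R]_N * Lam)%type.
Local Notation params := (@params R k e0).
Local Notation om := (drift Omega).

Definition dissipative (G : E -> 'cV[R]_N) (rho : R) : Prop :=
  forall x y p, `|x| <= rho -> `|y| <= rho -> params p ->
    lform C (x - y) (G (x, p) - G (y, p)) <= - a * lform C (x - y) (x - y).

(** The equation is required along single orbits of the translation, so that a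
section can be assembled pointwise from bounded solutions, before anything is
known about its dependence on the parameters. *)
Definition invariant_section (G : E -> 'cV[R]_N) (h : Lam -> 'cV[R]_N) : Prop :=
  forall p, params p -> forall t : R,
    is_derive t 1 (fun s : R => h (p + s *: om)) (G (h (p + t *: om), p + t *: om)).

Section Step.
Context (U : set 'cV[R]_N) (oU : open U) (rho : R)
  (rhoU : forall x : 'cV[R]_N, `|x| <= rho -> U x).
Context (G : E -> 'cV[R]_N) (h : Lam -> 'cV[R]_N).
Context (GP : torus_periodic e0 U G) (GD : dissipative G rho)
  (hrho : forall p, params p -> `|h p| < rho) (hG : invariant_section G h).

Let Sd p t : params p -> params (p + t *: om).
Proof. exact: params_drift. Qed.

Let hle p : params p -> `|h p| <= rho.
Proof. by move=> /hrho/ltW. Qed.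

(** Translating the phase by a period gives another bounded solution of the same
equation. *)
Lemma section_periodic p j : params p -> h (p + period j) = h p.
Proof.
move=> Sp; have Sp' := params_period j Sp.
have E0 : (fun t => h (p + period j + t *: om)) = (fun t => h (p + t *: om)).
  apply: (@bounded_solution_unique _ _ _ C a c a0 c0 CL _ _ _ _ rho _ _ (hG Sp') (hG Sp)).
  - by move=> t; apply: hle; exact: Sd.
  - by move=> t; apply: hle; exact: Sd.
  - move=> t; rewrite addrAC GP; [|by apply: rhoU; apply: hle; rewrite addrAC; exact: Sd|exact: Sd].
    apply: GD; [|by apply: hle; exact: Sd|exact: Sd].
    by rewrite addrAC; apply: hle; exact: Sd.
by have := congr1 (fun f : R -> _ => f 0) E0; rewrite /= !scale0r !addr0.
Qed.

(** The difference of two orbits of the section is the response to the change of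
the vector field that the change from p to q causes along one of them. *)
Lemma section_difference : exists2 kap : R, 0 < kap & forall p q (B : R),
  params p -> params q ->
  (forall t : R, `|G (h (p + t *: om), q + t *: om) - G (h (p + t *: om), p + t *: om)| <= B) ->
  forall t : R, `|h (q + t *: om) - h (p + t *: om)| <= kap * B.
Proof.
have [kap kap0 Hkap] := bounded_response a0 c0 CL.
exists kap => // p q B Sp Sq HB t.
have Dq := hG Sq; have Dp := hG Sp.
pose r (t : R) := G (h (p + t *: om), q + t *: om) - G (h (p + t *: om), p + t *: om).
apply: (Hkap (fun t => h (q + t *: om) - h (p + t *: om)) _ r B (rho + rho) _
  (fun u => @is_deriveB _ _ _ _ _ _ _ _ _ (Dq u) (Dp u))) => // u.
  apply: le_trans (ler_normB _ _) _; apply: lerD; apply: hle; exact: Sd.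
have := GD (hle (Sd u Sq)) (hle (Sd u Sp)) (Sd u Sq).
set x := h (q + _); set y := h (p + _); rewrite /r -/y => H.
rewrite -[G (x, _)](subrK (G (y, q + u *: om))) -addrA [X in X <= _]lformDr.
by rewrite lerD2r.
Qed.

Lemma section_continuous : {within U `*` params, continuous G} -> {within params, continuous h}.
Proof.
move=> Gc; have [kap kap0 Hkap] := section_difference.
apply/within_continuousP => p Sp e e_0.
have [d d0 Hd] := periodic_uniform rhoU Gc GP (divr_gt0 e_0 kap0).
exists d => // q Sq qp.
have := @Hkap p q (e / kap) Sp Sq _ 0; rewrite !scale0r !addr0 [kap * _]mulrC divfK ?gt_eqF//; apply.
move=> t; apply: Hd; rewrite ?subrr ?normr0//; try (by apply: hle; exact: Sd); try exact: Sd.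
by rewrite opprD addrACA subrr addr0.
Qed.

Context (dG : E -> E -> 'cV[R]_N)
  (DG : forall z, (U `*` params) z -> derivative_within (U `*` params) G z (dG z))
  (dGc : forall u, {within U `*` params, continuous (dG^~ u)}).

Let fE : fin_dim (E : normedModType R).
Proof. by do !apply: fin_dim_pair; try exact: fin_dim_cV; exact: fin_dim_real. Qed.

Let Lin z : (U `*` params) z -> linear (dG z).
Proof. by move=> /DG[]. Qed.

Let dGP : torus_periodic e0 U dG.
Proof. exact: torus_periodic_derivative DG. Qed.

Let Dz x p : `|x| <= rho -> params p -> (U `*` params) (x, p).
Proof. by move=> xr Sp; split=> //; exact: rhoU. Qed.

(** Divide the dissipativity inequality between x and x + s z by s^2 and let s
tend to 0. *)
Lemma dissipative_derivative x p z : `|x| < rho -> params p ->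
  lform C z (dG (x, p) (z, 0)) <= - a * lform C z z.
Proof.
move=> xr Sp.
have lin : linear (fun v : 'cV[R]_N => lform C z v : R).
  by move=> b u v; rewrite lformDr lformZr.
have [K K0 HK] := linear_bounded (fin_dim_cV N) lin.
apply/ler_addgt0Pr => e e_0.
have /derivative_withinP[L H] := DG (Dz (ltW xr) Sp).
have z0 : 0 < `|z| + 1 by rewrite ltr_wpDl.
have [d d0 Hd] := H (e / K / (`|z| + 1)) (divr_gt0 (divr_gt0 e_0 K0) z0).
pose s : R := Num.min (d / (`|z| + 1)) ((rho - `|x|) / (`|z| + 1)) / 2.
have m0 : 0 < Num.min (d / (`|z| + 1)) ((rho - `|x|) / (`|z| + 1)).
  by rewrite lt_min !divr_gt0// subr_gt0.
have s0 : 0 < s by rewrite divr_gt0.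
have : s < Num.min (d / (`|z| + 1)) ((rho - `|x|) / (`|z| + 1)).
  by rewrite ltr_pdivrMr// ltr_pMr// ltr1n.
rewrite lt_min !ltr_pdivlMr// => /andP[sd sr].
have sz : s * `|z| <= s * (`|z| + 1) by rewrite ler_pM2l// lerDl.
have xsr : `|x + s *: z| <= rho.
  apply: le_trans (ler_normD _ _) _; rewrite normrZ (gtr0_norm s0); lra.
have E1 : (x + s *: z, p) - (x, p) = (s *: z, 0) :> E.
  by congr (_, _); rewrite /= ?subrr// addrC addKr.
have := Hd _ (Dz xsr Sp); rewrite E1 prod_normE normr0 /= max_l//.
rewrite normrZ (gtr0_norm s0) => /(_ (le_lt_trans sz sd)) hr.
have := GD xsr (ltW xr) Sp; rewrite [x + _ - x]addrC addKr !(lformZl, lformZr).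
set D := G _ - G _ in hr * => hD.
have E2 : dG (x, p) (s *: z, 0) = s *: dG (x, p) (z, 0).
  by rewrite -(linearZ' _ _ L) /=; congr (dG _ (_, _)); rewrite [RHS]scaler0.
rewrite E2 in hr; rewrite -(ler_pM2l s0) mulrDr.
have : lform C z (s *: dG (x, p) (z, 0)) <= lform C z D + s * e.
  have -> : s *: dG (x, p) (z, 0) = D - (D - s *: dG (x, p) (z, 0)) by rewrite subKr.
  rewrite -scaleN1r lformDr lformZr lerD2l mulN1r.
  apply: le_trans (ler_norm _) _; rewrite normrN; apply: le_trans (HK _) _.
  rewrite mulrC -ler_pdivlMr//; apply: le_trans hr _.
  have -> : e / K / (`|z| + 1) * (s * `|z|) = s * e / K * (`|z| / (`|z| + 1)) by ring.
  apply: ler_piMr; first by rewrite divr_ge0 ?mulr_ge0// ltW.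
  by rewrite ler_pdivrMr// mul1r lerDl.
rewrite lformZr => h1; apply: le_trans h1 _; rewrite lerD2r.
rewrite -(ler_pM2l s0); apply: le_trans hD _.
by rewrite le_eqVlt; apply/orP; left; apply/eqP; ring.
Qed.

Lemma orbit_continuous p : params p -> continuous (fun t : R => (h (p + t *: om), p + t *: om) : E).
Proof.
move=> Sp t.
have h1 : {for t, continuous (fun t : R => h (p + t *: om))}.
  by have ? := hG Sp t; exact: is_derive_continuous.
have h2 : {for t, continuous (fun t : R => p + t *: om)}.
  apply: cvgD; first exact: cvg_cst.
  by apply: cvgZ; [exact: cvg_id|exact: cvg_cst].
exact: (cvg_pair h1 h2).
Qed.

(** The derivative in the direction v is the bounded solution of the variational
equation along the orbit. The remainder h q - h p - dh p (q - p) solves the same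
linear equation with a forcing that is small compared with |q - p|, hence it is
itself small compared with |q - p|. *)
Lemma section_derivative : exists dh : Lam -> Lam -> 'cV[R]_N,
  [/\ forall p, params p -> derivative_within params h p (dh p),
      forall v, invariant_section (fun z => dG (h z.2, z.2) (z.1, v)) (dh^~ v) &
      forall v, exists2 r : R, 0 < r & forall p, params p -> `|dh p v| < r].
Proof.
have Gc : {within U `*` params, continuous G} := derivative_within_continuous fE DG.
have [L L0 HL] := operator_bounded rhoU fE Lin dGc dGP.
have [kap kap0 Hkap] := bounded_response a0 c0 CL.
have norm0l (u : 'cV[R]_N) : `|((u, 0) : E)| = `|u| by rewrite prod_normE normr0 max_l.
have norm0r (v : Lam) : `|((0, v) : E)| = `|v| by rewrite prod_normE normr0 max_r.
have splitE z (u : 'cV[R]_N) (v : Lam) : (U `*` params) z -> dG z (u, v) = dG z (u, 0) + dG z (0, v).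
  by move=> /Lin/linearD' <-; congr (dG z (_, _)); rewrite ?addr0 ?add0r.
have diffE z (u u' : 'cV[R]_N) (v : Lam) : (U `*` params) z ->
    dG z (u, v) - dG z (u', v) = dG z (u - u', 0).
  by move=> /Lin/linearB' <-; congr (dG z (_, _)); rewrite subrr.
have Dh p t : params p -> (U `*` params) (h (p + t *: om), p + t *: om).
  by move=> Sp; apply: Dz; [apply: hle|]; exact: Sd.
have diss p t z : params p -> lform C z (dG (h (p + t *: om), p + t *: om) (z, 0)) <= - a * lform C z z.
  by move=> Sp; apply: dissipative_derivative; [apply: hrho|]; exact: Sd.
have HLh p t u : params p -> `|dG (h (p + t *: om), p + t *: om) u| <= L * `|u|.
  by move=> Sp; apply: HL; [apply: hle|]; exact: Sd.
(* the variational equation along the orbit of p, in the direction v *)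
have ex (pv : Lam * Lam) : exists x : R -> 'cV[R]_N, params pv.1 ->
    (forall t : R, is_derive t 1 x (dG (h (pv.1 + t *: om), pv.1 + t *: om) (x t, pv.2))) /\
    (forall t, `|x t| <= kap * (L * `|pv.2|)).
  case: pv => p v /=; have [Sp|nSp] := pselect (params p); last by exists (fun=> 0).
  have [||||x [K [Dx xK]]] := @bounded_solution R m N C a c a0 c0 CL
      (fun t u => dG (h (p + t *: om), p + t *: om) (u, v)) L (L * `|v|).
  - move=> t u u'; rewrite diffE//; last exact: Dh.
    by apply: le_trans (HLh _ _ _ Sp) _; rewrite norm0l.
  - by move=> t; apply: le_trans (HLh _ _ _ Sp) _; rewrite norm0r.
  - move=> u.
    have := @continuous_in_domain R (E : normedModType R) _ _ (dG^~ (u, v)) _ (@dGc (u, v)) (orbit_continuous Sp).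
    by apply=> t; exact: Dh.
  - by move=> t u u'; rewrite diffE; [exact: diss|exact: Dh].
  exists x => _; split=> //.
  apply: (Hkap x _ (fun t => dG (h (p + t *: om), p + t *: om) (0, v)) _ K xK Dx) => t.
    by rewrite splitE ?lformDr ?lerD2r; [exact: diss|exact: Dh].
  by apply: le_trans (HLh _ _ _ Sp) _; rewrite norm0r.
have [Z HZ] := choice ex.
have uniq p v (x : R -> 'cV[R]_N) K : params p ->
    (forall t : R, is_derive t 1 x (dG (h (p + t *: om), p + t *: om) (x t, v))) ->
    (forall t, `|x t| <= K) -> x = Z (p, v).
  move=> Sp Dx xK; have [DZ ZK] := HZ (p, v) Sp.
  apply: (@bounded_solution_unique _ _ _ C a c a0 c0 CL _ _ _ _ (Num.max K (kap * (L * `|v|))) _ _ Dx DZ).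
  - by move=> t; rewrite le_max xK.
  - by move=> t; rewrite le_max ZK orbT.
  - by move=> t; rewrite diffE; [exact: diss|exact: Dh].
pose dh p v := Z (p, v) 0.
have flow p v t : params p -> Z (p, v) t = dh (p + t *: om) v.
  move=> Sp; rewrite /dh.
  have [DZ ZK] := HZ (p, v) Sp.
  have <- : (fun s => Z (p, v) (t + s)) = Z (p + t *: om, v).
    apply: (uniq _ _ _ (kap * (L * `|v|)) (Sd t Sp)) => // s.
    rewrite -addrA -scalerDl; have /is_derive1P DZs := DZ (t + s).
    apply/is_derive1P => e e_0; have [d d0 Hd] := DZs e e_0; exists d => // u ud.
    by rewrite addrA; exact: Hd.
  by rewrite addr0.
have linh p : params p -> linear (dh p).
  move=> Sp b u v; rewrite /dh.
  have [DZu ZKu] := HZ (p, u) Sp; have [DZv ZKv] := HZ (p, v) Sp.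
  have <- : (fun t => b *: Z (p, u) t + Z (p, v) t) = Z (p, b *: u + v); last by [].
  apply: (uniq p _ _ (`|b| * (kap * (L * `|u|)) + kap * (L * `|v|)) Sp).
    move=> t; have ? := DZu t; have ? := DZv t; apply: is_derive_eq.
    have /Lin lin := Dh p t Sp.
    by rewrite -(lin b (Z (p, u) t, u) (Z (p, v) t, v)).
  move=> t; apply: le_trans (ler_normD _ _) _; apply: lerD => //.
  by rewrite normrZ ler_wpM2l// ZKu.
have [kap2 kap20 Hkap2] := section_difference.
have subE (p q : Lam) (t : R) : q + t *: om - (p + t *: om) = q - p.
  by rewrite opprD addrACA subrr addr0.
have lip p q t : params p -> params q -> `|h (q + t *: om) - h (p + t *: om)| <= kap2 * (L * `|q - p|).
  move=> Sp Sq; apply: Hkap2 => // s.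
  set y := h (p + s *: om); have yr : `|y| <= rho by apply: hle; exact: Sd.
  rewrite -[X in `|X|]subr0.
  apply: (@segment_mean_value _ _ _ (U `*` params) G dG (y, p + s *: om) (y, q + s *: om)) => //.
  - move=> s' s01; have -> : (y, p + s *: om) + s' *: ((y, q + s *: om) - (y, p + s *: om)) =
      (y, p + s *: om + s' *: (q + s *: om - (p + s *: om))) :> E.
      by congr (_, _); rewrite /= subrr scaler0 addr0.
    by apply: Dz => //; apply: params_convex => //; exact: Sd.
  - by rewrite mulr_ge0// ltW.
  - move=> s' /andP[s0 s1]; rewrite subr0.
    have -> : (y, p + s *: om) + s' *: ((y, q + s *: om) - (y, p + s *: om)) =
      (y, p + s *: om + s' *: (q + s *: om - (p + s *: om))) :> E.
      by congr (_, _); rewrite /= subrr scaler0 addr0.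
    apply: le_trans (HL _ _ _ yr _) _.
      by apply: params_convex; rewrite ?(ltW s0) ?(ltW s1)//; exact: Sd.
    have -> : (y, q + s *: om) - (y, p + s *: om) = (0, q - p) :> E.
      by congr (_, _); rewrite /= ?subrr ?subE.
    by rewrite norm0r.
exists dh; split.
- move=> p Sp; apply/derivative_withinP; split; first exact: linh.
  move=> e e_0; pose T : R := kap2 * L + 1.
  have T0 : 0 < T by rewrite addr_gt0// mulr_gt0.
  (* orbits of q are within T |q - p| of those of p, and the response to the
     forcing brings a factor kap *)
  have [d d0 Hd] := operator_uniform rhoU fE Lin dGc dGP (divr_gt0 e_0 (mulr_gt0 kap0 T0)).
  exists (d / T); first by rewrite divr_gt0.
  move=> q Sq qp; have qpT : `|q - p| * T < d by rewrite -ltr_pdivlMr.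
  have [DZ ZK] := HZ (p, q - p) Sp.
  have Dq := hG Sq; have Dp := hG Sp.
  pose hp t := h (p + t *: om); pose hq t := h (q + t *: om).
  pose r t := G (hq t, q + t *: om) - G (hp t, p + t *: om) -
     dG (hp t, p + t *: om) (hq t - hp t, q - p).
  have step t : `|((hq t, q + t *: om) - (hp t, p + t *: om) : E)| <= T * `|q - p|.
    rewrite prod_normE /= ge_max subE; apply/andP; split.
      by apply: le_trans (lip p q t Sp Sq) _; rewrite mulrA ler_wpM2r// /T lerDl.
    by rewrite ler_peMl// /T lerDr mulr_ge0// ltW.
  have eT0 : 0 <= e / (kap * T) by apply: ltW; rewrite divr_gt0// mulr_gt0.
  have rB t : `|r t| <= e / (kap * T) * (T * `|q - p|).
    have E1 : (hq t - hp t, q - p) = (hq t, q + t *: om) - (hp t, p + t *: om) :> E.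
      by congr (_, _); rewrite /= subE.
    have cvx s : 0 <= s <= 1 -> exists x' p', [/\ `|x'| <= rho, params p',
      (hp t, p + t *: om) + s *: ((hq t, q + t *: om) - (hp t, p + t *: om)) = (x', p'),
      `|x' - hp t| < d & `|p' - (p + t *: om)| < d].
      move=> /andP[s0 s1]; exists (hp t + s *: (hq t - hp t)), (p + t *: om + s *: (q + t *: om - (p + t *: om))).
      have nn := le_lt_trans (step t) _; rewrite mulrC in nn; have {}nn := nn _ qpT.
      move: nn; rewrite prod_normE gt_max /= => /andP[n1 n2].
      split => //.
      + have -> : hp t + s *: (hq t - hp t) = (1 - s) *: hp t + s *: hq t.
          by apply/colP => i; rewrite !mxE; ring.
        apply: le_trans (ler_normD _ _) _; rewrite !normrZ (ger0_norm s0) ger0_norm ?subr_ge0//.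
        have := hle (Sd t Sp); have := hle (Sd t Sq); rewrite -/(hp t) -/(hq t); nra.
      + by apply: params_convex; rewrite ?s0//; exact: Sd.
      + rewrite [hp t + _]addrC addrK normrZ ger0_norm//; apply: le_lt_trans n1.
        by rewrite ler_piMl.
      + rewrite [p + t *: om + _]addrC addrK normrZ ger0_norm//; apply: le_lt_trans n2.
        by rewrite ler_piMl.
    rewrite /r E1; apply: (@segment_mean_value _ _ _ (U `*` params) G dG) => //.
    + by move=> s /cvx[x' [p' [xr Sp' -> _ _]]]; exact: Dz.
    + by rewrite mulr_ge0// mulr_ge0// ltW.
    + move=> s /andP[s0 s1]; have [|x' [p' [xr Sp' -> x'd p'd]]] := cvx s.
        by rewrite !ltW.
      apply: le_trans (Hd _ _ _ _ _ xr (hle (Sd t Sp)) Sp' (Sd t Sp) x'd p'd) _.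
      by rewrite ler_wpM2l ?step.
  have := Hkap (fun t => hq t - hp t - Z (p, q - p) t)
    (fun t => G (hq t, q + t *: om) - G (hp t, p + t *: om) - dG (hp t, p + t *: om) (Z (p, q - p) t, q - p))
    r (e / (kap * T) * (T * `|q - p|)) (rho + rho + kap * (L * `|q - p|)).
  move=> /(_ _ _ _ rB 0); rewrite /hq /hp !scale0r !addr0 -/(dh p (q - p)).
  have -> : kap * (e / (kap * T) * (T * `|q - p|)) = e * `|q - p|.
    by field; rewrite !gt_eqF.
  apply.
  + move=> t; apply: le_trans (ler_normB _ _) _; apply: lerD => //.
    by apply: le_trans (ler_normB _ _) _; apply: lerD; apply: hle; exact: Sd.
  + move=> t; rewrite /r; set g := G _ - G _.
    have -> : g - dG (hp t, p + t *: om) (Z (p, q - p) t, q - p) =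
        dG (hp t, p + t *: om) (hq t - hp t - Z (p, q - p) t, 0) +
        (g - dG (hp t, p + t *: om) (hq t - hp t, q - p)).
      rewrite -(diffE _ _ _ (q - p)); last exact: Dh.
      by rewrite [RHS]addrC addrA subrK.
    by rewrite lformDr lerD2r; exact: diss.
- move=> v p Sp t; have [DZ _] := HZ (p, v) Sp.
  have -> : (fun s => dh (p + s *: om) v) = Z (p, v) by apply/funext => s; rewrite flow.
  by rewrite /= -flow//; exact: DZ.
- move=> v; exists (kap * (L * `|v|) + 1); first by rewrite ltr_wpDl// !mulr_ge0// ltW.
  by move=> p Sp; have [_ ZK] := HZ (p, v) Sp; apply: le_lt_trans (ZK 0) _; rewrite ltrDl.
Qed.

End Step.

Let fLam : fin_dim (Lam : normedModType R).
Proof. by apply: fin_dim_pair; [exact: fin_dim_cV|exact: fin_dim_real]. Qed.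

Let fE : fin_dim (E : normedModType R).
Proof. by apply: fin_dim_pair; [exact: fin_dim_cV|exact: fLam]. Qed.

(** The derivative of the section in the direction v is the section of the
linearized system, which is one degree less smooth and is defined for all x; this
drives the induction. *)
Theorem section_Cn n (U : set 'cV[R]_N) (rho : R) (G : E -> 'cV[R]_N) (h : Lam -> 'cV[R]_N) :
  open U -> (forall x : 'cV[R]_N, `|x| <= rho -> U x) ->
  Cn_on n (U `*` params) G -> torus_periodic e0 U G -> dissipative G rho ->
  (forall p, params p -> `|h p| < rho) -> invariant_section G h -> Cn_on n params h.
Proof.
elim: n U rho G h => [|n IH] U rho G h oU rhoU GC GP GD hrho hG.
  exact: (section_continuous rhoU GP GD hrho hG).
have hC : Cn_on n params h by apply: (IH U rho G) => //; exact: Cn_on_le.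
have [dG [DG dGC]] := GC.
have dGc u : {within U `*` params, continuous (dG^~ u)} by exact: Cn_on_continuous (dGC u).
have dGP : torus_periodic e0 U dG by exact: torus_periodic_derivative DG.
have [dh [Ddh sdh bdh]] := section_derivative oU rhoU GP GD hrho hG DG dGc.
exists dh; split=> // v.
have hD p : params p -> (U `*` params) (h p, p).
  by move=> Sp; split=> //; apply: rhoU; apply: ltW; exact: hrho.
have [r r0 hr] := bdh v.
apply: (IH setT r (fun z => dG (h z.2, z.2) (z.1, v))) => //; first exact: openT.
- pose b (i : 'I_N) : E := (delta_mx i 0, 0).
  have snd2 : Cn_on n (setT `*` params) (fun z : E => z.2) by exact: Cn_on_linear.
  have hC2 : Cn_on n (setT `*` params) (fun z : E => (h z.2, z.2)).
    apply: Cn_on_pair => //.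
    by apply: (@Cn_on_comp _ _ _ _ _ _ params h snd) => // z [].
  have comp u : Cn_on n (setT `*` params) (fun z : E => dG (h z.2, z.2) u).
    apply: (@Cn_on_comp _ _ _ _ _ _ (U `*` params) (fun z => dG z u) (fun z : E => (h z.2, z.2))) => //.
    - by move=> z [_ Sz]; exact: hD.
    - exact: dGC.
  apply: (@Cn_on_ext _ _ _ n (setT `*` params) (fun z : E => \sum_(i < N) z.1 i 0 *: dG (h z.2, z.2) (b i) + dG (h z.2, z.2) (0, v)) (fun z : E => dG (h z.2, z.2) (z.1, v))).
    move=> z [_ Sz]; have [lin _] := DG _ (hD _ Sz).
    have -> : (z.1, v) = \sum_i z.1 i 0 *: b i + (0, v) :> E.
      rewrite [RHS]surjective_pairing /=.
      rewrite !(big_morph fst (id1 := 0) (op1 := +%R))// !(big_morph snd (id1 := 0) (op1 := +%R))//=.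
      congr (_, _); last by rewrite big1 ?add0r// => i _; rewrite scaler0.
      rewrite addr0; apply/colP => i; rewrite summxE (bigD1 i)//= !mxE !eqxx mulr1.
      by rewrite big1 ?addr0// => j ji; rewrite !mxE eq_sym (negbTE ji) mulr0.
    by rewrite (linearD' _ _ lin) (linear_sum' _ _ _ lin).
  apply: Cn_onD => //; apply: Cn_on_sum => i; apply: Cn_on_scale => //.
  by apply: Cn_on_linear => // a' u w; rewrite /= !mxE.
- by move=> x p j _ Sp /=; rewrite (section_periodic rhoU GP GD hrho hG)// dGP//; apply: rhoU; apply: ltW; exact: hrho.
- move=> x y p _ _ Sp /=; have [lin _] := DG _ (hD _ Sp).
  rewrite -linearB'//.
  have -> : (x, v) - (y, v) = (x - y, 0) :> E by congr (_, _); rewrite /= subrr.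
  by apply: (dissipative_derivative rhoU GD DG) => //; exact: hrho.
Qed.
End Regularity.

(** * The forced system near the stable equilibrium *)

Section Clamp.
Context {R : realType} {N : nat} (rho : R) (rho0 : 0 <= rho).

Lemma max_lipschitz (s x y : R) : `|Num.max s x - Num.max s y| <= `|x - y|.
Proof.
have := ler_norm (x - y); have := ler_norm (y - x); rewrite [`|y - x|]distrC.
move: (`|x - y|) => d h1 h2; rewrite ler_norml.
by case: (lerP s x) => h3; case: (lerP s y) => h4; apply/andP; split; lra.
Qed.

Lemma min_lipschitz (s x y : R) : `|Num.min s x - Num.min s y| <= `|x - y|.
Proof.
have := ler_norm (x - y); have := ler_norm (y - x); rewrite [`|y - x|]distrC.
move: (`|x - y|) => d h1 h2; rewrite ler_norml.
by case: (lerP s x) => h3; case: (lerP s y) => h4; apply/andP; split; lra.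
Qed.

(** A Lipschitz retraction, with constant 1, onto the ball of the supremum norm. *)
Definition clamp (x : 'cV[R]_N) : 'cV[R]_N :=
  \col_i Num.max (- rho) (Num.min rho (x i 0)).

Lemma clamp_norm x : `|clamp x| <= rho.
Proof.
apply: cV_norm_le => // i; rewrite mxE ler_norml le_max lexx/= ge_max ge_min lexx/= andbT.
by apply: le_trans rho0; rewrite oppr_le0.
Qed.

Lemma clamp_id x : `|x| <= rho -> clamp x = x.
Proof.
move=> xr; apply/colP => i; rewrite mxE.
have := le_trans (cV_coord_le x i) xr; rewrite ler_norml => /andP[h1 h2].
by rewrite min_r// max_r.
Qed.

Lemma clamp_lipschitz x y : `|clamp x - clamp y| <= `|x - y|.
Proof.
apply: cV_norm_le => // i; apply: le_trans (cV_coord_le (x - y) i); rewrite !mxE.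
move: (x i 0) (y i 0) => u v.
apply: le_trans (max_lipschitz _ _ _) _; exact: min_lipschitz.
Qed.

End Clamp.

Section Forced.
Context {R : realType} {m N k : nat} (C : 'M[R]_(m, N)) (A : 'M[R]_N) (a c : R).
Context (a0 : 0 < a) (c0 : 0 < c)
  (CL : forall x : 'cV[R]_N, c * `|x| ^+ 2 <= lform C x x)
  (CA : forall x : 'cV[R]_N, lform C x (A *m x) <= - a * lform C x x).
Context (Omega : 'cV[R]_k) (e0 : R) (e00 : 0 < e0).
Local Notation Lam := ('cV[R]_k * R)%type.
Local Notation E := ('cV[R]_N * Lam)%type.
Local Notation params := (@params R k e0).
Local Notation om := (drift Omega).

(** Terms with a small Lipschitz constant cost at most half of the decay. *)
Lemma small_perturbation : exists2 ka : R, 0 < ka & forall u v : 'cV[R]_N,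
  `|v| <= ka * `|u| -> lform C u v <= a / 2 * lform C u u.
Proof.
have [c' c'0 CU] := lform_le C.
exists (a / 2 * Num.sqrt (c / c')); first by rewrite mulr_gt0 ?divr_gt0// sqrtr_gt0 divr_gt0.
move=> u v uv.
have q0 : 0 < a / 2 by rewrite divr_gt0.
move: (a / 2) q0 uv => q q0 uv.
have h1 := lform_young C u v q0.
have h2 : lform C v v <= q ^+ 2 * lform C u u.
  apply: le_trans (CU v) _; rewrite mulrC -ler_pdivlMr//.
  apply: (@le_trans _ _ ((q * Num.sqrt (c / c') * `|u|) ^+ 2)).
    by rewrite ler_sqr ?nnegrE// !mulr_ge0 ?sqrtr_ge0// ltW.
  rewrite !exprMn sqr_sqrtr ?divr_ge0 ?(ltW c0) ?(ltW c'0)//.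
  rewrite -[leLHS]mulrA -[leRHS]mulrA; apply: ler_wpM2l; first exact: sqr_ge0.
  by rewrite mulrAC ler_pM2r ?invr_gt0.
have h3 : lform C v v / q <= q * lform C u u.
  by rewrite ler_pdivrMr//; apply: le_trans h2 _; rewrite le_eqVlt; apply/orP; left; apply/eqP; ring.
lra.
Qed.

Context (ka : R) (ka0 : 0 < ka)
  (kaP : forall u v : 'cV[R]_N, `|v| <= ka * `|u| -> lform C u v <= a / 2 * lform C u u).
Context (rho : R) (rho0 : 0 < rho) (g : E -> 'cV[R]_N) (B : R)
  (gL : forall x y p, `|x| <= rho -> `|y| <= rho -> params p ->
     `|g (x, p) - g (y, p)| <= ka * `|x - y|)
  (gc : forall x p, `|x| <= rho -> params p -> continuous (fun t : R => g (x, p + t *: om)))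
  (gB : forall p, params p -> `|g (0, p)| <= B).

Definition forced (z : E) : 'cV[R]_N := A *m z.1 + g z.

Let b := a / 2.
Let b0 : 0 < b. Proof. by rewrite divr_gt0. Qed.
Let Sd p t : params p -> params (p + t *: om).
Proof. exact: params_drift. Qed.

Let dissE (u v w : 'cV[R]_N) : `|w| <= ka * `|u - v| ->
  lform C (u - v) (A *m (u - v) + w) <= - b * lform C (u - v) (u - v).
Proof. by move=> /kaP h; rewrite [X in X <= _]lformDr; have := CA (u - v); rewrite /b; lra. Qed.

Lemma forced_dissipative : dissipative C b e0 forced rho.
Proof.
move=> x y p xr yr Sp; rewrite /forced /= opprD addrACA -mulmxBr.
by apply: dissE; exact: gL.
Qed.

(* outside the ball the nonlinearity is frozen at its boundary values, which
   makes the system Lipschitz and dissipative on the whole space *)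
Let F p (t : R) (x : 'cV[R]_N) : 'cV[R]_N := A *m x + g (clamp rho x, p + t *: om).

Let cn (x : 'cV[R]_N) : `|clamp rho x| <= rho.
Proof. by apply: clamp_norm; exact: ltW. Qed.

Let cl (x y : 'cV[R]_N) : `|clamp rho x - clamp rho y| <= `|x - y|.
Proof. by apply: clamp_lipschitz; exact: ltW. Qed.

Let c0' : clamp rho 0 = 0 :> 'cV[R]_N.
Proof. by rewrite clamp_id ?normr0// ltW. Qed.

Let FD p t (x y : 'cV[R]_N) : params p ->
  lform C (x - y) (F p t x - F p t y) <= - b * lform C (x - y) (x - y).
Proof.
move=> Sp; rewrite /F opprD addrACA -mulmxBr; apply: dissE.
apply: le_trans (gL (cn x) (cn y) (Sd t Sp)) _.
by rewrite ler_wpM2l ?(ltW ka0).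
Qed.

Let Alin : exists2 L : R, 0 < L & forall x : 'cV[R]_N, `|A *m x| <= L * `|x|.
Proof.
apply: (linear_bounded (fin_dim_cV N)) => s u v.
by rewrite mulmxDr scalemxAr.
Qed.

Let Fdata p : params p -> exists L,
  [/\ forall t (x y : 'cV[R]_N), `|F p t x - F p t y| <= L * `|x - y|,
      forall t, `|F p t 0| <= B &
      forall x, continuous (F p ^~ x)].
Proof.
move=> Sp; have [L L0 HL] := Alin; exists (L + ka); split.
- move=> t x y; rewrite /F opprD addrACA -mulmxBr mulrDl.
  apply: le_trans (ler_normD _ _) _; apply: lerD => //.
  apply: le_trans (gL (cn x) (cn y) (Sd t Sp)) _.
  by rewrite ler_wpM2l ?(ltW ka0).
- by move=> t; rewrite /F mulmx0 add0r c0'; apply: gB; exact: Sd.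
- move=> x t; apply: cvgD; first exact: cvg_cst.
  by apply: gc.
Qed.

Let F_forced p t x : `|x| <= rho -> F p t x = forced (x, p + t *: om).
Proof. by move=> xr; rewrite /F /forced clamp_id. Qed.

(** The truncated equation has a bounded solution for every p, and it is so small
that truncation does not affect it. By uniqueness the solution for p + s om is the
solution for p, translated in time by s. *)
Lemma forced_section (kap : R) : response_gain C b kap -> kap * B < rho ->
  exists h : Lam -> 'cV[R]_N, invariant_section Omega e0 forced h /\
    forall p (Bp : R), params p -> (forall t : R, `|g (0, p + t *: om)| <= Bp) -> `|h p| <= kap * Bp.
Proof.
move=> Hkap kB.
have ex p : exists x : R -> 'cV[R]_N, params p ->
    exists K, (forall t : R, is_derive t 1 x (F p t (x t))) /\ forall t, `|x t| <= K.
  have [Sp|nSp] := pselect (params p); last by exists (fun=> 0).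
  have [L [FL F0 Fc]] := Fdata Sp.
  have [x [K H]] := bounded_solution b0 c0 CL FL F0 Fc (fun t u v => FD t u v Sp).
  by exists x => _; exists K.
have [X HX] := choice ex.
have XB p Bp : params p -> (forall t : R, `|g (0, p + t *: om)| <= Bp) -> forall t, `|X p t| <= kap * Bp.
  move=> Sp gBp; have [K [DX XK]] := HX p Sp.
  apply: (Hkap (X p) _ (fun t => g (0, p + t *: om)) _ K XK DX) => // t.
  have := FD t (X p t) 0 Sp; rewrite subr0 {2}/F mulmx0 add0r c0'.
  move=> h; rewrite -[F p t (X p t)](subrK (g (0, p + t *: om))) lformDr lerD2r.
  exact: h.
have Xr p t : params p -> `|X p t| <= rho.
  move=> Sp; apply: le_trans (ltW kB); apply: XB => // s; apply: gB; exact: Sd.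
exists (fun p => X p 0); split; last by move=> p Bp Sp H; exact: XB.
move=> p Sp t.
have flow s : X (p + s *: om) 0 = X p s.
  have [K1 [D1 B1]] := HX p Sp; have [K2 [D2 B2]] := HX _ (Sd s Sp).
  have D1' (u : R) : is_derive u 1 (fun u => X p (s + u)) (F p (s + u) (X p (s + u))).
    have /is_derive1P D := D1 (s + u); apply/is_derive1P => e e_0.
    by have [d d0 Hd] := D e e_0; exists d => // v vd; rewrite addrA; exact: Hd.
  have E0 : X (p + s *: om) = fun u => X p (s + u).
    apply: (@bounded_solution_unique _ _ _ C b c b0 c0 CL _ _ _ _ (Num.max K1 K2) _ _ D2 D1').
    - by move=> u; rewrite le_max B2 orbT.
    - by move=> u; rewrite le_max B1.
    - move=> u; have -> : F (p + s *: om) u = F p (s + u).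
        by apply/funext => x; rewrite /F -addrA -scalerDl.
      exact: FD.
  by rewrite E0 addr0.
have -> : (fun s => X (p + s *: om) 0) = X p by apply/funext => s; rewrite flow.
have [K1 [D1 B1]] := HX p Sp.
by rewrite flow -F_forced; [exact: D1|exact: Xr].
Qed.

(** The form is at most c rho^2 / 2 on this ball, half of the level below which
the ball of radius rho is not left. *)
Definition basin_radius (c' : R) : R := Num.sqrt (c * rho ^+ 2 / 2 / c').

(** The sublevel c rho^2 of the form is contained in the ball of radius rho and
cannot be reached: the decay outweighs a forcing of size B. For a given solution
the estimate is applied up to the first time at which the level is attained. *)
Lemma forced_forward (c' : R) (x0 : 'cV[R]_N) p : 0 < c' ->
  (forall x : 'cV[R]_N, lform C x x <= c' * `|x| ^+ 2) ->
  B <= b * basin_radius c' / 2 -> params p -> `|x0| < basin_radius c' ->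
    (exists x : R -> 'cV[R]_N, [/\ x 0 = x0, forall t, 0 <= t -> `|x t| < rho &
        forall t : R, 0 <= t -> is_derive t 1 x (forced (x t, p + t *: om))]) /\
    (forall x : R -> 'cV[R]_N, x 0 = x0 -> {within `[0, +oo[, continuous x} ->
        (forall t : R, 0 < t -> is_derive t 1 x (forced (x t, p + t *: om))) ->
        forall t, 0 <= t -> `|x t| < rho).
Proof.
move=> c'0 CU BB Sp x0r; set r := basin_radius c' in BB x0r.
pose w : R := c * rho ^+ 2.
have w0 : 0 < w by rewrite mulr_gt0 ?exprn_gt0.
have wrho x : lform C x x < w -> `|x| < rho.
  move=> xw; rewrite -(ltr_sqr (x := `|x|)) ?nnegrE ?(ltW rho0)// -(ltr_pM2l c0).
  exact: le_lt_trans (CL x) xw.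
have r2 : c' * r ^+ 2 = w / 2 by rewrite /r /basin_radius -/w sqr_sqrtr ?divr_ge0 ?(ltW w0) ?(ltW c'0)//; field; rewrite gt_eqF.
have r0 : 0 < r by rewrite /r /basin_radius -/w sqrtr_gt0 !divr_gt0.
pose B0 : R := b * r / 2.
have B00 : 0 < B0 by rewrite divr_gt0// mulr_gt0.
pose M : R := Num.sqrt c' * B0.
have gM t : lform C (g (0, p + t *: om)) (g (0, p + t *: om)) <= M ^+ 2.
  apply: le_trans (CU _) _; rewrite exprMn sqr_sqrtr ?(ltW c'0)// ler_wpM2l ?(ltW c'0)//.
  rewrite ler_sqr ?nnegrE ?(ltW B00)//; apply: le_trans BB; apply: gB; exact: Sd.
have Mb : (M / b) ^+ 2 = w / 8.
  rewrite /M /B0 !exprMn exprVn sqr_sqrtr ?(ltW c'0)//.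
  have -> : w = c' * r ^+ 2 * 2 by rewrite r2 divfK.
  by rewrite /b; field; rewrite gt_eqF.
have x0w : lform C x0 x0 < w / 2.
  apply: le_lt_trans (CU x0) _; rewrite -r2 ltr_pM2l// ltr_sqr ?nnegrE//; exact: ltW.
have stay (x : R -> 'cV[R]_N) T : 0 <= T -> x 0 = x0 -> {within `[0, T], continuous x} ->
    (forall t : R, 0 < t < T -> is_derive t 1 x (F p t (x t))) -> lform C (x T) (x T) < w.
  move=> T0 xx0 cx Dx.
  have := @energy_estimate _ _ _ C b b0 x (fun t => F p t (x t)) (fun t => g (0, p + t *: om)) M 0 T T0 cx Dx.
  rewrite xx0 Mb => H; have {}H : lform C (x T) (x T) <=
     expR (- b * (T - 0)) * lform C x0 x0 + w / 8.
    apply: H => // t _; have := FD t (x t) 0 Sp; rewrite subr0 {2}/F mulmx0 add0r c0'.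
    move=> h; rewrite -[F p t (x t)](subrK (g (0, p + t *: om))) lformDr lerD2r.
    exact: h.
  have : expR (- b * (T - 0)) * lform C x0 x0 <= lform C x0 x0.
    rewrite ler_piMl ?lform_ge0// -[leRHS](@expR0 R) ler_expR subr0 mulNr oppr_le0.
    by rewrite mulr_ge0// ltW.
  lra.
split.
  have [L [FL F0 Fc]] := Fdata Sp.
  have [x [xx0 Dx]] := global_solution FL F0 Fc 0 x0.
  have xr t : 0 <= t -> `|x t| < rho.
    move=> t0; apply: (wrho _); apply: stay => //.
    by apply: continuous_subspaceT => u; have ? := Dx u; apply: is_derive_continuous.
  by exists x; split=> // t t0; rewrite -F_forced ?(ltW (xr t t0)).
move=> x xx0 cx Dx t1 t10; apply: (wrho _); rewrite ltNge; apply/negP => xw.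
pose v (t : R) := lform C (x t) (x t).
have cv := continuous_lform (C := C) cx.
pose X : set R := [set t | 0 <= t /\ w <= v t].
have hX : has_inf X by split; [exists t1|exists 0 => t []].
pose T := inf X.
have T0 : 0 <= T by apply: lb_le_inf; [exact: hX.1|move=> t []].
have Tlow t : 0 <= t -> t < T -> v t < w.
  move=> t0 tT; rewrite ltNge; apply/negP => wv.
  have : T <= t by apply: ge_inf; [exact: hX.2|split].
  by rewrite leNgt tT.
have wT : w <= v T.
  rewrite leNgt; apply/negP => vw.
  have e_0 : 0 < (w - v T) / 2 by rewrite divr_gt0// subr_gt0.
  move/within_continuousP : cv => /(_ T) /=; rewrite in_itv/= T0 => /(_ isT _ e_0)[d d0 Hd].
  have [t [t0 wt] td] := inf_adherent d0 hX.
  have Tt : T <= t by apply: ge_inf; [exact: hX.2|split].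
  have := Hd t; rewrite /= in_itv/= t0 => /(_ isT).
  rewrite ger0_norm ?subr_ge0// ltrBlDr addrC => /(_ td).
  move=> /(le_trans (ler_norm _)); move: wt; rewrite -/(v t) -/(v T); lra.
have := stay x T T0 xx0; rewrite ltNge wT => H; suff : ~~ true by [].
apply: H.
- move/within_continuousP : cx => cx; apply/within_continuousP => t /=; rewrite in_itv/= => /andP[t0 tT] e e_0.
  have [|d d0 Hd] := cx t _ e e_0; first by rewrite /= in_itv/= t0.
  exists d => // s /=; rewrite in_itv/= => /andP[s0 _]; apply: Hd.
  by rewrite /= in_itv/= s0.
- move=> t /andP[t0 tT]; rewrite F_forced; first exact: Dx.
  by apply: ltW; apply: (wrho _); apply: Tlow => //; exact: ltW.
Qed.

(** The difference to the orbit of the section decays exponentially by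
dissipativity. *)
Lemma forced_attraction (h : Lam -> 'cV[R]_N) (p : Lam) (x : R -> 'cV[R]_N) :
  params p -> invariant_section Omega e0 forced h -> (forall q, params q -> `|h q| <= rho) ->
  {within `[0, +oo[, continuous x} ->
  (forall t : R, 0 < t -> is_derive t 1 x (forced (x t, p + t *: om))) ->
  (forall t, 0 <= t -> `|x t| <= rho) ->
  `|x t - h (p + t *: om)| @[t --> +oo] --> 0.
Proof.
move=> Sp hh hr cx Dx xr.
have [c' c'0 CU] := lform_le C.
pose K : R := lform C (x 0 - h p) (x 0 - h p).
have Dh (t : R) : is_derive t 1 (fun t => h (p + t *: om)) (forced (h (p + t *: om), p + t *: om)) by exact: hh.
have decay t : 0 <= t -> lform C (x t - h (p + t *: om)) (x t - h (p + t *: om)) <= expR (- b * t) * K.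
  move=> t0.
  have := @contraction_estimate _ _ _ C b b0 x (fun t => h (p + t *: om))
    (fun t => forced (x t, p + t *: om)) (fun t => forced (h (p + t *: om), p + t *: om)) 0 t t0.
  rewrite scale0r addr0 subr0; apply.
  - move/within_continuousP : cx => cx; apply/within_continuousP => s /=; rewrite in_itv/= => /andP[s0 st] e e_0.
    have [|d d0 Hd] := cx s _ e e_0; first by rewrite /= in_itv/= s0.
    exists d => // u /=; rewrite in_itv/= => /andP[u0 _]; apply: Hd.
    by rewrite /= in_itv/= u0.
  - by apply: continuous_subspaceT => u; have ? := Dh u; apply: is_derive_continuous.
  - by move=> u /andP[u0 _]; exact: Dx.
  - move=> u /andP[u0 _]; apply: forced_dissipative; [|apply: hr|]; try exact: Sd.
    by apply: xr; exact: ltW.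
have K0 : 0 <= K by exact: lform_ge0.
apply/cvgrPdist_le => e e_0.
have [T T0 HT] : exists2 T : R, 0 < T & forall t, T <= t -> expR (- b * t) * K <= c * e ^+ 2.
  exists (1 + K / (b * (c * e ^+ 2))); first by rewrite ltr_pwDl// divr_ge0// !mulr_ge0 ?sqr_ge0// ltW.
  have ce : 0 < c * e ^+ 2 by rewrite mulr_gt0// exprn_gt0.
  move=> t Tt; rewrite mulNr expRN mulrC ler_pdivrMr ?expR_gt0//.
  have h1 : K / (b * (c * e ^+ 2)) <= t by apply: le_trans Tt; rewrite lerDr.
  have h2 : K <= c * e ^+ 2 * (b * t).
    by move: h1; rewrite ler_pdivrMr ?mulr_gt0// => h1; apply: le_trans h1 _; rewrite le_eqVlt; apply/orP; left; apply/eqP; ring.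
  apply: le_trans h2 _; rewrite ler_pM2l//.
  by apply: le_trans (expR_ge1Dx _); rewrite lerDr.
exists T; split; first exact: num_real.
move=> t /ltW Tt; rewrite sub0r normrN normr_id.
apply: (norm_le_lform c0 CL); first exact: ltW.
apply: le_trans (decay t _) (HT t Tt).
by apply: le_trans Tt; exact: ltW.
Qed.

End Forced.

(** * Power series whose coefficients are forms on lists *)

Section ListForms.
Context {R : realType} {V W : normedModType R}.
Implicit Types (P : seq V -> W) (l : seq V).

Definition norm_prod l : R := \prod_(v <- l) `|v|.

Lemma norm_prod_ge0 l : 0 <= norm_prod l.
Proof. by apply: prodr_ge0. Qed.

Lemma norm_prod_nil : norm_prod [::] = 1.
Proof. by rewrite /norm_prod big_nil. Qed.

Lemma norm_prod_cons v l : norm_prod (v :: l) = `|v| * norm_prod l.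
Proof. by rewrite /norm_prod big_cons. Qed.

Lemma norm_prod_cat l1 l2 : norm_prod (l1 ++ l2) = norm_prod l1 * norm_prod l2.
Proof. by rewrite /norm_prod big_cat. Qed.

Lemma norm_prod_nseq n v : norm_prod (nseq n v) = `|v| ^+ n.
Proof. by elim: n => [|n IH]; rewrite ?norm_prod_nil ?expr0//= norm_prod_cons IH exprS. Qed.

(** Forms of all degrees are packed into one function on lists of arguments, so
that differentiation (inserting arguments) and substitution (cutting the list into
blocks) become structural recursions. *)
Definition list_multilinear P : Prop :=
  forall l1 l2, linear (fun u => P (l1 ++ u :: l2)).

Lemma list_multilinear_cons P x : list_multilinear P ->
  list_multilinear (fun l => P (x :: l)).
Proof. by move=> h l1 l2; apply: (h (x :: l1)). Qed.

Definition list_of_forms (p : forall n, ('I_n -> V) -> W) l : W :=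
  p (size l) (fun i => nth 0 l i).

Lemma list_of_formsE p l n : size l = n ->
  list_of_forms p l = p n (fun i => nth 0 l i).
Proof. by move=> <-. Qed.

Lemma list_of_forms_multilinear p : (forall n, multilinear (p n)) ->
  list_multilinear (list_of_forms p).
Proof.
move=> h l1 l2; pose n := (size l1 + (size l2).+1)%N.
have sz u : size (l1 ++ u :: l2) = n by rewrite size_cat.
have i0P : (size l1 < n)%N by rewrite /n addnS ltnS leq_addr.
pose i0 := Ordinal i0P; pose v (i : 'I_n) := nth 0 (l1 ++ 0 :: l2) i.
have E u : list_of_forms p (l1 ++ u :: l2) = p n (dfwith v i0 u).
  rewrite (list_of_formsE p (sz u)); congr (p n _); apply/funext => i.
  have [<-|ii] := eqVneq i0 i.
    by rewrite dfwithin nth_cat /= ltnn subnn.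
  rewrite dfwithout// /v !nth_cat; case: ifP => // il.
  case E: (i - size l1)%N => [|j] //=.
  move/negP: ii; case; apply/eqP/val_inj => /=.
  by apply/eqP; rewrite eqn_leq leqNgt il /= -subn_eq0; apply/eqP.
by move=> a x y /=; rewrite !E; apply: (h n v i0).
Qed.

Lemma list_of_forms_bound p (C a : R) :
  (forall n v, `|p n v| <= C * a ^+ n * \prod_(i < n) `|v i|) ->
  forall l, `|list_of_forms p l| <= C * a ^+ size l * norm_prod l.
Proof.
move=> h l; rewrite /list_of_forms; apply: le_trans (h _ _) _.
by rewrite /norm_prod (big_nth 0) big_mkord.
Qed.

Lemma list_of_forms_nseq p n h : list_of_forms p (nseq n h) = p n (fun=> h).
Proof.
rewrite (list_of_formsE p (size_nseq n h)); congr (p n _); apply/funext => i.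
by rewrite nth_nseq ltn_ord.
Qed.

Definition forms_of_list P n (v : 'I_n -> V) : W := P [seq v i | i <- enum 'I_n].

Lemma forms_of_list_multilinear P n : list_multilinear P ->
  multilinear (@forms_of_list P n).
Proof.
move=> h v i; pose s := [seq v j | j <- enum 'I_n].
have E u : [seq dfwith v i u j | j <- enum 'I_n] = take i s ++ u :: drop i.+1 s.
  have iE : (i < size (enum 'I_n))%N by rewrite size_enum_ord.
  have si : (i < size s)%N by rewrite size_map.
  apply: (@eq_from_nth _ 0) => [|j].
    have ss : size s = size (enum 'I_n) by rewrite size_map.
    by rewrite size_map size_cat /= size_drop size_takel ?(ltnW si)// ss addnS -addSn subnKC.
  rewrite size_map size_enum_ord => jn.
  rewrite (nth_map i) ?size_enum_ord//.
  have -> : nth i (enum 'I_n) j = Ordinal jn by apply: val_inj; rewrite /= nth_enum_ord.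
  have vs (x : 'I_n) : v x = nth 0 s x.
    by rewrite (nth_map x) ?size_enum_ord// nth_ord_enum.
  rewrite nth_cat size_takel ?(ltnW si)//.
  case: (ltngtP j i) => ji.
  - rewrite dfwithout ?nth_take// ?vs//.
    by apply/eqP => /(congr1 val)/= e; rewrite e ltnn in ji.
  - rewrite dfwithout; last by apply/eqP => /(congr1 val)/= e; rewrite e ltnn in ji.
    by rewrite vs /= -[in LHS](subnKC ji) -{2}(subnKC ji) addSn -addnS addKn /= nth_drop addSnnS.
  - have -> : Ordinal jn = i by apply: val_inj.
    by rewrite dfwithin ji subnn.
move=> a x y; rewrite /forms_of_list !E; exact: h.
Qed.

Lemma forms_of_list_nseq P n (h : V) : forms_of_list P (fun _ : 'I_n => h) = P (nseq n h).
Proof. rewrite /forms_of_list; congr P.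
by rewrite -[in RHS](size_enum_ord n); elim: (enum 'I_n) => //= i s ->. Qed.

Lemma forms_of_list_bound P (C a : R) n (v : 'I_n -> V) :
  (forall l, `|P l| <= C * a ^+ size l * norm_prod l) ->
  `|forms_of_list P v| <= C * a ^+ n * \prod_(i < n) `|v i|.
Proof.
move=> h; apply: le_trans (h _) _.
by rewrite size_map size_enum_ord /norm_prod big_map big_enum.
Qed.

End ListForms.

Section Insertion.
Context {R : realType} {V W : normedModType R}.
Implicit Types (P : seq V -> W) (l : seq V).

(** On a list of n copies of x this is the derivative of the polynomial
x |-> P [:: x; ...; x] of degree n + 1 in the direction v. *)
Fixpoint insertion (v : V) P l : W :=
  P (v :: l) + (if l is x :: l' then insertion v (fun l => P (x :: l)) l' else 0).

Lemma insertion_linear_form (F : V -> seq V -> W) v l :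
  (forall l, linear (F^~ l)) -> linear (fun u => insertion v (F u) l).
Proof.
elim: l F => [|x l IH] F lF a u w /=.
  by rewrite !addr0; exact: lF.
rewrite (lF (v :: x :: l)) (IH (fun u l => F u (x :: l))) => [|l']; last exact: lF.
by rewrite scalerDr -!addrA; congr (_ + _); rewrite addrCA.
Qed.

Lemma insertion_linear P l : list_multilinear P -> linear (fun v => insertion v P l).
Proof.
elim: l P => [|x l IH] P lP a u w /=.
  by rewrite !addr0; exact: (lP [::]).
rewrite (lP [::]) (IH (fun l => P (x :: l))) => [|l1 l2]; last exact: (lP (x :: l1)).
by rewrite scalerDr -!addrA; congr (_ + _); rewrite addrCA.
Qed.

Lemma insertion_multilinear v P : list_multilinear P -> list_multilinear (insertion v P).
Proof.
move=> lP l1; elim: l1 P lP => [|x l1 IH] P lP l2 a u w /=.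
  rewrite (lP [:: v]) (insertion_linear_form (F := fun u l => P (u :: l))) => [|l]; last first.
    exact: (lP [::]).
  by rewrite scalerDr -!addrA; congr (_ + _); rewrite addrCA.
rewrite (lP (v :: x :: l1)) (IH (fun l => P (x :: l)) (list_multilinear_cons _ lP)).
by rewrite scalerDr -!addrA; congr (_ + _); rewrite addrCA.
Qed.

Lemma insertion_bound v P (c : R) l : 0 <= c ->
  (forall l', size l' = (size l).+1 -> `|P l'| <= c * norm_prod l') ->
  `|insertion v P l| <= (size l).+1%:R * c * (`|v| * norm_prod l).
Proof.
elim: l P c => [|x l IH] P c c0 h /=.
  by rewrite addr0 mul1r; apply: le_trans (h _ _) _; rewrite ?norm_prod_cons.
rewrite (le_trans (ler_normD _ _))//.
have h1 : `|P (v :: x :: l)| <= c * (`|v| * (`|x| * norm_prod l)).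
  by apply: le_trans (h _ _) _ => //; rewrite !norm_prod_cons.
have h2 : `|insertion v (fun l => P (x :: l)) l| <=
    (size l).+1%:R * (c * `|x|) * (`|v| * norm_prod l).
  apply: IH => [|l' sl']; first by rewrite mulr_ge0.
  by apply: le_trans (h _ _) _; rewrite /= ?sl'// norm_prod_cons mulrA.
apply: le_trans (lerD h1 h2) _; rewrite norm_prod_cons -[(size l).+2%:R]natr1.
by rewrite le_eqVlt; apply/orP; left; apply/eqP; ring.
Qed.

Definition power_derivative P n (x k : V) : W :=
  if n is n'.+1 then insertion k P (nseq n' x) else 0.

Lemma power_lipschitz P n (c r : R) x y : list_multilinear P -> 0 <= c -> 0 < r ->
  (forall l, size l = n -> `|P l| <= c * norm_prod l) -> `|x| <= r -> `|y| <= r ->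
  `|P (nseq n y) - P (nseq n x)| <= c * n%:R * r ^+ n * (`|y - x| / r).
Proof.
move=> lP c0 r0 h xr yr; elim: n P c lP c0 h => [|n IH] P c lP c0 h /=.
  by rewrite subrr normr0 mulr0 !mul0r.
have -> : P (y :: nseq n y) - P (x :: nseq n x) =
    (P (y :: nseq n y) - P (y :: nseq n x)) + P ((y - x) :: nseq n x).
  by rewrite (linearB' _ _ (lP [::] _)) /= addrA subrK.
rewrite (le_trans (ler_normD _ _))//.
have h1 := IH (fun l => P (y :: l)) (c * r) (list_multilinear_cons _ lP) (mulr_ge0 c0 (ltW r0)).
have /h1{}h1 l : size l = n -> `|P (y :: l)| <= c * r * norm_prod l.
  move=> sl; apply: le_trans (h _ _) _; rewrite /= ?sl// norm_prod_cons mulrA.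
  by rewrite ler_wpM2r ?norm_prod_ge0// ler_wpM2l.
have h2 : `|P ((y - x) :: nseq n x)| <= c * (`|y - x| * r ^+ n).
  apply: le_trans (h _ _) _; rewrite /= ?size_nseq// norm_prod_cons norm_prod_nseq.
  by rewrite !ler_wpM2l// lerXn2r ?nnegrE// ltW.
apply: le_trans (lerD h1 h2) _; rewrite -natr1 exprS le_eqVlt; apply/orP; left; apply/eqP.
by field; rewrite gt_eqF.
Qed.

(** Peeling off the first argument leaves the same estimate for a form of smaller
degree and a product of two first order differences. *)
Lemma power_second_order P n (c r : R) x y : list_multilinear P -> 0 <= c -> 0 < r ->
  (forall l, size l = n -> `|P l| <= c * norm_prod l) -> `|x| <= r -> `|y| <= r ->
  `|P (nseq n y) - P (nseq n x) - power_derivative P n x (y - x)| <=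
     c * n%:R ^+ 2 * r ^+ n * (`|y - x| / r) ^+ 2.
Proof.
move=> lP c0 r0 h xr yr; elim: n P c lP c0 h => [|n IH] P c lP c0 h.
  by rewrite /= subr0 subrr normr0 expr0n /= mulr0 !mul0r.
have -> : P (nseq n.+1 y) - P (nseq n.+1 x) - power_derivative P n.+1 x (y - x) =
    (P (x :: nseq n y) - P (x :: nseq n x) -
       power_derivative (fun l => P (x :: l)) n x (y - x)) +
    (P ((y - x) :: nseq n y) - P ((y - x) :: nseq n x)).
  have -> : power_derivative P n.+1 x (y - x) = P ((y - x) :: nseq n x) +
      power_derivative (fun l => P (x :: l)) n x (y - x) by case: n {IH h}.
  rewrite /= [P ((y - x) :: nseq n y)](linearB' _ _ (lP [::] _)) /=.
  move: (P _) (P _) (P _) (P _) (power_derivative _ _ _ _) => b' K' c' a' D'.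
  have -> : a' - c' - (K' + D') = a' - K' + (- c' - D') by rewrite opprD addrACA.
  have -> : b' - c' - D' = b' + (- c' - D') by rewrite addrA.
  by rewrite [RHS]addrC [a' - b' - K']addrAC [RHS]addrA subrK.
rewrite (le_trans (ler_normD _ _))//.
have h1 := IH (fun l => P (x :: l)) (c * r) (list_multilinear_cons _ lP) (mulr_ge0 c0 (ltW r0)).
have /h1{}h1 l : size l = n -> `|P (x :: l)| <= c * r * norm_prod l.
  move=> sl; apply: le_trans (h _ _) _; rewrite /= ?sl// norm_prod_cons mulrA.
  by rewrite ler_wpM2r ?norm_prod_ge0// ler_wpM2l.
have k0 : 0 <= c * `|y - x| by rewrite mulr_ge0.
have h2 := @power_lipschitz (fun l => P ((y - x) :: l)) n _ r x y (list_multilinear_cons _ lP) k0 r0.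
have /h2{}h2 l : size l = n -> `|P ((y - x) :: l)| <= c * `|y - x| * norm_prod l.
  by move=> sl; apply: le_trans (h _ _) _; rewrite /= ?sl// norm_prod_cons mulrA.
apply: le_trans (lerD h1 (h2 xr yr)) _.
have -> : c * r * n%:R ^+ 2 * r ^+ n * (`|y - x| / r) ^+ 2 +
   c * `|y - x| * n%:R * r ^+ n * (`|y - x| / r) =
   c * (n%:R ^+ 2 + n%:R) * r ^+ n.+1 * (`|y - x| / r) ^+ 2.
  by rewrite (exprS r n); field; rewrite gt_eqF.
rewrite -[leLHS]mulrA -[leRHS]mulrA; apply: ler_wpM2r.
  by rewrite mulr_ge0 ?sqr_ge0// exprn_ge0// ltW.
apply: ler_wpM2l => //.
by rewrite -natr1; have : 0 <= n%:R :> R by []; nra.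
Qed.

Fixpoint insertions (l : seq V) P : seq V -> W :=
  if l is v :: l' then insertion v (insertions l' P) else P.

Lemma insertions_multilinear l P : list_multilinear P -> list_multilinear (insertions l P).
Proof. by move=> lP; elim: l => //= v l IH; apply: insertion_multilinear. Qed.

Lemma insertions_bound P (C A : R) : 0 <= C -> 0 <= A ->
  (forall l, `|P l| <= C * A ^+ size l * norm_prod l) -> forall l l',
  `|insertions l P l'| <= C * A ^+ (size l + size l') *
     ((size l + size l') ^_ (size l))%:R * norm_prod l * norm_prod l'.
Proof.
move=> C0 A0 h; elim=> [|v l IH] l' /=.
  by rewrite ffactn0 norm_prod_nil !mulr1 add0n.
pose c := C * A ^+ (size l + (size l').+1) *
     ((size l + (size l').+1) ^_ (size l))%:R * norm_prod l.
have c0 : 0 <= c by rewrite !mulr_ge0// ?exprn_ge0// norm_prod_ge0.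
apply: le_trans (insertion_bound v c0 _) _.
  by move=> l'' sl''; apply: le_trans (IH _) _; rewrite sl''.
rewrite ffactnSr addSn -addnS addKn natrM norm_prod_cons /c.
by rewrite le_eqVlt; apply/orP; left; apply/eqP; ring.
Qed.

Lemma bin_le_exp2 n m : ('C(n, m) <= 2 ^ n)%N.
Proof.
elim: n m => [|n IH] [|m]; rewrite ?bin0 ?bin0n ?expn_gt0//.
by rewrite binS expnS mul2n -addnn leq_add.
Qed.

(** Differentiating j times brings the factor (n + j) ^_ j, which is j`! times a
binomial coefficient, hence at most j`! 2 ^ (n + j). The price of Cauchy's
estimates is thus a factor 2 in A, however often one differentiates. *)
Lemma insertions_cauchy P (C A : R) : 0 <= C -> 0 <= A ->
  (forall l, `|P l| <= C * A ^+ size l * norm_prod l) -> forall l l',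
  `|insertions l P l'| <= (C * (2 * A) ^+ size l * (size l)`!%:R * norm_prod l) *
      (2 * A) ^+ size l' * norm_prod l'.
Proof.
move=> C0 A0 h l l'; apply: le_trans (insertions_bound C0 A0 h l l') _.
apply: ler_wpM2r; first exact: norm_prod_ge0.
rewrite -bin_ffact natrM.
have : ('C(size l + size l', size l))%:R <= 2 ^+ (size l + size l') :> R.
  by rewrite -natrX ler_nat bin_le_exp2.
set b := _%:R => bl.
have -> : C * A ^+ (size l + size l') * (b * (size l)`!%:R) * norm_prod l =
  (C * A ^+ (size l + size l') * (size l)`!%:R * norm_prod l) * b by ring.
apply: (le_trans (ler_wpM2l _ bl)).
  by rewrite !mulr_ge0// ?exprn_ge0// norm_prod_ge0.
by rewrite !exprD !exprMn le_eqVlt; apply/orP; left; apply/eqP; ring.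
Qed.

End Insertion.

(** * Termwise differentiation of power series *)

Section PowerSeries.
Context {R : realType} {V : normedModType R} {N : nat}.
Local Notation W := 'cV[R]_N.
Implicit Types (P : seq V -> W) (S : set V) (f : V -> W).

Lemma half_sum (n : nat) : \sum_(0 <= i < n) (2^-1 ^+ i : R) <= 2.
Proof.
suff -> : \sum_(0 <= i < n) (2^-1 ^+ i : R) = 2 - 2 * 2^-1 ^+ n.
  by rewrite lerBlDr lerDl mulr_ge0// exprn_ge0.
elim: n => [|n IH]; first by rewrite big_geq// expr0 mulr1 subrr.
by rewrite big_nat_recr//= IH exprS; field.
Qed.

Lemma succ_le_exp2 (n : nat) : n.+1%:R <= 2 ^+ n :> R.
Proof. by rewrite -natrX ler_nat ltn_expl. Qed.

Lemma sqr_le_exp2 (n : nat) : n%:R ^+ 2 <= 2 * 2 ^+ n :> R.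
Proof.
rewrite -natrX -natrX -natrM ler_nat.
case: n => [|[|[|n]]]//; elim: n => // n IH.
rewrite [(2 ^ n.+4)%N]expnS mulnCA; apply: leq_trans (leq_mul (leqnn 2) IH).
by rewrite -(ler_nat R) natrM !natrX -![_.+1%:R]natr1; have : 0 <= n%:R :> R by []; nra.
Qed.

Lemma geometric_limit (u : nat -> W) (c : R) : 0 <= c ->
  (forall n, `|u n| <= c * 2^-1 ^+ n) -> exists2 l : W, `|l| <= 2 * c & series u @ \oo --> l.
Proof.
move=> c0 h.
have T n m : (n <= m)%N -> `|series u m - series u n| <= 2 * c * 2^-1 ^+ n.
  by apply: geometric_telescope => j; rewrite seriesSB; exact: h.
have [l lP] := cauchy_limit T (cvg_half (2 * c)).
exists l.
  have := lP 0%N; rewrite expr0 mulr1 /series /= big_geq// subr0.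
  by [].
apply/cvgrPdist_le => e e0.
have /cvgrPdist_le/(_ _ e0) := cvg_half (2 * c).
apply: filterS => n; rewrite sub0r normrN => hn.
by apply: le_trans (lP n) _; apply: le_trans (ler_norm _) hn.
Qed.

Lemma cvg_norm_le (u : nat -> W) (l : W) (c : R) : u @ \oo --> l ->
  (\forall n \near \oo, `|u n| <= c) -> `|l| <= c.
Proof.
move=> ul h; have nl : (fun n => `|u n|) @ \oo --> `|l| by apply: cvg_norm.
rewrite -(cvg_lim _ nl)//; apply: limr_le => //.
by apply/cvg_ex; exists `|l|.
Qed.

Definition power_sum P (x : V) (y : W) : Prop :=
  series (fun n => P (nseq n x)) @ \oo --> y.

(** The bound on A r leaves room for factors that grow like 2 ^ n. *)
Definition convergent_at P (C A r : R) : Prop :=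
  [/\ list_multilinear P, [&& 0 <= C, 0 <= A, 0 < r & A * r <= 4^-1] &
      forall l, `|P l| <= C * A ^+ size l * norm_prod l].

Lemma small_power (A r : R) n : 0 <= A -> 0 < r -> A * r <= 4^-1 ->
  A ^+ n * r ^+ n <= 2^-1 ^+ n * 2^-1 ^+ n.
Proof.
move=> A0 r0 Ar; rewrite -!exprMn; apply: lerXn2r; rewrite ?nnegrE ?mulr_ge0 ?(ltW r0)//.
by apply: le_trans Ar _; lra.
Qed.

(** The quadratic remainders of the terms add up to a quadratic remainder of the
sum. *)
Lemma power_sum_derivative S (x0 : V) f (P : seq V -> W) (C A r : R) x :
  convergent_at P C A r -> `|x - x0| < r -> S x ->
  (forall y, S y -> `|y - x0| < r -> power_sum P (y - x0) (f y)) ->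
  exists2 df, derivative_within S f x df &
     forall v, power_sum (insertion v P) (x - x0) (df v).
Proof.
move=> [lP /and4P[C0 A0 r0 Ar] bP] xr Sx fP.
have term v n : `|insertion v P (nseq n (x - x0))| <= C * A * `|v| * 2^-1 ^+ n.
  have h : forall l', size l' = (size (nseq n (x - x0))).+1 ->
      `|P l'| <= (C * A ^+ n.+1) * norm_prod l'.
    by move=> l'; rewrite size_nseq => sl; apply: le_trans (bP _) _; rewrite sl.
  apply: le_trans (insertion_bound v _ h) _; first by rewrite mulr_ge0// exprn_ge0.
  rewrite size_nseq norm_prod_nseq.
  have -> : n.+1%:R * (C * A ^+ n.+1) * (`|v| * `|x - x0| ^+ n) =
    (C * A * `|v|) * (n.+1%:R * (A ^+ n * `|x - x0| ^+ n)) by rewrite exprS; ring.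
  apply: ler_wpM2l; first by rewrite !mulr_ge0.
  have h1 : `|x - x0| ^+ n <= r ^+ n by rewrite lerXn2r ?nnegrE// ltW.
  have h2 := ler_wpM2l (exprn_ge0 n A0) h1.
  have h3 := le_trans h2 (small_power n A0 r0 Ar).
  apply: (le_trans (ler_wpM2l _ h3)) => //.
  rewrite mulrA; apply: ler_piMl; first by rewrite exprn_ge0.
  by rewrite exprVn ler_pdivrMr ?exprn_gt0// mul1r succ_le_exp2.
have [df dfP] : exists df : V -> W, forall v, power_sum (insertion v P) (x - x0) (df v).
  have H v : exists d, power_sum (insertion v P) (x - x0) d.
    have [|l _ lP'] := @geometric_limit _ (C * A * `|v|) _ (term v); first by rewrite !mulr_ge0.
    by exists l.
  by exists (fun v => sval (cid (H v))) => v; exact: svalP (cid (H v)).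
exists df => //; split.
  move=> a u v; apply/esym/(cvg_unique _ _ (dfP _)) => //.
  have -> : series (fun n => insertion (a *: u + v) P (nseq n (x - x0))) =
      (fun n => a *: series (fun n => insertion u P (nseq n (x - x0))) n +
         series (fun n => insertion v P (nseq n (x - x0))) n).
    apply/funext => n; rewrite /series /= scaler_sumr -big_split /=; apply: eq_bigr => i _.
    by rewrite (insertion_linear _ lP).
  by apply: cvgD (dfP v); apply: cvgZ (dfP u); exact: cvg_cst.
have quad y : S y -> `|y - x0| < r ->
    `|f y - f x - df (y - x)| <= 4 * C * (`|y - x| / r) ^+ 2.
  move=> Sy yr; set d2 := (_ / r) ^+ 2.
  have cv : (fun M => series (fun n => P (nseq n (y - x0))) M.+1 -
      series (fun n => P (nseq n (x - x0))) M.+1 -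
      series (fun n => insertion (y - x) P (nseq n (x - x0))) M) @ \oo --> f y - f x - df (y - x).
    apply: cvgB (dfP _); apply: cvgB.
      by have := fP y Sy yr; rewrite /power_sum -(cvg_shiftS (series _)).
    by have := fP x Sx xr; rewrite /power_sum -(cvg_shiftS (series _)).
  apply: (cvg_norm_le cv); apply: nearW => M.
  have -> : series (fun n => insertion (y - x) P (nseq n (x - x0))) M =
     \sum_(0 <= n < M.+1) power_derivative P n (x - x0) (y - x).
    by rewrite big_nat_recl//= add0r.
  rewrite /series /= -!sumrB; apply: le_trans (ler_norm_sum _ _ _) _.
  have d20 : 0 <= d2 by exact: sqr_ge0.
  apply: (@le_trans _ _ (\sum_(0 <= n < M.+1) 2 * C * d2 * 2^-1 ^+ n)); last first.
    rewrite -mulr_sumr; have := half_sum M.+1; set s := \sum_(_ <= _ < _) _ => hs.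
    have := ler_wpM2l (mulr_ge0 (mulr_ge0 (ler0n R 2) C0) d20) hs.
    by lra.
  apply: ler_sum => n _.
  have -> : y - x = (y - x0) - (x - x0) by rewrite opprB addrA subrK.
  have h l : size l = n -> `|P l| <= C * A ^+ n * norm_prod l.
    by move=> <-; exact: bP.
  apply: (le_trans (power_second_order lP _ r0 h (ltW xr) (ltW yr))).
    by rewrite mulr_ge0// exprn_ge0.
  have -> : (y - x0) - (x - x0) = y - x by rewrite opprB addrA subrK.
  rewrite -/d2.
  have -> : C * A ^+ n * n%:R ^+ 2 * r ^+ n * d2 = (C * d2) * (n%:R ^+ 2 * (A ^+ n * r ^+ n)) by ring.
  have -> : 2 * C * d2 * 2^-1 ^+ n = (C * d2) * (2 * 2^-1 ^+ n) by ring.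
  apply: ler_wpM2l; first by rewrite mulr_ge0.
  apply: (le_trans (ler_wpM2l (sqr_ge0 _) (small_power n A0 r0 Ar))).
  rewrite mulrA; apply: ler_wpM2r; first by rewrite exprn_ge0.
  by rewrite exprVn ler_pdivrMr ?exprn_gt0// sqr_le_exp2.
move=> e e0; apply/near_withinP.
have q0 : 0 < e * r ^+ 2 / (4 * C + 1) by rewrite divr_gt0 ?mulr_gt0 ?exprn_gt0// ltr_wpDl ?mulr_ge0.
exists (Num.min (r - `|x - x0|) (e * r ^+ 2 / (4 * C + 1))).
  by rewrite lt_min subr_gt0 xr q0.
move=> y Sy; rewrite lt_min => /andP[y1 y2].
have yr : `|y - x0| < r.
  have -> : y - x0 = (y - x) + (x - x0) by rewrite addrA subrK.
  by apply: le_lt_trans (ler_normD _ _) _; rewrite -ltrBrDr.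
apply: le_trans (quad y Sy yr) _.
rewrite exprMn exprVn expr2.
have -> : 4 * C * (`|y - x| * `|y - x| / r ^+ 2) = (4 * C * (`|y - x| / r ^+ 2)) * `|y - x| by ring.
apply: ler_wpM2r => //.
rewrite mulrA ler_pdivrMr ?exprn_gt0//.
have := ler_wpM2l (mulr_ge0 (ler0n R 4) C0) (ltW y2).
move=> h; apply: le_trans h _; rewrite mulrA ler_pdivrMr ?ltr_wpDl ?mulr_ge0//.
rewrite mulrC; apply: ler_wpM2l; first by rewrite mulr_ge0 ?exprn_ge0 ?(ltW e0) ?(ltW r0).
by rewrite lerDl.
Qed.

End PowerSeries.

(** * Taylor expansion with uniform radius *)

Section Taylor.
Context {R : realType} {V : normedModType R} {N : nat}.
Local Notation W := 'cV[R]_N.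

Lemma is_derive_monomial (k : R) n (s : R) :
  is_derive s 1 (fun t : R => k * t ^+ n.+1) (k * (n.+1%:R * s ^+ n)).
Proof.
have h : is_derive s 1 ((id : R -> R) ^+ n.+1) ((n.+1%:R * s ^+ n) *: 1).
  exact: is_deriveX.
rewrite [X in is_derive _ _ X](_ : _ = k \*: ((id : R -> R) ^+ n.+1)); last first.
  by apply/funext => t; rewrite /= exprfctE.
by apply: is_derive_eq; rewrite /GRing.scale/= mulr1.
Qed.

Lemma is_derive_taylor_polynomial (c : nat -> W) (M : nat) (s : R) :
  is_derive s 1 (fun s : R => \sum_(0 <= n < M.+1) (s ^+ n / n`!%:R) *: c n)
    (\sum_(0 <= n < M) (s ^+ n / n`!%:R) *: c n.+1).
Proof.
elim: M => [|M IH].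
  rewrite [X in is_derive _ _ X](_ : _ = fun=> c 0%N); last first.
    by apply/funext => t; rewrite big_nat1 expr0 fact0 divr1 scale1r.
  by rewrite big_geq//; exact: is_derive_cst.
rewrite [X in is_derive _ _ X](_ : _ = (fun s : R => \sum_(0 <= n < M.+1) (s ^+ n / n`!%:R) *: c n)
    \+ (fun s : R => (s ^+ M.+1 / M.+1`!%:R) *: c M.+1)); last first.
  by apply/funext => t; rewrite big_nat_recr.
rewrite big_nat_recr//=; apply: is_deriveD.
apply/is_derive_coordP => i; rewrite mxE.
rewrite [X in is_derive _ _ X](_ : _ = fun t : R => (c M.+1 i 0 / M.+1`!%:R) * t ^+ M.+1); last first.
  by apply/funext => t; rewrite mxE mulrC mulrA mulrAC.
apply: is_derive_eq; first exact: is_derive_monomial.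
rewrite factS natrM.
have f0 : M`!%:R != 0 :> R by rewrite pnatr_eq0 -lt0n fact_gt0.
field.
by rewrite f0 /= addrC natr1 pnatr_eq0.
Qed.

Context (fV : fin_dim V) (S : set V) (D : seq V -> V -> W)
  (DD : forall l x, S x -> derivative_within S (D l) x (fun v => D (v :: l) x)).

(** Integrating the estimate of order M for the derivative in the direction
y - x. The factor 1/M! must not be lost, since the derivatives of order M of an
analytic function may grow like M!. *)
Lemma taylor_remainder M l x y (K : R) : 0 <= K ->
  (forall s, 0 <= s <= 1 -> S (x + s *: (y - x))) ->
  (forall s, 0 <= s <= 1 -> `|D (nseq M (y - x) ++ l) (x + s *: (y - x))| <= K) ->
  forall s, 0 <= s <= 1 ->
  `|D l (x + s *: (y - x)) - \sum_(0 <= n < M) (s ^+ n / n`!%:R) *: D (nseq n (y - x) ++ l) x| <=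
     K * (s ^+ M / M`!%:R).
Proof.
move=> K0 seg; elim: M l => [|M IH] l bD s s01.
  by rewrite big_geq// subr0 expr0 fact0 divr1 mulr1; exact: bD.
have shift n : nseq n (y - x) ++ (y - x) :: l = nseq n.+1 (y - x) ++ l.
  by rewrite -cat_rcons; congr (_ ++ _); rewrite -cats1 -[[:: _]]/(nseq 1 _) -nseqD addn1.
have [gc Dg] := segment_path fV seg (DD l).
pose T (s : R) := \sum_(0 <= n < M.+1) (s ^+ n / n`!%:R) *: D (nseq n (y - x) ++ l) x.
pose dT (s : R) := \sum_(0 <= n < M) (s ^+ n / n`!%:R) *: D (nseq n.+1 (y - x) ++ l) x.
have DT (u : R) : is_derive u 1 T (dT u) by exact: is_derive_taylor_polynomial.
pose b (s : R) := K * (s ^+ M.+1 / M.+1`!%:R).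
pose db (s : R) := K * (s ^+ M / M`!%:R).
have f0 m : 0 < m`!%:R :> R by rewrite ltr0n fact_gt0.
have Db (u : R) : is_derive u 1 b (db u).
  rewrite /b [X in is_derive _ _ X](_ : _ = fun t : R => (K / M.+1`!%:R) * t ^+ M.+1); last first.
    by apply/funext => t; rewrite [t ^+ _ / _]mulrC mulrA.
  apply: is_derive_eq; first exact: is_derive_monomial.
  rewrite factS natrM /db; field.
  by rewrite (gt_eqF (f0 M)) /= addrC natr1 pnatr_eq0.
have := @path_majorant _ _ (fun s => D l (x + s *: (y - x)) - T s)
  (fun s => D (y - x :: l) (x + s *: (y - x)) - dT s) 0 b db.
have T0 : T 0 = D l x.
  rewrite /T big_nat_recl// expr0 fact0 divr1 scale1r big1 ?addr0// => n _.
  by rewrite expr0n /= mul0r scale0r.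
rewrite /= scale0r addr0 T0 subrr; move=> H.
have b0 : b 0 = 0 by rewrite /b expr0n /= mul0r mulr0.
rewrite -[leRHS]subr0 -b0 -[X in `|X|]subr0 -[X in `|_ - X|](scaler0 _ s) -[X in `|X - _|]subr0.
apply: H => //.
- by move=> u; apply: continuousB; [exact: gc|
    apply: continuous_subspaceT => {}u; have ? := DT u; apply: is_derive_continuous].
- by move=> u u01; have ? := Dg u u01; have ? := DT u; apply: is_derive_eq.
- move=> u /andP[u0 u1]; rewrite subr0 /dT /db.
  under eq_bigr do rewrite -shift.
  apply: IH; last by rewrite !ltW.
  by move=> t t01; rewrite shift; exact: bD.
- move=> u /andP[u0 _]; rewrite b0 /b mulr_ge0// divr_ge0 ?exprn_ge0// ltW//.
Qed.

(** The radius is determined by the bounds on the derivatives alone, so it is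
uniform when they are; the definition of analyticity only provides some radius at
each point. *)
Lemma taylor_series x y (C a : R) : 0 <= C -> 0 <= a -> a * `|y - x| <= 2^-1 ->
  (forall s, 0 <= s <= 1 -> S (x + s *: (y - x))) ->
  (forall s l, 0 <= s <= 1 ->
     `|D l (x + s *: (y - x))| <= C * a ^+ size l * (size l)`!%:R * norm_prod l) ->
  power_sum (fun l => (size l)`!%:R^-1 *: D l x) (y - x) (D [::] y).
Proof.
move=> C0 a0 ha seg bD; apply/cvgrPdist_le => e e0.
have /cvgrPdist_le/(_ _ e0) := cvg_half C.
apply: filterS => n; rewrite sub0r normrN => hn.
apply: le_trans hn; apply: le_trans (ler_norm _).
have f0 m : 0 < m`!%:R :> R by rewrite ltr0n fact_gt0.
have K0 : 0 <= C * (a * `|y - x|) ^+ n * n`!%:R by rewrite !mulr_ge0 ?exprn_ge0 ?mulr_ge0.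
have := @taylor_remainder n [::] x y _ K0 seg _ 1.
have -> : x + 1 *: (y - x) = y by rewrite scale1r addrC subrK.
rewrite expr1n /series /= ler01 lexx => H.
have -> : \sum_(0 <= i < n) (size (nseq i (y - x)))`!%:R^-1 *: D (nseq i (y - x)) x =
   \sum_(0 <= i < n) (1 ^+ i / i`!%:R) *: D (nseq i (y - x) ++ [::]) x.
  by apply: eq_bigr => i _; rewrite size_nseq cats0 expr1n div1r.
apply: le_trans (H _ isT) _.
  move=> s s01; apply: le_trans (bD _ _ s01) _.
  by rewrite cats0 size_nseq norm_prod_nseq exprMn le_eqVlt; apply/orP; left; apply/eqP; ring.
rewrite mulrA mulr1 mulfK ?gt_eqF//; apply: ler_wpM2l => //.
by apply: lerXn2r; rewrite ?nnegrE ?mulr_ge0.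
Qed.

End Taylor.

(** * Analytic functions on a set *)

Section AnalyticClosure.
Context {R : realType}.

(** The condition [analytic_within] with forms on lists and nonnegative constants. *)
Definition list_analytic_at (V W : normedModType R) (S : set V) (f : V -> W) (x : V)
    (P : seq V -> W) : Prop :=
  list_multilinear P /\ exists C A r : R,
    [/\ [&& 0 <= C, 0 <= A & 0 < r],
      forall l, `|P l| <= C * A ^+ size l * norm_prod l &
      forall h, `|h| < r -> S (x + h) -> series (fun n => P (nseq n h)) @ \oo --> f (x + h)].

Lemma analytic_withinP (V W : normedModType R) (S : set V) (f : V -> W) (x : V) :
  analytic_within S f x <-> exists P, list_analytic_at S f x P.
Proof.
split.
  move=> [p [C [a [r [r0 lp bp cv]]]]].
  exists (list_of_forms p); split; first exact: list_of_forms_multilinear.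
  exists `|C|, `|a|, r; split; first by rewrite !normr_ge0 r0.
    apply: list_of_forms_bound => n v; apply: le_trans (bp n v) _.
    apply: ler_wpM2r; first exact: prodr_ge0.
    by apply: le_trans (ler_norm _) _; rewrite normrM normrX.
  move=> h hr Sh; have -> : (fun n => list_of_forms p (nseq n h)) = fun n => p n (fun=> h).
    by apply/funext => n; rewrite list_of_forms_nseq.
  exact: cv.
move=> [P [lP [C [A [r [/and3P[C0 A0 r0] bP cv]]]]]].
exists (fun n => @forms_of_list _ _ _ P n), C, A, r; split => //.
- by move=> n; exact: forms_of_list_multilinear.
- by move=> n v; exact: forms_of_list_bound.
move=> h hr Sh.
have -> : (fun n => forms_of_list P (fun _ : 'I_n => h)) = fun n => P (nseq n h).
  by apply/funext => n; rewrite forms_of_list_nseq.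
exact: cv.
Qed.

Lemma analytic_within_subset (V W : normedModType R) (S S' : set V) (f : V -> W) x :
  S' `<=` S -> analytic_within S f x -> analytic_within S' f x.
Proof.
move=> SS [p [C [a [r [r0 lp bp cv]]]]]; exists p, C, a, r; split => // h hr Sh.
by apply: cv => //; apply: SS.
Qed.

Lemma analytic_within_ext (V W : normedModType R) (S : set V) (f g : V -> W) x :
  (forall y, S y -> f y = g y) -> analytic_within S f x -> analytic_within S g x.
Proof.
move=> fg [p [C [a [r [r0 lp bp cv]]]]]; exists p, C, a, r; split => // h hr Sh.
by rewrite -fg//; apply: cv.
Qed.

Lemma coefficient_majorant (C C' A A' : R) n : 0 <= C -> 0 <= C' -> 0 <= A -> 0 <= A' ->
  C * A ^+ n <= (C + C') * (A + A') ^+ n.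
Proof.
move=> *; apply: ler_pM => //; first exact: exprn_ge0.
  by rewrite lerDl.
by apply: lerXn2r; rewrite ?nnegrE ?addr_ge0// lerDl.
Qed.

Lemma analytic_withinD (V W : normedModType R) (S : set V) (f g : V -> W) x :
  analytic_within S f x -> analytic_within S g x ->
  analytic_within S (fun y => f y + g y) x.
Proof.
move=> /analytic_withinP[P [lP [C [A [r [/and3P[C0 A0 r0] bP cv]]]]]].
move=> /analytic_withinP[Q [lQ [C' [A' [r' [/and3P[C'0 A'0 r'0] bQ cv']]]]]].
apply/analytic_withinP; exists (fun l => P l + Q l); split.
  by move=> l1 l2 a u v /=; rewrite lP lQ scalerDr addrACA.
exists ((C + C') + (C' + C)), (A + A'), (Num.min r r'); split.
- by rewrite !addr_ge0// lt_min r0 r'0.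
- move=> l; apply: le_trans (ler_normD _ _) _.
  apply: le_trans (lerD (bP l) (bQ l)) _; rewrite -mulrDl.
  apply: ler_wpM2r; first exact: norm_prod_ge0.
  rewrite [X in _ <= X]mulrDl; apply: lerD; first exact: coefficient_majorant.
  by rewrite [A + A']addrC; exact: coefficient_majorant.
move=> h; rewrite lt_min => /andP[hr hr'] Sh.
have -> : series (fun n => P (nseq n h) + Q (nseq n h)) =
   (fun M => series (fun n => P (nseq n h)) M + series (fun n => Q (nseq n h)) M).
  by apply/funext => M; rewrite /series /= big_split.
by apply: cvgD; [exact: cv | exact: cv'].
Qed.

Lemma analytic_within_linear (V W : normedModType R) (S : set V) (f : V -> W) x :
  fin_dim V -> linear f -> analytic_within S f x.
Proof.
move=> fV lf; have [K K0 bK] := linear_bounded fV lf.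
apply/analytic_withinP.
exists (fun l => match l with [::] => f x | [:: v] => f v | _ => 0 end); split.
  by move=> [|v [|w l1]] [|v' l2] a u u' //=; rewrite ?scaler0 ?addr0//; exact: lf.
exists (`|f x| + K), 1, 1; split; first by rewrite addr_ge0 ?(ltW K0)//= ler01 ltr01.
  move=> l; rewrite expr1n mulr1; case: l => [|v [|w l]].
  - by rewrite norm_prod_nil mulr1 lerDl ltW.
  - rewrite norm_prod_cons norm_prod_nil mulr1; apply: le_trans (bK v) _.
    by apply: ler_wpM2r => //; rewrite lerDr.
  - by rewrite normr0 mulr_ge0 ?norm_prod_ge0// addr_ge0// ltW.
move=> h _ _; rewrite -(cvg_shiftS (series _)) -(cvg_shiftS (fun n => series _ n.+1)).
have -> : (fun n => series (fun n => match nseq n h with [::] => f x | [:: v] => f v | _ => 0 end) n.+2) =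
    fun=> f (x + h).
  apply/funext => n; rewrite /series /= !big_nat_recl//= big1 ?addr0 => [|i _ //].
  by rewrite (linearD' _ _ lf).
exact: cvg_cst.
Qed.

Lemma analytic_within_precomp (U V W : normedModType R) (S : set U) (T : set V)
    (f : V -> W) (L : U -> V) x : fin_dim U -> linear L -> (forall y, S y -> T (L y)) ->
  analytic_within T f (L x) -> analytic_within S (f \o L) x.
Proof.
move=> fU lL ST; have [K K0 bK] := linear_bounded fU lL.
move=> /analytic_withinP[P [lP [C [A [r [/and3P[C0 A0 r0] bP cv]]]]]].
apply/analytic_withinP; exists (P \o map L); split.
  by move=> l1 l2 a u v /=; rewrite !map_cat /= lL; exact: lP.
exists C, (A * K), (r / K); split; first by rewrite C0 mulr_ge0 ?divr_gt0// ltW.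
  move=> l; apply: le_trans (bP _) _; rewrite size_map exprMn mulrA -[leRHS]mulrA.
  apply: ler_wpM2l; first by rewrite mulr_ge0// exprn_ge0.
  elim: l => [|v l IH] /=; first by rewrite !norm_prod_nil expr0 mul1r.
  rewrite !norm_prod_cons exprS mulrACA; apply: ler_pM => //; exact: norm_prod_ge0.
move=> h; rewrite ltr_pdivlMr// => hr Sh.
have -> : (fun n => (P \o map L) (nseq n h)) = fun n => P (nseq n (L h)).
  by apply/funext => n; rewrite /= map_nseq.
rewrite /= (linearD' _ _ lL); apply: cv; first by apply: le_lt_trans (bK h) _; rewrite mulrC.
by rewrite -(linearD' _ _ lL); exact: ST.
Qed.

Lemma analytic_within_scale (V W : normedModType R) (S : set V) (k : V -> R) (f : V -> W) x :
  fin_dim V -> linear k -> analytic_within S f x -> analytic_within S (fun y => k y *: f y) x.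
Proof.
move=> fV lk; have [K K0 bK] := linear_bounded fV lk.
move=> /analytic_withinP[P [lP [C [A [r [/and3P[C0 A0 r0] bP cv]]]]]].
apply/analytic_withinP.
pose Q l := k x *: P l + (if l is v :: l' then k v *: P l' else 0).
exists Q; split.
  case=> [|w l1] l2 a u v /=; rewrite /Q /=.
    rewrite [P (_ :: _)](lP [::]) lk /= scalerDl !scalerDr !scalerA [k x * a]mulrC.
    by rewrite addrACA.
  rewrite [P (_ :: _ ++ _)](lP (w :: l1)) [P (l1 ++ _)](lP l1) /= !scalerDr !scalerA.
  by rewrite [k x * a]mulrC [k w * a]mulrC addrACA.
exists (`|k x| * C + K * C), (A + 1), r; split.
- by rewrite !addr_ge0 ?mulr_ge0 ?(ltW K0).
- have pw n : A ^+ n <= (A + 1) ^+ n.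
    by apply: lerXn2r; rewrite ?nnegrE ?addr_ge0// lerDl.
  move=> l; apply: le_trans (ler_normD _ _) _; rewrite !mulrDl; apply: lerD.
    rewrite normrZ -!mulrA; apply: ler_wpM2l => //; apply: le_trans (bP l) _.
    by rewrite -mulrA; apply: ler_wpM2l => //; apply: ler_wpM2r => //; exact: norm_prod_ge0.
  case: l => [|v l].
    by rewrite normr0 !mulr_ge0 ?exprn_ge0 ?norm_prod_ge0 ?addr_ge0 ?(ltW K0).
  rewrite normrZ norm_prod_cons /=.
  have -> : K * C * (A + 1) ^+ (size l).+1 * (`|v| * norm_prod l) =
     (K * `|v|) * (C * (A + 1) ^+ (size l).+1 * norm_prod l) by ring.
  apply: ler_pM => //; apply: le_trans (bP l) _.
  apply: ler_wpM2r; first exact: norm_prod_ge0.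
  apply: ler_wpM2l => //; apply: le_trans (pw _) _; rewrite exprS; apply: ler_peMl.
    by rewrite exprn_ge0 ?addr_ge0.
  by rewrite lerDr.
move=> h hr Sh; rewrite (linearD' _ _ lk) scalerDl -(cvg_shiftS (series _)).
have -> : (fun n => series (fun n => Q (nseq n h)) n.+1) =
   (fun n => k x *: series (fun n => P (nseq n h)) n.+1 + k h *: series (fun n => P (nseq n h)) n).
  apply/funext => M; rewrite /series /= /Q big_split /= !scaler_sumr; congr (_ + _).
  by rewrite big_nat_recl//= add0r.
apply: cvgD; apply: cvgZ; try exact: cvg_cst; last exact: cv.
by rewrite (cvg_shiftS (series _)); exact: cv.
Qed.

End AnalyticClosure.

Section DerivativeFamily.
Context {R : realType} {V : normedModType R} {N : nat}.
Local Notation W := 'cV[R]_N.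
Context (fV : fin_dim V) (S : set V) (thS : forall x, S x -> thick_at S x).

(** Derivatives are chosen once and for all, which allows to iterate them; on
thick sets the choice is unique. *)
Definition some_derivative (f : V -> W) (x : V) : V -> W :=
  xget (fun=> 0) [set df | derivative_within S f x df].

Lemma some_derivativeE f x df : S x -> derivative_within S f x df ->
  some_derivative f x = df.
Proof.
move=> Sx Df; rewrite /some_derivative; case: xgetP => [df' _ h|h]; last by case: (h df).
exact: (derivative_within_unique (thS Sx) h Df).
Qed.

Fixpoint iterated_derivative (f : V -> W) (l : seq V) : V -> W :=
  if l is v :: l' then fun x => some_derivative (iterated_derivative f l') x v else f.

Definition cauchy_bound f (x : V) (C a r : R) : Prop :=
  forall y l, S y -> `|y - x| < r ->
    `|iterated_derivative f l y| <= C * a ^+ size l * (size l)`!%:R * norm_prod l.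

(** On a ball around x the iterated derivatives are the sums of the series
obtained by insertions. At x itself only the term of degree 0 of such a series
remains, and it is multilinear in the inserted arguments. *)
Lemma analytic_local f x : S x -> analytic_within S f x ->
  [/\ forall l, derivative_within S (iterated_derivative f l) x
        (fun v => iterated_derivative f (v :: l) x),
      list_multilinear (fun l => iterated_derivative f l x) &
      exists C a r, [/\ [&& 0 <= C, 0 <= a & 0 < r] & cauchy_bound f x C a r]].
Proof.
move=> Sx /analytic_withinP[P [lP [C [A [r1 [/and3P[C0 A0 r10] bP cv]]]]]].
pose a := 2 * A; have a0 : 0 <= a by rewrite mulr_ge0.
(* makes a * r at most 1/4 *)
pose r := Num.min r1 (4 * (a + 1))^-1.
have r0 : 0 < r by rewrite lt_min r10 invr_gt0 mulr_gt0// ltr_wpDl.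
have ar : a * r <= 4^-1.
  apply: (@le_trans _ _ (a * (4 * (a + 1))^-1)); first by rewrite ler_wpM2l// ge_min lexx orbT.
  have -> : a * (4 * (a + 1))^-1 = a / (a + 1) * 4^-1 by field; rewrite gt_eqF ?ltr_wpDl.
  by apply: ler_piMl => //; rewrite ler_pdivrMr ?ltr_wpDl// mul1r lerDl.
pose Cl (l : seq V) := C * a ^+ size l * (size l)`!%:R * norm_prod l.
have Cl0 l : 0 <= Cl l by rewrite !mulr_ge0 ?exprn_ge0 ?norm_prod_ge0.
have conv l : convergent_at (insertions l P) (Cl l) a r.
  split; first exact: insertions_multilinear.
    by rewrite Cl0 a0 r0 ar.
  by move=> l'; exact: insertions_cauchy.
have exp l y : S y -> `|y - x| < r ->
    power_sum (insertions l P) (y - x) (iterated_derivative f l y) /\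
    derivative_within S (iterated_derivative f l) y (fun v => iterated_derivative f (v :: l) y).
  elim: l y => [|v l IH] y Sy yr.
    have H z : S z -> `|z - x| < r -> power_sum P (z - x) (f z).
      move=> Sz zr; rewrite /power_sum.
      have {2}-> : z = x + (z - x) by rewrite addrC subrK.
      apply: cv; first by apply: lt_le_trans zr _; rewrite ge_min lexx.
      by rewrite addrC subrK.
    split; first exact: H.
    have [df Df _] := power_sum_derivative (conv [::]) yr Sy H.
    by rewrite /= (some_derivativeE Sy Df).
  have H1 z : S z -> `|z - x| < r -> power_sum (insertions (v :: l) P) (z - x)
      (iterated_derivative f (v :: l) z).
    move=> Sz zr; have [df Df pdf] := power_sum_derivative (conv l) zr Sz
      (fun w Sw wr => (IH w Sw wr).1).
    by rewrite /= (some_derivativeE Sz Df); exact: pdf.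
  split; first exact: H1.
  have [df Df _] := power_sum_derivative (conv (v :: l)) yr Sy H1.
  have E := some_derivativeE Sy Df.
  have -> : (fun w => iterated_derivative f [:: w, v & l] y) = df.
    by rewrite -E.
  exact: Df.
have xx : `|x - x| < r by rewrite subrr normr0.
have at_center l : iterated_derivative f l x = insertions l P [::].
  have [h _] := exp l x Sx xx.
  suff h' : power_sum (insertions l P) (x - x) (insertions l P [::]).
    exact: (cvg_unique _ h h').
  rewrite /power_sum subrr -(cvg_shiftS (series _)).
  have -> : (fun n => series (fun n => insertions l P (nseq n 0)) n.+1) = fun=> insertions l P [::].
    apply/funext => n; rewrite /series /= big_nat_recl//= big1 ?addr0// => i _.
    have lin := (insertions_multilinear l lP) [::] (nseq i 0).
    exact: (linear0' lin).
  exact: cvg_cst.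
split.
- by move=> l; have [] := exp l x Sx xx.
- move=> l1 l2; suff lin l' : linear (fun u => insertions (l1 ++ u :: l2) P l').
    by move=> b u v; rewrite !at_center; exact: lin.
  elim: l1 l' => [|w l1 IH] l' /=; first exact: (insertion_linear _ (insertions_multilinear l2 lP)).
  exact: (insertion_linear_form (F := fun u => insertions (l1 ++ u :: l2) P)).
exists (2 * C), a, r; split; first by rewrite mulr_ge0 ?a0.
move=> y l Sy yr; have [h _] := exp l y Sy yr.
have [_ /and4P[_ _ _ _] bl] := conv l.
have tm n : `|insertions l P (nseq n (y - x))| <= Cl l * 2^-1 ^+ n.
  apply: le_trans (bl _) _; rewrite size_nseq norm_prod_nseq -mulrA.
  apply: ler_wpM2l => //.
  have h1 : `|y - x| ^+ n <= r ^+ n by rewrite lerXn2r ?nnegrE// ltW.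
  apply: le_trans (ler_wpM2l (exprn_ge0 n a0) h1) _.
  apply: le_trans (small_power n a0 r0 ar) _.
  apply: ler_piMl; first by rewrite exprn_ge0.
  by apply: exprn_ile1 => //; rewrite invf_le1// ler1n.
have [s sb sl] := geometric_limit (Cl0 l) tm.
have -> : iterated_derivative f l y = s by apply: (cvg_unique _ h sl).
by apply: le_trans sb _; rewrite /Cl !mulrA.
Qed.

Lemma analytic_derivative f l x : analytic_on S f -> S x ->
  derivative_within S (iterated_derivative f l) x (fun v => iterated_derivative f (v :: l) x).
Proof. by move=> h Sx; have [] := analytic_local Sx (h x Sx). Qed.

Lemma analytic_Cn f n l : analytic_on S f -> Cn_on n S (iterated_derivative f l).
Proof.
move=> h; elim: n l => [|n IH] l.
  by apply: (derivative_within_continuous fV) => x; exact: analytic_derivative.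
exists (fun x v => iterated_derivative f (v :: l) x); split => [x|v]; last exact: (IH (v :: l)).
exact: analytic_derivative.
Qed.

(** Otherwise there are points at which the constants n, n and 1/(n + 1) fail,
and the local bounds at a cluster point of these contradict this for large n. *)
Lemma compact_cauchy_bound f (Q : set V) : analytic_on S f -> compact Q -> Q `<=` S ->
  exists C a r, [/\ [&& 0 <= C, 0 <= a & 0 < r] & forall x, Q x -> cauchy_bound f x C a r].
Proof.
move=> h cQ QS; apply: contrapT => no.
have bad n : exists x, Q x /\ ~ cauchy_bound f x n%:R n%:R n.+1%:R^-1.
  apply: contrapT => H; apply: no; exists n%:R, n%:R, n.+1%:R^-1; split.
    by rewrite !ler0n invr_gt0 ltr0Sn.
  by move=> x Qx; apply: contrapT => nx; apply: H; exists x.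
pose u n := sval (cid (bad n)); have uP n := svalP (cid (bad n)).
have uQ n : Q (u n) by have [] := uP n.
have [c Qc Hc] := compact_cluster_seq cQ uQ.
have Sc := QS _ Qc.
have [_ _ [C [a [r [/and3P[C0 a0 r0] b]]]]] := analytic_local Sc (h c Sc).
have r20 : 0 < r / 2 by rewrite divr_gt0.
(* n exceeds C and a, and 1/(n + 1) is below r / 2 *)
have [n n0 nc] := Hc _ r20 (Num.truncn (C + a + (r / 2)^-1)).+1.
have ng : C + a + (r / 2)^-1 <= n%:R.
  apply: le_trans (ltW (truncnS_gt _)) _; by rewrite ler_nat.
have ri0 : 0 < (r / 2)^-1 by rewrite invr_gt0.
have [_] := uP n; apply=> y l Sy yu; apply: le_trans (b y l Sy _) _.
  have -> : y - c = (y - u n) + (u n - c) by rewrite addrA subrK.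
  apply: le_lt_trans (ler_normD _ _) _; rewrite [r]splitr; apply: ltrD nc.
  apply: lt_le_trans yu _; rewrite -[leRHS]invrK lef_pV2 ?posrE ?ltr0Sn//.
  by rewrite -natr1; lra.
apply: ler_wpM2r; first exact: norm_prod_ge0.
apply: ler_wpM2r => //; apply: ler_pM => //; first exact: exprn_ge0.
  by lra.
by apply: lerXn2r; rewrite ?nnegrE//; lra.
Qed.

End DerivativeFamily.

(** * Compositions and the substitution of power series *)

Lemma linear_sum_nat (R : realType) (V W : lmodType R) (f : V -> W) (F : nat -> V) M :
  linear f -> f (\sum_(0 <= i < M) F i) = \sum_(0 <= i < M) f (F i).
Proof.
move=> lf; elim: M => [|M IH]; first by rewrite !big_geq// (linear0' lf).
by rewrite !big_nat_recr//= (linearD' _ _ lf) IH.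
Qed.

Section CompositionSum.
Context {R : realType} {L E W : normedModType R}.
Implicit Types (w : seq L -> E) (Q : seq E -> W) (l : seq L).

(** The sum of Q [:: w l1; ...; w lm] over all ways to cut l into consecutive
nonempty blocks l1, ..., lm; the recursion runs over the first block and n is
fuel. Consecutive blocks suffice, because on lists of copies of one vector these
sums are the coefficients of the composite of two power series. *)
Fixpoint composition_sum n w Q l : W :=
  if l is [::] then Q [::] else
  if n is n'.+1 then
    \sum_(0 <= i < size l)
      composition_sum n' w (fun s => Q (w (take i.+1 l) :: s)) (drop i.+1 l)
  else 0.

Lemma composition_sum_nil n w Q : composition_sum n w Q [::] = Q [::].
Proof. by case: n. Qed.

Lemma composition_sumS n w Q l : (0 < size l)%N -> composition_sum n.+1 w Q l =
  \sum_(0 <= i < size l) composition_sum n w (fun s => Q (w (take i.+1 l) :: s)) (drop i.+1 l).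
Proof. by case: l. Qed.

Lemma composition_sum_fuel n m w Q l : (size l <= n)%N -> (size l <= m)%N ->
  composition_sum n w Q l = composition_sum m w Q l.
Proof.
elim: n m Q l => [|n IH] m Q l.
  by rewrite leqn0 => /nilP -> _; rewrite !composition_sum_nil.
case: m => [|m]; first by rewrite leqn0 => _ /nilP ->.
case: l => [|v l] // ln lm; rewrite !composition_sumS//; apply: eq_big_nat => i /andP[_ il].
by apply: IH; rewrite size_drop /= subSS; apply: leq_trans (leq_subr _ _) _; [exact: ln|exact: lm].
Qed.

Lemma composition_sum_ext n w w' Q l :
  (forall l', (0 < size l' <= size l)%N -> w l' = w' l') ->
  composition_sum n w Q l = composition_sum n w' Q l.
Proof.
elim: n Q l => [|n IH] Q l h //; case: l h => [|v l] // h.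
rewrite !composition_sumS//; apply: eq_big_nat => i /andP[_ il].
rewrite h ?size_takel//; apply: IH => l' /andP[l0 ll]; apply: h; rewrite l0.
by apply: leq_trans ll _; rewrite size_drop leq_subr.
Qed.

Lemma composition_sum_combination n w Q Q1 Q2 (a : R) l :
  (forall s, Q s = a *: Q1 s + Q2 s) ->
  composition_sum n w Q l = a *: composition_sum n w Q1 l + composition_sum n w Q2 l.
Proof.
elim: n Q Q1 Q2 l => [|n IH] Q Q1 Q2 l h; case: l => [|v l] //=; try exact: h.
  by rewrite scaler0 addr0.
rewrite scaler_sumr -big_split /=; apply: eq_bigr => i _.
by apply: IH => s; exact: h.
Qed.

Lemma composition_sum_linear n w Q l1 l2 : list_multilinear Q ->
  (forall k1 k2, (size k1 + size k2 <= size l1 + size l2)%N ->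
     linear (fun u => w (k1 ++ u :: k2))) ->
  linear (fun u => composition_sum n w Q (l1 ++ u :: l2)).
Proof.
elim: n Q l1 => [|n IH] Q l1 lQ lw a u v.
  have E0 x : composition_sum 0 w Q (l1 ++ x :: l2) = 0 by case: l1 {lw}.
  by rewrite !E0 scaler0 addr0.
have sz x : size (l1 ++ x :: l2) = (size l1 + size l2).+1 by rewrite size_cat /= addnS.
rewrite !composition_sumS ?sz// scaler_sumr -big_split /=; apply: eq_big_nat => i /andP[_ il].
have [il1|il1] := leqP i.+1 (size l1).
  have tk x : take i.+1 (l1 ++ x :: l2) = take i.+1 l1 by rewrite takel_cat.
  have dr x : drop i.+1 (l1 ++ x :: l2) = drop i.+1 l1 ++ x :: l2.
    rewrite drop_cat; case: ifPn => //; rewrite -leqNgt => h.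
    have e : i.+1 = size l1 by apply/eqP; rewrite eqn_leq il1 h.
    by rewrite e subnn drop0 drop_size.
  rewrite !tk !dr; apply: IH; first exact: list_multilinear_cons.
  move=> k1 k2 h; apply: lw; apply: leq_trans h _; rewrite leq_add2r size_drop; exact: leq_subr.
have i1 : (size l1 <= i)%N by [].
have tk x : take i.+1 (l1 ++ x :: l2) = l1 ++ x :: take (i - size l1) l2.
  by rewrite take_cat ltnNge leqW//= subSn.
have dr x : drop i.+1 (l1 ++ x :: l2) = drop (i - size l1) l2.
  by rewrite drop_cat ltnNge leqW//= subSn.
rewrite !tk !dr; apply: composition_sum_combination => s; rewrite lw; first exact: (lQ [::]).
by rewrite leq_add2l size_take; case: ltnP => // /ltnW.
Qed.

(** The sequence 1/n^2 is stable under convolution up to a constant factor, and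
so a bound with these weights passes through a recursion with products. *)
Definition convolution_weight (n : nat) : R := (n%:R ^+ 2)^-1.
Local Notation theta := convolution_weight.

Lemma theta_ge0 n : 0 <= theta n.
Proof. by rewrite invr_ge0 sqr_ge0. Qed.

Lemma theta_le1 n : (0 < n)%N -> theta n <= 1.
Proof.
move=> n0; have n1 : 1 <= n%:R :> R by rewrite ler1n.
by rewrite invf_le1 ?exprn_gt0 ?ltr0n// exprn_ege1.
Qed.

Lemma theta_sum n : \sum_(0 <= i < n) theta i.+1 <= 2.
Proof.
suff : (\sum_(0 <= i < n) theta i.+1 <= 2 - n.+1%:R^-1 \/ n = 0%N).
  by case=> [h|->]; [apply: le_trans h _; rewrite gerBl invr_ge0|rewrite big_geq].
case: n => [|n]; [by right|left].
suff : \sum_(0 <= i < n.+1) theta i.+1 <= 2 - n.+1%:R^-1.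
  move=> h; apply: le_trans h _; rewrite lerD2l lerN2 lef_pV2 ?posrE ?ltr0n//.
  by rewrite ler_nat.
elim: n => [|n IH]; first by rewrite big_nat1 /theta expr1n invr1; lra.
rewrite big_nat_recr//=; apply: le_trans (lerD IH (lexx _)) _.
suff : theta n.+2 <= n.+1%:R^-1 - n.+2%:R^-1.
  by move: (theta _) (n.+1%:R^-1) (n.+2%:R^-1) => x y z; lra.
have p1 : 0 < n.+1%:R :> R by rewrite ltr0n.
have p2 : n.+2%:R = n.+1%:R + 1 :> R by rewrite natr1.
rewrite /theta p2; move: (n.+1%:R) p1 => x x0.
have -> : x^-1 - (x + 1)^-1 = (x * (x + 1))^-1 by field; rewrite !gt_eqF// ltr_wpDr.
rewrite lef_pV2 ?posrE ?mulr_gt0 ?exprn_gt0 ?addr_gt0//; nra.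
Qed.

(** Equivalent to (i + j)^2 <= 2 (i^2 + j^2). *)
Lemma theta_mul i j : (0 < i)%N -> (0 < j)%N ->
  theta i * theta j <= 2 * theta (i + j) * (theta i + theta j).
Proof.
move=> i0 j0; rewrite /theta natrD.
have : 0 < i%:R :> R by rewrite ltr0n.
have : 0 < j%:R :> R by rewrite ltr0n.
move: (i%:R) (j%:R) => x y y0 x0.
have -> : 2 * ((x + y) ^+ 2)^-1 * ((x ^+ 2)^-1 + (y ^+ 2)^-1) =
   (x ^+ 2)^-1 * (y ^+ 2)^-1 * (2 * (x ^+ 2 + y ^+ 2) / (x + y) ^+ 2).
  by field; rewrite !gt_eqF// addr_gt0.
apply: ler_peMr; first by rewrite mulr_ge0// invr_ge0 sqr_ge0.
by rewrite ler_pdivlMr ?exprn_gt0 ?addr_gt0// mul1r; have := sqr_ge0 (x - y); nra.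
Qed.

Lemma theta_convolution n :
  \sum_(0 <= i < n) theta i.+1 * theta (n - i) <= 8 * theta n.+1.
Proof.
have -> : 8 * theta n.+1 = 2 * theta n.+1 * (2 + 2) by ring.
apply: (@le_trans _ _ (\sum_(0 <= i < n) 2 * theta n.+1 * (theta i.+1 + theta (n - i)))).
  rewrite big_nat_cond [leRHS]big_nat_cond; apply: ler_sum => i; rewrite andbT => /andP[_ ik].
  have := @theta_mul i.+1 (n - i) isT; rewrite subn_gt0 ik addSn subnKC ?(ltnW ik)//; exact.
rewrite -mulr_sumr; apply: ler_wpM2l; first by rewrite mulr_ge0// theta_ge0.
rewrite big_split /=; apply: lerD; first exact: theta_sum.
rewrite big_nat_rev /= add0n.
rewrite (_ : \sum_(_ <= _ < _) _ = \sum_(0 <= i < n) theta i.+1); first exact: theta_sum.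
by apply: eq_big_nat => i /andP[_ ik]; rewrite subKn.
Qed.

(** Induction on the list after the first block. The case of a single block gives
one half of the bound, and the convolution of the weights costs at most as much
again because A K is small. *)
Lemma composition_sum_bound n w Q (c A K b : R) l : 0 <= c -> 0 <= A -> 0 <= K -> 0 <= b ->
  16 * (A * K) <= 1 -> (0 < size l <= n)%N ->
  (forall s, `|Q s| <= c * A ^+ size s * norm_prod s) ->
  (forall l', (0 < size l' <= size l)%N ->
     `|w l'| <= K * b ^+ size l' * theta (size l') * norm_prod l') ->
  `|composition_sum n w Q l| <=
     2 * c * (A * K) * theta (size l) * b ^+ size l * norm_prod l.
Proof.
move=> c0 A0 K0 b0 AK; elim: n Q l c c0 => [|n IH] Q l c c0 /andP[l0 ln] bQ bw.
  by move: (leq_trans l0 ln).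
rewrite composition_sumS//; apply: le_trans (ler_norm_sum _ _ _) _.
case: l l0 ln bw => [//|v l0]; set l := v :: l0 => _ ln bw.
have sl : size l = (size l0).+1 by [].
pose m := size l0; pose B := norm_prod l.
have B0 : 0 <= B by exact: norm_prod_ge0.
have split_l i : norm_prod (take i.+1 l) * norm_prod (drop i.+1 l) = B.
  by rewrite -norm_prod_cat cat_take_drop.
have AK0 : 0 <= A * K by rewrite mulr_ge0.
have bQ' i : (i < size l)%N -> forall s, `|Q (w (take i.+1 l) :: s)| <=
   (c * (A * K) * b ^+ i.+1 * theta i.+1 * norm_prod (take i.+1 l)) * A ^+ size s * norm_prod s.
  move=> il s; apply: le_trans (bQ _) _; rewrite norm_prod_cons /= exprS.
  have := bw (take i.+1 l); rewrite size_takel// => /(_ il) h.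
  have -> : c * (A * K) * b ^+ i.+1 * theta i.+1 * norm_prod (take i.+1 l) * A ^+ size s * norm_prod s
    = (c * (A * A ^+ size s)) * ((K * b ^+ i.+1 * theta i.+1 * norm_prod (take i.+1 l)) * norm_prod s).
    by ring.
  apply: ler_wpM2l; first by rewrite !mulr_ge0// exprn_ge0.
  by apply: ler_wpM2r => //; exact: norm_prod_ge0.
have cge i : 0 <= c * (A * K) * b ^+ i.+1 * theta i.+1 * norm_prod (take i.+1 l).
  by rewrite !mulr_ge0 ?exprn_ge0 ?theta_ge0 ?norm_prod_ge0.
rewrite sl big_nat_recr//=.
have last : `|composition_sum n w (fun s => Q (w (take m.+1 l) :: s)) (drop m l0)| <=
    c * (A * K) * b ^+ m.+1 * theta m.+1 * B.
  rewrite drop_size composition_sum_nil; apply: le_trans (bQ' m _ [::]) _ => //.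
  by rewrite expr0 norm_prod_nil !mulr1 take_oversize.
have other i : (i < m)%N -> `|composition_sum n w (fun s => Q (w (take i.+1 l) :: s)) (drop i l0)| <=
   (2 * c * (A * K) * (A * K) * b ^+ m.+1 * B) * (theta i.+1 * theta (m - i)).
  move=> im; have il : (i < size l)%N by rewrite sl ltnS ltnW.
  have sd : size (drop i l0) = (m - i)%N by rewrite size_drop.
  apply: le_trans (IH _ (drop i l0) _ (cge i) _ (bQ' i il) _) _.
  - by rewrite sd subn_gt0 im; apply: leq_trans (leq_subr _ _) _.
  - move=> l' /andP[l'0 l's]; apply: bw; rewrite l'0; apply: leq_trans l's _.
    by rewrite sd sl; apply: leq_trans (leq_subr _ _) _.
  rewrite sd -(split_l i) [drop i.+1 l]/=.
  have -> : b ^+ m.+1 = b ^+ i.+1 * b ^+ (m - i) by rewrite -exprD addSn subnKC// ltnW.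
  by rewrite le_eqVlt; apply/orP; left; apply/eqP; ring.
apply: (@le_trans _ _ (\sum_(0 <= i < m)
  (2 * c * (A * K) * (A * K) * b ^+ m.+1 * B) * (theta i.+1 * theta (m - i)) +
   c * (A * K) * b ^+ m.+1 * theta m.+1 * B)).
  apply: lerD => //; rewrite big_nat_cond [leRHS]big_nat_cond; apply: ler_sum => i.
  by rewrite andbT => /andP[_ im]; exact: other.
rewrite -mulr_sumr -/m -/B.
have X0 : 0 <= c * (A * K) * b ^+ m.+1 * B by rewrite !mulr_ge0// exprn_ge0.
have cv := theta_convolution m; set S := \sum_(_ <= _ < _) _ in cv *.
have h1 : 2 * (A * K) * S <= theta m.+1.
  apply: le_trans (ler_wpM2l _ cv) _; first by rewrite mulr_ge0.
  by rewrite [leLHS]mulrA; apply: ler_piMl; [exact: theta_ge0 | lra].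
have -> : 2 * c * (A * K) * (A * K) * b ^+ m.+1 * B * S + c * (A * K) * b ^+ m.+1 * theta m.+1 * B =
  (c * (A * K) * b ^+ m.+1 * B) * (2 * (A * K) * S + theta m.+1) by ring.
have -> : 2 * c * (A * K) * theta m.+1 * b ^+ m.+1 * B =
  (c * (A * K) * b ^+ m.+1 * B) * (2 * theta m.+1) by ring.
by apply: ler_wpM2l => //; lra.
Qed.

Section Truncation.
Context (w : seq L -> E) (eta : L).
Local Notation Wn i := (w (nseq i.+1 eta)).

Definition composition_partial j Q : W :=
  \sum_(0 <= n < j.+1) composition_sum n w Q (nseq n eta).

(** Cutting off the first block lowers the admissible total degree by its length. *)
Lemma composition_partial_rec j Q : composition_partial j Q =
  Q [::] + \sum_(0 <= i < j) composition_partial (j - i.+1) (fun s => Q (Wn i :: s)).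
Proof.
elim: j => [|j IH]; first by rewrite /composition_partial big_nat1 big_geq//= addr0.
rewrite {1}/composition_partial big_nat_recr//= -/(composition_partial j Q) IH -addrA.
congr (_ + _); rewrite size_nseq !big_nat_recr//= addrA; congr (_ + _); last first.
  rewrite subnn /composition_partial big_nat1 composition_sum_nil.
  have -> : drop j (nseq j eta) = [::] by rewrite -{1}(size_nseq j eta) drop_size.
  have -> : take j (nseq j eta) = nseq j eta by rewrite -{1}(size_nseq j eta) take_size.
  by rewrite composition_sum_nil.
rewrite -big_split /=; apply: eq_big_nat => i /andP[_ ij].
rewrite subSS -(subnSK ij) /composition_partial [RHS]big_nat_recr//; congr (_ + _).
have -> : take i (nseq j eta) = nseq i eta by rewrite take_nseq// ltnW.
rewrite drop_nseq (subnSK ij); apply: composition_sum_fuel; rewrite size_nseq//.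
exact: leq_subr.
Qed.

(** Expanding Q [:: X; ...; X] yields the compositions of total degree at most j
and further terms. Each of those has total degree above j, which makes it smaller
than 2 ^ -j times a geometric factor. *)
Lemma truncation_error (M : nat) (kap A : R) : 0 <= A -> 0 <= kap -> A * kap <= 2^-1 ->
  (forall i, `|Wn i| <= kap * 4^-1 ^+ i.+1) ->
  forall (n j : nat) Q (c : R), 0 <= c -> list_multilinear Q ->
  (forall s, `|Q s| <= c * A ^+ size s * norm_prod s) -> (j <= n)%N -> (j <= M)%N ->
  `|\sum_(0 <= m < n.+1) Q (nseq m (\sum_(0 <= i < M) Wn i)) - composition_partial j Q|
     <= 2 * c * 2^-1 ^+ j.
Proof.
move=> A0 kap0 Ak bW; set X := \sum_(0 <= i < M) Wn i.
have hs k : \sum_(0 <= i < k) (2^-1 ^+ i.+1 : R) <= 1.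
  rewrite (eq_bigr (fun i => 2^-1 * 2^-1 ^+ i)) => [|i _]; last by rewrite exprS.
  by rewrite -mulr_sumr; have := @half_sum R k; lra.
have q4 i : 4^-1 ^+ i.+1 <= 2^-1 ^+ i.+1 :> R by apply: lerXn2r; rewrite ?nnegrE//; lra.
have bX : A * `|X| <= 2^-1.
  apply: le_trans Ak; apply: ler_wpM2l => //; apply: le_trans (ler_norm_sum _ _ _) _.
  apply: (@le_trans _ _ (\sum_(0 <= i < M) kap * 2^-1 ^+ i.+1)).
    by apply: ler_sum => i _; apply: le_trans (bW i) _; apply: ler_wpM2l.
  by rewrite -mulr_sumr; apply: ler_piMr.
have bQ' Q (c : R) i : 0 <= c -> (forall s, `|Q s| <= c * A ^+ size s * norm_prod s) ->
    forall s, `|Q (Wn i :: s)| <= (c * (A * kap) * 4^-1 ^+ i.+1) * A ^+ size s * norm_prod s.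
  move=> c0 bQ s; apply: le_trans (bQ _) _; rewrite norm_prod_cons /= exprS.
  have -> : c * (A * kap) * 4^-1 ^+ i.+1 * A ^+ size s * norm_prod s
    = (c * (A * A ^+ size s)) * ((kap * 4^-1 ^+ i.+1) * norm_prod s) by ring.
  apply: ler_wpM2l; first by rewrite !mulr_ge0// exprn_ge0.
  by apply: ler_wpM2r; [exact: norm_prod_ge0 | exact: bW].
have c'0 (c : R) i : 0 <= c -> 0 <= c * (A * kap) * 4^-1 ^+ i.+1.
  by move=> c0; rewrite !mulr_ge0// exprn_ge0.
have total Q (c : R) k : 0 <= c -> (forall s, `|Q s| <= c * A ^+ size s * norm_prod s) ->
    `|\sum_(0 <= m < k) Q (nseq m X)| <= 2 * c.
  move=> c0 bQ; apply: le_trans (ler_norm_sum _ _ _) _.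
  apply: (@le_trans _ _ (\sum_(0 <= i < k) c * 2^-1 ^+ i)).
    apply: ler_sum => i _; apply: le_trans (bQ _) _.
    rewrite size_nseq norm_prod_nseq -mulrA -exprMn; apply: ler_wpM2l => //.
    by apply: lerXn2r; rewrite ?nnegrE ?mulr_ge0.
  by rewrite -mulr_sumr mulrC; apply: ler_wpM2r => //; exact: half_sum.
elim=> [|n IH] j Q c c0 lQ bQ jn jM.
  move: jn; rewrite leqn0 => /eqP ->; rewrite /composition_partial !big_nat1 subrr normr0.
  by rewrite mulr_ge0 ?mulr_ge0 ?exprn_ge0.
rewrite composition_partial_rec big_nat_recl//= opprD addrACA subrr add0r.
have -> : \sum_(0 <= m < n.+1) Q (X :: nseq m X) =
    \sum_(0 <= i < M) \sum_(0 <= m < n.+1) Q (Wn i :: nseq m X).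
  rewrite exchange_big_nat /=; apply: eq_bigr => m _.
  have lin := lQ [::] (nseq m X).
  exact: (linear_sum_nat _ _ lin).
rewrite (big_cat_nat _ jM)//= addrAC -sumrB.
apply: le_trans (ler_normD _ _) _.
have ck0 : 0 <= 2 * c * (A * kap) by rewrite !mulr_ge0.
have h1 : `|\sum_(0 <= i < j) (\sum_(0 <= m < n.+1) Q (Wn i :: nseq m X) -
      composition_partial (j - i.+1) (fun s => Q (Wn i :: s)))|
    <= \sum_(0 <= i < j) 2 * c * (A * kap) * 2^-1 ^+ j * 2^-1 ^+ i.+1.
  apply: le_trans (ler_norm_sum _ _ _) _; rewrite big_nat_cond [leRHS]big_nat_cond.
  apply: ler_sum => i; rewrite andbT => /andP[_ ij].
  apply: le_trans (IH (j - i.+1)%N _ _ (c'0 c i c0) (list_multilinear_cons _ lQ) (bQ' _ _ _ c0 bQ) _ _) _.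
  - by rewrite leq_subLR addSn -addnS; apply: leq_trans jn _; rewrite leq_addl.
  - by apply: leq_trans (leq_subr _ _) jM.
  - have -> : 2^-1 ^+ j = 2^-1 ^+ i.+1 * 2^-1 ^+ (j - i.+1) :> R by rewrite -exprD subnKC.
    have -> : 4^-1 ^+ i.+1 = 2^-1 ^+ i.+1 * 2^-1 ^+ i.+1 :> R.
      by rewrite -exprMn; congr (_ ^+ _); field.
    by rewrite le_eqVlt; apply/orP; left; apply/eqP; ring.
have h2 : `|\sum_(j <= i < M) \sum_(0 <= m < n.+1) Q (Wn i :: nseq m X)|
    <= \sum_(j <= i < M) 2 * c * (A * kap) * 2^-1 ^+ j * 2^-1 ^+ i.+1.
  apply: le_trans (ler_norm_sum _ _ _) _; rewrite big_nat_cond [leRHS]big_nat_cond.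
  apply: ler_sum => i; rewrite andbT => /andP[ji _].
  apply: le_trans (total _ _ _ (c'0 c i c0) (bQ' _ _ _ c0 bQ)) _.
  have -> : 4^-1 ^+ i.+1 = 2^-1 ^+ i.+1 * 2^-1 ^+ i.+1 :> R.
    by rewrite -exprMn; congr (_ ^+ _); field.
  have -> : 2 * (c * (A * kap) * (2^-1 ^+ i.+1 * 2^-1 ^+ i.+1)) =
    (2 * c * (A * kap) * 2^-1 ^+ i.+1) * 2^-1 ^+ i.+1 by ring.
  apply: ler_wpM2r; first exact: exprn_ge0.
  apply: ler_wpM2l => //; apply: ler_wiXn2l => //; last exact: leqW.
  by rewrite invf_le1// ler1n.
apply: le_trans (lerD h1 h2) _; rewrite -big_cat_nat//= -mulr_sumr.
have j0 : 0 <= 2^-1 ^+ j :> R by rewrite exprn_ge0.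
have h := ler_wpM2l (mulr_ge0 ck0 j0) (hs M); apply: le_trans h _; rewrite mulr1; apply: ler_wpM2r; first exact: exprn_ge0.
by apply: ler_piMr; [rewrite mulr_ge0 | lra].
Qed.

End Truncation.

End CompositionSum.

(** * Power series solutions along an orbit *)

Lemma continuous_bounded_sum (R : realType) (W : normedModType R) (F : R -> nat -> W) n :
  (forall i, (i < n)%N -> continuous (F^~ i) /\ exists K : R, forall t, `|F t i| <= K) ->
  continuous (fun t => \sum_(0 <= i < n) F t i) /\
  exists K : R, forall t, `|\sum_(0 <= i < n) F t i| <= K.
Proof.
elim: n => [|k IH] H.
  split; last by exists 0 => t; rewrite big_geq// normr0.
  rewrite (_ : (fun t => _) = fun=> 0); first by move=> t; exact: cvg_cst.
  by apply/funext => t; rewrite big_geq.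
have [|c1 [K1 b1]] := IH; first by move=> i ik; apply: H; exact: ltnW.
have [c2 [K2 b2]] := H k (ltnSn k).
split; last first.
  exists (K1 + K2) => t; rewrite big_nat_recr//=.
  by apply: le_trans (ler_normD _ _) _; apply: lerD.
rewrite (_ : (fun t => _) = fun t => \sum_(0 <= i < k) F t i + F t k); last first.
  by apply/funext => t; rewrite big_nat_recr.
by move=> t; apply: cvgD; [exact: c1|exact: c2].
Qed.

Section BoundedForms.
Context {R : realType} {E W : normedModType R} (A : R) (A0 : 0 <= A).

Definition bounded_forms (Q : R -> seq E -> W) : Prop :=
  [/\ forall t, list_multilinear (Q t),
      exists2 c : R, 0 <= c & forall t s, `|Q t s| <= c * A ^+ size s * norm_prod s &
      forall s, continuous (Q^~ s)].

(** Multilinearity reduces the continuity of a form with moving arguments to the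
continuity of its values at fixed arguments. *)
Lemma bounded_forms_cons Q (x : R -> E) (K : R) : bounded_forms Q ->
  continuous x -> (forall t, `|x t| <= K) -> bounded_forms (fun t s => Q t (x t :: s)).
Proof.
move=> [lQ [c c0 bQ] cQ] cx bx; split.
- by move=> t; exact: list_multilinear_cons.
- have K0 : 0 <= K by apply: le_trans (bx 0).
  exists (c * A * K); first by rewrite !mulr_ge0.
  move=> t s; apply: le_trans (bQ _ _) _; rewrite norm_prod_cons /= exprS.
  have -> : c * A * K * A ^+ size s * norm_prod s = (c * (A * A ^+ size s)) * (K * norm_prod s).
    by ring.
  apply: ler_wpM2l; first by rewrite !mulr_ge0// exprn_ge0.
  by apply: ler_wpM2r => //; exact: norm_prod_ge0.
move=> s t0; apply/cvgrPdist_le => e e0; have e20 : 0 < e / 2 by rewrite divr_gt0.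
pose k := c * A ^+ (size s).+1 * norm_prod s.
have k0 : 0 < k + 1 by rewrite ltr_wpDl// !mulr_ge0 ?exprn_ge0 ?norm_prod_ge0.
have /cvgrPdist_le/(_ _ e20) h1 := cQ (x t0 :: s) t0.
have /cvgrPdist_le/(_ _ (divr_gt0 e20 k0)) h2 := cx t0.
near=> t.
have -> : Q t0 (x t0 :: s) - Q t (x t :: s) =
   (Q t0 (x t0 :: s) - Q t (x t0 :: s)) + Q t ((x t0 - x t) :: s).
  by rewrite (linearB' _ _ (lQ t [::] s)) /= addrA subrK.
apply: le_trans (ler_normD _ _) _; rewrite [e]splitr; apply: lerD; first by near: t.
apply: le_trans (bQ _ _) _; rewrite norm_prod_cons /=.
have : `|x t0 - x t| <= e / 2 / (k + 1) by near: t.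
rewrite ler_pdivlMr// => h; apply: le_trans h.
have -> : c * A ^+ (size s).+1 * (`|x t0 - x t| * norm_prod s) = `|x t0 - x t| * k.
  by rewrite /k; ring.
by apply: ler_wpM2l => //; rewrite lerDl.
Unshelve. all: by end_near. Qed.

Context {L : normedModType R}.

Lemma bounded_forms_composition n (w : R -> seq L -> E) Q l : bounded_forms Q ->
  (forall l', (0 < size l' <= size l)%N -> continuous (w^~ l') /\ exists K : R, forall t, `|w t l'| <= K) ->
  continuous (fun t => composition_sum n (w t) (Q t) l) /\
  exists K : R, forall t, `|composition_sum n (w t) (Q t) l| <= K.
Proof.
elim: n Q l => [|n IH] Q l bQ hw.
  case: l hw => [|v l] hw /=.
    have [_ [c c0 h] cQ] := bQ; split; first exact: cQ.
    by exists (c * A ^+ 0 * norm_prod (Nil E)) => t; exact: h.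
  by split; [move=> t; exact: cvg_cst|exists 0 => t; rewrite normr0].
case: l hw => [|v l] hw; first by have [//|] := IH Q [::] bQ _; case: n {IH}.
pose F t i := composition_sum n (w t) (fun s => Q t (w t (take i.+1 (v :: l)) :: s)) (drop i.+1 (v :: l)).
have H i : (i < size (v :: l))%N -> continuous (fun t => F t i) /\ exists K : R, forall t, `|F t i| <= K.
  move=> il; have [|cw [K bw]] := hw (take i.+1 (v :: l)).
    by rewrite size_takel.
  apply: (IH (fun t s => Q t (w t (take i.+1 (v :: l)) :: s))).
    exact: (bounded_forms_cons bQ cw bw).
  move=> l' /andP[l'0 l's]; apply: hw; rewrite l'0; apply: leq_trans l's _.
  by rewrite size_drop; exact: leq_subr.
have E0 t : composition_sum n.+1 (w t) (Q t) (v :: l) = \sum_(0 <= i < size (v :: l)) F t i.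
  exact: composition_sumS.
rewrite (_ : (fun t => composition_sum n.+1 (w t) (Q t) (v :: l)) =
   fun t => \sum_(0 <= i < size (v :: l)) F t i); last by apply/funext => t; exact: E0.
have [cs [K bs]] := continuous_bounded_sum H.
by split => //; exists K => t; rewrite E0; exact: bs.
Qed.

End BoundedForms.

Section Coefficients.
Context {R : realType} {m N : nat} (C : 'M[R]_(m, N)) (a c : R).
Context (a0 : 0 < a) (c0 : 0 < c)
  (CL : forall x : 'cV[R]_N, c * `|x| ^+ 2 <= lform C x x).
Context {L : normedModType R}.
Local Notation W := 'cV[R]_N.
Local Notation E := ('cV[R]_N * L)%type.
Context (P : R -> seq E -> W) (A C0 : R) (A0 : 0 <= A) (C00 : 0 <= C0)
  (lP : forall t, list_multilinear (P t))
  (bP : forall t s, `|P t s| <= C0 * A ^+ size s * norm_prod s)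
  (cP : forall s, continuous (P^~ s))
  (dP : forall t z, lform C z (P t [:: (z, 0)]) <= - a * lform C z z).

Let PP : bounded_forms A P.
Proof. by split => //; exists C0. Qed.

Definition linear_part t (z : W) : W := P t [:: (z, 0)].

Lemma linear_part_linear t : linear (linear_part t).
Proof.
move=> b u v; rewrite /linear_part -(lP t [::] [::]) /=; congr (P t [:: _]).
by apply: injective_projections; rewrite /= ?scaler0 ?addr0.
Qed.

Lemma linear_part_bound t z : `|linear_part t z| <= C0 * A * `|z|.
Proof.
apply: le_trans (bP _ _) _; rewrite expr1 norm_prod_cons norm_prod_nil mulr1.
apply: ler_wpM2l; first by rewrite mulr_ge0.
by rewrite prod_normE /= normr0 ge_max lexx normr_ge0.
Qed.

(** The solutions of the linearized equation along the orbit, with forcing F. *)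
Definition bounded_response_to (F x : R -> W) : Prop :=
  (exists K : R, forall t, `|x t| <= K) /\
  forall t : R, is_derive t 1 x (linear_part t (x t) + F t).

Lemma bounded_response_exists (F : R -> W) : continuous F ->
  (exists M : R, forall t, `|F t| <= M) -> exists x, bounded_response_to F x.
Proof.
move=> cF [M bF].
pose Ft t u := linear_part t u + F t.
have FL t (u v : W) : `|Ft t u - Ft t v| <= C0 * A * `|u - v|.
  rewrite /Ft opprD addrACA subrr addr0 -(linearB' _ _ (linear_part_linear t)).
  exact: linear_part_bound.
have F0 t : `|Ft t 0| <= M by rewrite /Ft (linear0' (linear_part_linear t)) add0r.
have Fc u : continuous (Ft^~ u).
  by move=> t; apply: cvgD; [exact: cP | exact: cF].
have FD t (u v : W) : lform C (u - v) (Ft t u - Ft t v) <= - a * lform C (u - v) (u - v).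
  by rewrite /Ft opprD addrACA subrr addr0 -(linearB' _ _ (linear_part_linear t)); exact: dP.
have [x [K [Dx bx]]] := bounded_solution a0 c0 CL FL F0 Fc FD.
by exists x; split; [exists K|].
Qed.

Lemma bounded_response_to_unique (F x y : R -> W) :
  bounded_response_to F x -> bounded_response_to F y -> x = y.
Proof.
move=> [[K1 bx] Dx] [[K2 by'] Dy].
apply: (@bounded_solution_unique _ _ _ C a c a0 c0 CL x y _ _ (Num.max K1 K2) _ _ Dx Dy).
- by move=> t; rewrite le_max bx.
- by move=> t; rewrite le_max by' orbT.
- move=> t; rewrite opprD addrACA subrr addr0 -(linearB' _ _ (linear_part_linear t)); exact: dP.
Qed.

Definition response (F : R -> W) : R -> W := xget (fun=> 0) (bounded_response_to F).

Lemma responseP F : continuous F -> (exists M : R, forall t, `|F t| <= M) ->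
  bounded_response_to F (response F).
Proof.
move=> cF bF; have [x hx] := bounded_response_exists cF bF.
by rewrite /response; case: xgetP => [y _ //|/(_ x)].
Qed.

Lemma bounded_response_combination (b : R) (F G x y : R -> W) :
  bounded_response_to F x -> bounded_response_to G y ->
  bounded_response_to (fun t => b *: F t + G t) (fun t => b *: x t + y t).
Proof.
move=> [[K1 bx] Dx] [[K2 by'] Dy]; split.
  exists (`|b| * K1 + K2) => t; apply: le_trans (ler_normD _ _) _; apply: lerD => //.
  by rewrite normrZ ler_wpM2l.
move=> t; have ? := Dx t; have ? := Dy t; apply: is_derive_eq.
by rewrite linear_part_linear scalerDr addrACA.
Qed.


(** Increments of the state and of the parameters: the latter do not change along
the flow and are linear in the arguments. *)
Definition block (u : seq L -> R -> W) (t : R) (l : seq L) : E :=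
  (u l t, if l is [:: v] then v else 0).

(** The composition of l into a single block is split: its state component is
the unknown of the equation, and its other component, which is present for lists
of length 1 only, is part of the forcing. *)
Definition forcing (w : seq L -> E) (Q : seq E -> W) l : W :=
  (if l is [:: v] then Q [:: (0, v)] else 0) +
  \sum_(0 <= i < (size l).-1)
     composition_sum (size l).-1 w (fun s => Q (w (take i.+1 l) :: s)) (drop i.+1 l).

(** The forcing at l only involves the coefficients at shorter lists; n is fuel. *)
Fixpoint coefficient_rec n (l : seq L) : R -> W :=
  if n is n'.+1 then
    if (size l <= n')%N then coefficient_rec n' l
    else response (fun t => forcing (block (coefficient_rec n') t) (P t) l)
  else fun=> 0.

Definition coefficient l := coefficient_rec (size l) l.
Local Notation u := coefficient.

Lemma coefficient_recE n l : (size l <= n)%N -> coefficient_rec n l = u l.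
Proof.
rewrite /coefficient; elim: n => [|n IH]; first by rewrite leqn0 => /eqP ->.
rewrite leq_eqVlt => /predU1P[->//|]; rewrite ltnS => h.
by rewrite /= h; exact: IH.
Qed.

Lemma forcing_ext w w' Q l :
  (forall l', (0 < size l' < size l)%N -> w l' = w' l') -> forcing w Q l = forcing w' Q l.
Proof.
move=> h; congr (_ + _); apply: eq_big_nat => i /andP[_ il].
have l0 : (0 < size l)%N by case: (size l) il.
have il' : (i.+1 < size l)%N by rewrite -[size l]prednK.
rewrite h ?size_takel ?(ltnW il')//.
apply: composition_sum_ext => l' /andP[l'0 l's]; apply: h; rewrite l'0.
apply: leq_ltn_trans l's _; rewrite size_drop -{2}[size l]subn0 ltn_sub2l//.
Qed.

Lemma coefficientE l : (0 < size l)%N ->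
  u l = response (fun t => forcing (block u t) (P t) l).
Proof.
move=> l0; rewrite /u -(prednK l0) /= leqNgt prednK// leqnn /=.
congr response; apply/funext => t; apply: forcing_ext => l' /andP[l'0 l's].
by rewrite /block coefficient_recE// -ltnS prednK.
Qed.

Lemma forcing_regular l (w : R -> seq L -> E) :
  (forall l', (0 < size l' < size l)%N -> continuous (w^~ l') /\ exists K : R, forall t, `|w t l'| <= K) ->
  continuous (fun t => forcing (w t) (P t) l) /\
  exists M : R, forall t, `|forcing (w t) (P t) l| <= M.
Proof.
move=> hw.
pose F1 t := if l is [:: v] then P t [:: (0, v)] else 0.
pose F t i := composition_sum (size l).-1 (w t) (fun s => P t (w t (take i.+1 l) :: s)) (drop i.+1 l).
have H1 : continuous F1 /\ exists M : R, forall t, `|F1 t| <= M.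
  rewrite /F1; case: l {hw F1 F} => [|v [|v' l]].
  - by split; [move=> t; exact: cvg_cst|exists 0 => t; rewrite normr0].
  - by split; [exact: cP|exists (C0 * A ^+ 1 * norm_prod [:: (0, v) : E]) => t; exact: bP].
  - by split; [move=> t; exact: cvg_cst|exists 0 => t; rewrite normr0].
have H i : (i < (size l).-1)%N -> continuous (fun t => F t i) /\ exists K : R, forall t, `|F t i| <= K.
  move=> il.
  have l0 : (0 < size l)%N by case: (size l) il.
  have il' : (i.+1 < size l)%N by rewrite -[size l]prednK.
  have [|cw [K bw]] := hw (take i.+1 l); first by rewrite size_takel// ltnW.
  apply: (@bounded_forms_composition _ _ _ A A0 _ _ w (fun t s => P t (w t (take i.+1 l) :: s))).
    exact: (bounded_forms_cons A0 PP cw bw).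
  move=> l' /andP[l'0 l's]; apply: hw; rewrite l'0; apply: leq_ltn_trans l's _.
  by rewrite size_drop -{2}[size l]subn0 ltn_sub2l.
have [cs [Ks bs]] := continuous_bounded_sum H.
have [c1 [K1 b1]] := H1; split; first by move=> t; apply: cvgD; [exact: c1|exact: cs].
by exists (K1 + Ks) => t; apply: le_trans (ler_normD _ _) _; apply: lerD; [exact: b1|exact: bs].
Qed.

Lemma block_regular l : continuous (u l) -> (exists K : R, forall t, `|u l t| <= K) ->
  continuous (fun t => block u t l) /\ exists K : R, forall t, `|block u t l| <= K.
Proof.
move=> cu [K bu]; split.
  move=> t; exact: (cvg_pair (cu t) (cvg_cst (if l is [:: v] then v else 0))).
exists (Num.max K `|if l is [:: v] then v else 0|) => t.
by rewrite prod_normE /= ge_max !le_max bu lexx orbT.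
Qed.

Lemma coefficient_response l : (0 < size l)%N ->
  bounded_response_to (fun t => forcing (block u t) (P t) l) (u l).
Proof.
have [n ln] := ubnP (size l); elim: n => // n IH in l ln *; move=> l0.
rewrite coefficientE//.
have [|cF bF] := @forcing_regular l (block u); last exact: responseP.
move=> l' /andP[l'0 l's]; have [bu Du] := IH l' (leq_trans l's ln) l'0.
apply: block_regular bu => t; have ? := Du t; exact: is_derive_continuous.
Qed.

(** Together these equations say that the coefficients form a formal power series
solution. *)
Lemma coefficient_derive l (t : R) : (0 < size l)%N ->
  is_derive t 1 (u l) (composition_sum (size l) (block u t) (P t) l).
Proof.
move=> l0; have [_ Du] := coefficient_response l0.
suff <- : linear_part t (u l t) + forcing (block u t) (P t) l =
  composition_sum (size l) (block u t) (P t) l by exact: Du.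
case: l l0 {Du} => [//|v l] _; rewrite (@composition_sumS _ _ _ _ (size l))// [in RHS](_ : size (v :: l) = (size l).+1)//.
rewrite [in RHS]big_nat_recr// /forcing addrA [RHS]addrC.
congr (_ + _); rewrite drop_oversize// take_oversize// composition_sum_nil /linear_part.
rewrite /block; case: l => [|v' l]; last by rewrite addr0.
by rewrite -(linearD' _ _ (lP t [::] [::])) /=; congr (P t [:: _]); apply: injective_projections; rewrite /= ?addr0 ?add0r.
Qed.

Lemma block_linear t l1 l2 : linear (fun v => u (l1 ++ v :: l2) t) ->
  linear (fun v => block u t (l1 ++ v :: l2)).
Proof.
move=> h b x y; rewrite /block; apply: injective_projections => /=; first exact: h.
by case: l1 {h} => [|w [|w' l1]]; case: l2 => [|z l2] //=; rewrite scaler0 addr0.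
Qed.

Lemma forcing_linear t l1 l2 :
  (forall k1 k2, (size k1 + size k2 < size l1 + size l2)%N ->
     linear (fun v => block u t (k1 ++ v :: k2))) ->
  linear (fun v => forcing (block u t) (P t) (l1 ++ v :: l2)).
Proof.
move=> lw b x y.
have sz z : size (l1 ++ z :: l2) = (size l1 + size l2).+1 by rewrite size_cat /= addnS.
rewrite /forcing !sz /= scalerDr addrACA; congr (_ + _).
  case: l1 {lw sz} => [|w [|w' l1]]; case: l2 => [|z l2] //=; rewrite ?scaler0 ?addr0//.
  rewrite -(lP t [::] [::]) /=; congr (P t [:: _]).
  by apply: injective_projections; rewrite /= ?scaler0 ?addr0.
rewrite scaler_sumr -big_split /=; apply: eq_big_nat => i /andP[_ il].
have [il1|il1] := leqP i.+1 (size l1).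
  have tk z : take i.+1 (l1 ++ z :: l2) = take i.+1 l1 by rewrite takel_cat.
  have dr z : drop i.+1 (l1 ++ z :: l2) = drop i.+1 l1 ++ z :: l2.
    rewrite drop_cat; case: ifPn => //; rewrite -leqNgt => h.
    have e : i.+1 = size l1 by apply/eqP; rewrite eqn_leq il1 h.
    by rewrite e subnn drop0 drop_size.
  rewrite !tk !dr; apply: composition_sum_linear; first exact: list_multilinear_cons.
  move=> k1 k2 h; apply: lw; apply: leq_ltn_trans h _; rewrite ltn_add2r size_drop.
  by rewrite -{2}[size l1]subn0 ltn_sub2l//; case: (size l1) il1.
have tk z : take i.+1 (l1 ++ z :: l2) = l1 ++ z :: take (i - size l1) l2.
  by rewrite take_cat ltnNge leqW//= subSn.
have dr z : drop i.+1 (l1 ++ z :: l2) = drop (i - size l1) l2.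
  by rewrite drop_cat ltnNge leqW//= subSn.
rewrite !tk !dr; apply: composition_sum_combination => s; rewrite lw; first exact: (lP t [::]).
have h : (i - size l1 < size l2)%N by rewrite ltn_subLR.
by rewrite ltn_add2l size_takel// ltnW.
Qed.

(** Bounded solutions depend linearly on the forcing, by uniqueness, and the
forcing is multilinear because the shorter coefficients are. *)
Lemma coefficient_multilinear l1 l2 t : linear (fun v => u (l1 ++ v :: l2) t).
Proof.
have [n ln] := ubnP (size l1 + size l2); elim: n => // n IH in l1 l2 ln t *.
move=> b x y.
have s0 z : (0 < size (l1 ++ z :: l2))%N by rewrite size_cat addnS.
have := bounded_response_combination b (coefficient_response (s0 x)) (coefficient_response (s0 y)).
have -> : (fun t => b *: forcing (block u t) (P t) (l1 ++ x :: l2) +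
      forcing (block u t) (P t) (l1 ++ y :: l2)) =
    (fun t => forcing (block u t) (P t) (l1 ++ (b *: x + y) :: l2)).
  apply/funext => s; rewrite forcing_linear// => k1 k2 h; apply: block_linear.
  by apply: IH; exact: leq_trans h ln.
by move=> h; rewrite (bounded_response_to_unique (coefficient_response (s0 _)) h).
Qed.

Section CoefficientBound.
Context (kap : R) (kap0 : 0 < kap)
  (kapP : response_gain C a kap).
Context (K b : R) (K0 : 0 < K) (b0 : 0 <= b) (AK : 16 * (A * K) <= 1)
  (CK : 16 * kap * C0 * A ^+ 2 * K <= 1) (Kb : 1 + kap * C0 * A <= K * b).
Local Notation theta := (@convolution_weight R).

(** At least two blocks occur, so the bound is quadratic in K and closes for
small K; the growth rate b is still free to match the coefficients of degree 1. *)
Lemma forcing_bound t l (w : seq L -> E) : (1 < size l)%N ->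
  (forall l', (0 < size l' < size l)%N ->
     `|w l'| <= K * b ^+ size l' * theta (size l') * norm_prod l') ->
  kap * `|forcing w (P t) l| <= K * b ^+ size l * theta (size l) * norm_prod l.
Proof.
case: l => [|v [|v' l0]] // _; set l := [:: v, v' & l0] => bw.
have [n sl] : exists n, size l = n.+1 by exists (size l0).+1.
have -> : forcing w (P t) l = \sum_(0 <= i < n)
     composition_sum n w (fun s => P t (w (take i.+1 l) :: s)) (drop i.+1 l).
  by rewrite /forcing sl /= add0r.
clearbody l; pose B := norm_prod l.
have B0 : 0 <= B by exact: norm_prod_ge0.
have K0' := ltW K0.
have AK0 : 0 <= A * K by rewrite mulr_ge0.
have h : `|\sum_(0 <= i < n) composition_sum n w (fun s => P t (w (take i.+1 l) :: s)) (drop i.+1 l)|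
   <= \sum_(0 <= i < n) (2 * C0 * (A * K) * (A * K) * b ^+ n.+1 * B) * (theta i.+1 * theta (n - i)).
  apply: le_trans (ler_norm_sum _ _ _) _; rewrite big_nat_cond [leRHS]big_nat_cond.
  apply: ler_sum => i; rewrite andbT => /andP[_ il].
  have il' : (i.+1 <= size l)%N by rewrite sl ltnS ltnW.
  have split_l : norm_prod (take i.+1 l) * norm_prod (drop i.+1 l) = B.
    by rewrite -norm_prod_cat cat_take_drop.
  have sd : size (drop i.+1 l) = (n - i)%N by rewrite size_drop sl subSS.
  pose ci := C0 * (A * K) * b ^+ i.+1 * theta i.+1 * norm_prod (take i.+1 l).
  have ci0 : 0 <= ci by rewrite !mulr_ge0 ?exprn_ge0 ?theta_ge0 ?norm_prod_ge0.
  have bQ s : `|P t (w (take i.+1 l) :: s)| <= ci * A ^+ size s * norm_prod s.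
    apply: le_trans (bP _ _) _; rewrite norm_prod_cons /= exprS.
    have := bw (take i.+1 l); rewrite size_takel// => /(_ _) hb.
    have -> : ci * A ^+ size s * norm_prod s
      = (C0 * (A * A ^+ size s)) * ((K * b ^+ i.+1 * theta i.+1 * norm_prod (take i.+1 l)) * norm_prod s).
      by rewrite /ci; ring.
    apply: ler_wpM2l; first by rewrite !mulr_ge0// exprn_ge0.
    apply: ler_wpM2r; [exact: norm_prod_ge0|apply: hb; by rewrite sl].
  have := @composition_sum_bound _ _ _ _ n w (fun s => P t (w (take i.+1 l) :: s)) ci A K b (drop i.+1 l)
    ci0 A0 K0' b0 AK.
  rewrite sd subn_gt0 il leq_subr => /(_ isT bQ) hc; apply: le_trans (hc _) _.
    move=> l' /andP[l'0 l's]; apply: bw; rewrite l'0 sl; apply: leq_ltn_trans l's _.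
    by rewrite ltnS leq_subr.
  rewrite /ci -split_l.
  have -> : b ^+ n.+1 = b ^+ i.+1 * b ^+ (n - i) by rewrite -exprD addSn subnKC// ltnW.
  by rewrite le_eqVlt; apply/orP; left; apply/eqP; ring.
apply: le_trans (ler_wpM2l (ltW kap0) h) _; rewrite -mulr_sumr.
have X0 : 0 <= kap * (2 * C0 * (A * K) * (A * K) * b ^+ n.+1 * B).
  by apply: mulr_ge0; [exact: ltW|rewrite !mulr_ge0// exprn_ge0].
rewrite [leLHS]mulrA; have cv := @theta_convolution R n; have h2 := ler_wpM2l X0 cv.
apply: (le_trans h2); rewrite sl -/B.
have -> : kap * (2 * C0 * (A * K) * (A * K) * b ^+ n.+1 * B) * (8 * theta n.+1) =
  (16 * kap * C0 * A ^+ 2 * K) * (K * b ^+ n.+1 * theta n.+1 * B) by ring.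
apply: ler_piMl => //.
by rewrite !mulr_ge0 ?exprn_ge0 ?theta_ge0.
Qed.

Lemma block_bound l t : (0 < size l)%N ->
  `|block u t l| <= K * b ^+ size l * theta (size l) * norm_prod l.
Proof.
have [n ln] := ubnP (size l); elim: n => // n IH in l ln t *; move=> l0.
have [[B bu] Du] := coefficient_response l0.
have DD s : lform C (u l s) (linear_part s (u l s) + forcing (block u s) (P s) l) <=
    - a * lform C (u l s) (u l s) + lform C (u l s) (forcing (block u s) (P s) l).
  by rewrite [X in X <= _]lformDr lerD2r; exact: dP.
have bb F : (forall s, kap * `|forcing (block u s) (P s) l| <= F) -> `|u l t| <= F.
  move=> hF; have := kapP bu Du DD (B := F / kap) _ t; rewrite mulrCA divff ?gt_eqF// mulr1; apply.
  by move=> s; rewrite ler_pdivlMr// mulrC.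
case: l l0 ln bu Du DD bb => [//|v [|v' l]] l0 ln bu Du DD bb.
  have -> : theta (size [:: v]) = 1 by rewrite /convolution_weight expr1n invr1.
  rewrite mulr1 expr1 norm_prod_cons norm_prod_nil mulr1.
  have k1 : 0 <= kap * C0 * A by rewrite !mulr_ge0// ltW.
  rewrite prod_normE ge_max /block /=; apply/andP; split.
    apply: bb => s; rewrite /forcing /= big_geq// addr0.
    have h := bP s [:: (0, v) : E]; rewrite expr1 norm_prod_cons norm_prod_nil mulr1 in h.
    rewrite prod_normE /= normr0 max_r// in h.
    apply: le_trans (ler_wpM2l (ltW kap0) h) _; rewrite !mulrA; apply: ler_wpM2r => //.
    by apply: le_trans Kb; rewrite lerDr.
  by rewrite -[leLHS]mul1r; apply: ler_wpM2r => //; apply: le_trans Kb; rewrite lerDl.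
rewrite prod_normE /= normr0 ge_max; apply/andP; split; last first.
  by rewrite mulr_ge0 ?norm_prod_ge0// mulr_ge0 ?theta_ge0// mulr_ge0 ?exprn_ge0// ltW.
apply: bb => s; apply: forcing_bound => // l' /andP[l'0 l's].
by apply: IH => //; exact: leq_trans l's ln.
Qed.

End CoefficientBound.

End Coefficients.

(** * Analyticity of the bounded solution *)

Section AnalyticSection.
Context {R : realType} {m N k : nat} (C : 'M[R]_(m, N)) (a c : R).
Context (a0 : 0 < a) (c0 : 0 < c)
  (CL : forall x : 'cV[R]_N, c * `|x| ^+ 2 <= lform C x x).
Context (Omega : 'cV[R]_k) (e0 : R) (e00 : 0 < e0).
Local Notation Lam := ('cV[R]_k * R)%type.
Local Notation E := ('cV[R]_N * Lam)%type.
Local Notation params := (@params R k e0).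
Local Notation om := (drift Omega).
Context (U : set 'cV[R]_N) (oU : open U) (rho : R) (rho0 : 0 < rho)
  (rhoU : forall x : 'cV[R]_N, `|x| <= rho -> U x).
Context (G : E -> 'cV[R]_N) (h : Lam -> 'cV[R]_N).
Context (GA : analytic_on (U `*` params) G) (GP : torus_periodic e0 U G)
  (GD : dissipative C a e0 G rho)
  (hrho : forall p, params p -> `|h p| <= rho / 2)
  (hG : invariant_section Omega e0 G h).

Let fLam : fin_dim (Lam : normedModType R).
Proof. by apply: fin_dim_pair; [exact: fin_dim_cV|exact: fin_dim_real]. Qed.
Let fE : fin_dim (E : normedModType R).
Proof. by apply: fin_dim_pair; [exact: fin_dim_cV|exact: fLam]. Qed.
Let S := U `*` params.
Let thS x : S x -> thick_at S x.
Proof. exact: thick_params. Qed.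
Let D l := iterated_derivative S G l.
Let DD l x : S x -> derivative_within S (D l) x (fun v => D (v :: l) x).
Proof. exact: analytic_derivative. Qed.

Lemma iterated_derivative_periodic l : torus_periodic e0 U (D l).
Proof.
elim: l => [//|v l IH] x p j Ux Sp.
have := @torus_periodic_derivative _ _ e0 e00 _ _ U (D l) (fun z v => D (v :: l) z) oU IH.
by move=> /(_ (fun z Sz => DD l Sz)) /(_ x p j Ux Sp) /(congr1 (fun f => f v)).
Qed.

(** Derivatives inherit periodicity, so it is enough to consider phases in a
compact box. *)
Lemma uniform_cauchy_bound : exists C0 A r : R, [/\ [&& 0 <= C0, 0 <= A & 0 < r] &
  forall x p, `|x| <= rho -> params p -> cauchy_bound S G (x, p) C0 A r].
Proof.
pose Q : set E := [set x : 'cV[R]_N | forall i, - rho <= x i 0 <= rho] `*`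
  ([set phi : 'cV[R]_k | forall i, 0 <= phi i 0 <= 2 * pi] `*` `[0, e0]%classic).
have cQ : compact Q.
  apply: compact_setX; first exact: cV_box_compact.
  by apply: compact_setX; [exact: cV_box_compact|exact: segment_compact].
have QS : Q `<=` S.
  move=> [x [phi e]] [/= bx [bphi be]]; split => //=.
  by apply: rhoU; apply: cV_norm_le => [|i]; [exact: ltW|rewrite ler_norml; exact: bx].
have [C0 [A [r [pos H]]]] := compact_cauchy_bound thS GA cQ QS.
exists C0, A, r; split => // x [phi e] xr Sp [y q] l Sy yr.
have [n bn] := lattice_reduce phi.
have Qx : Q (x, (phi, e) + (lattice n, 0)).
  split => /=; first by move=> i; rewrite -ler_norml; exact: le_trans (cV_coord_le _ _) xr.
  by split => //=; rewrite addr0; case: Sp.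
have [Uy Sq] := Sy.
have Sq' : params (q + (lattice n, 0)).
  by case: (q) Sq => q1 q2 [_ /= q2e]; split => //=; rewrite addr0.
rewrite -/(D l (y, q)).
have <- : D l (y, q + (lattice n, 0)) = D l (y, q).
  exact: torus_periodic_lattice (@iterated_derivative_periodic l) _ _.
apply: (H _ Qx); first by split.
have -> : (y, q + (lattice n, 0)) - (x, (phi, e) + (lattice n, 0)) = (y, q) - (x, (phi, e)).
  apply: injective_projections => //=.
  by rewrite opprD addrACA subrr addr0.
exact: yr.
Qed.

(** The coefficients of the formal power series solution along the orbit of p,
taken at time 0, are the Taylor coefficients of h at p. Indeed a partial sum,
added to the orbit of p, solves the equation for p + eta up to an error that is
exponentially small in the order of truncation, and by dissipativity it is then
as close to the orbit of p + eta. *)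
Theorem section_analytic : analytic_on params h.
Proof.
move=> p Sp; apply/analytic_withinP.
have [C0 [A [r1 [/and3P[C00 A0 r10] CB]]]] := uniform_cauchy_bound.
have rho20 : 0 < rho / 2 by rewrite divr_gt0.
have rho2 : rho / 2 < rho by rewrite ltr_pdivrMr// ltr_pMr// ltr1n.
pose z (t : R) : E := (h (p + t *: om), p + t *: om).
have Spt t : params (p + t *: om) by exact: params_drift.
have zr t : `|(z t).1| <= rho / 2 by exact: hrho.
have Sz t : S (z t) by split => /=; [apply: rhoU; apply: le_trans (hrho (Spt t)) (ltW rho2)|exact: Spt].
pose P (t : R) l := (size l)`!%:R^-1 *: D l (z t).
have f0 n : 0 < n`!%:R :> R by rewrite ltr0n fact_gt0.
have lP t : list_multilinear (P t).
  move=> l1 l2 b u v; have [_ lin _] := analytic_local thS (Sz t) (GA (Sz t)).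
  have sz x : size (l1 ++ x :: l2) = (size l1 + size l2).+1 by rewrite size_cat /= addnS.
  rewrite /P !sz /D lin scalerDr !scalerA; congr (_ *: _ + _); exact: mulrC.
have CBt t y l : S y -> `|y - z t| < r1 -> `|D l y| <= C0 * A ^+ size l * (size l)`!%:R * norm_prod l.
  by move=> Sy yr; apply: CB yr => //; exact: le_trans (zr t) (ltW rho2).
have bP t l : `|P t l| <= C0 * A ^+ size l * norm_prod l.
  rewrite /P normrZ gtr0_norm ?invr_gt0// mulrC ler_pdivrMr//.
  have := CBt t (z t) l (Sz t); rewrite subrr normr0 => /(_ r10).
  by rewrite -mulrA [_%:R * _]mulrC mulrA.
have cz : continuous z.
  by move=> t; exact: (orbit_continuous hG Sp).
have cP s : continuous (P^~ s).
  move=> t; apply: cvgZ; first exact: cvg_cst.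
  have cD : {within S, continuous (D s)} := derivative_within_continuous fE (DD s).
  exact: (continuous_in_domain cD cz Sz).
have dP t v : lform C v (P t [:: (v, 0)]) <= - a * lform C v v.
  rewrite /P /= invr1 scale1r.
  have DD1 w : S w -> derivative_within S G w (fun v => D [:: v] w) by exact: DD [::] _.
  exact: (dissipative_derivative rhoU GD DD1 v (le_lt_trans (zr t) rho2) (Spt t)).
have Pnil t : P t [::] = G (z t) by rewrite /P /= invr1 scale1r.
have [kap kap0 kapP] := bounded_response a0 c0 CL.
pose q := kap * C0 * A; have q0 : 0 <= q by rewrite !mulr_ge0// ltW.
(* small enough for the two conditions that close the recursion *)
pose K := (16 * (A + 1) * (1 + q))^-1.
have q1 : 0 < 1 + q by rewrite ltr_pwDl.
have A1 : 0 < A + 1 by rewrite ltr_wpDl.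
have K0 : 0 < K by rewrite invr_gt0 !mulr_gt0.
have AK : 16 * (A * K) <= 1.
  rewrite mulrA /K ler_pdivrMr ?mulr_gt0// mul1r -!mulrA ler_pM2l//.
  by have := mulr_ge0 A0 q0; nra.
have CK : 16 * kap * C0 * A ^+ 2 * K <= 1.
  rewrite /K ler_pdivrMr ?mulr_gt0// mul1r.
  have -> : 16 * kap * C0 * A ^+ 2 = 16 * A * q by rewrite /q; ring.
  by have := mulr_ge0 A0 q0; nra.
(* large enough for the coefficients of degree 1 *)
pose b := (1 + q) / K; have b0 : 0 <= b by rewrite divr_ge0 ?(ltW q1) ?(ltW K0).
have Kb : 1 + kap * C0 * A <= K * b by rewrite /b mulrCA mulfV ?gt_eqF// mulr1.
pose u := coefficient P.
have bu l t : (0 < size l)%N -> `|block u t l| <= K * b ^+ size l * norm_prod l.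
  move=> l0; apply: le_trans (block_bound a0 c0 CL A0 C00 lP bP cP dP kap0 kapP K0 b0 AK CK Kb t l0) _.
  apply: ler_wpM2r; first exact: norm_prod_ge0.
  by apply: ler_piMr; [rewrite mulr_ge0 ?exprn_ge0// ltW|exact: theta_le1].
(* the Taylor expansion along the orbit is valid for increments of this size *)
pose r2 := Num.min (rho / 2) (Num.min (r1 / 2) (2 * (A + 1))^-1).
have r20 : 0 < r2 by rewrite !lt_min rho20 divr_gt0// invr_gt0 mulr_gt0.
have taylor t X : `|X| <= r2 -> params (z t + X).2 -> power_sum (P t) X (G (z t + X)).
  rewrite !le_min => /and3P[X1 X2 X3] SX.
  have zX : z t + X - z t = X by rewrite addrC addKr.
  have Sseg s : 0 <= s <= 1 -> S (z t + s *: (z t + X - z t)).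
    move=> s01; split => /=; last first.
      have -> : (z t).2 + s *: (z t + X - z t).2 = (z t).2 + s *: ((z t + X).2 - (z t).2) by [].
      by apply: params_convex => //; exact: Spt.
    have -> : h (p + t *: om) + X.1 - h (p + t *: om) = X.1 by rewrite addrC addKr.
    apply: rhoU; apply: le_trans (ler_normD _ _) _; rewrite [rho]splitr.
    apply: lerD; first exact: zr.
    rewrite normrZ; apply: le_trans X1; case/andP: s01 => s0 s1.
    rewrite ger0_norm//; apply: le_trans (_ : `|X.1| <= _); first exact: ler_piMl.
    by rewrite prod_normE le_max lexx.
  have Xr : `|X| < r1 by apply: le_lt_trans X2 _; rewrite ltr_pdivrMr// ltr_pMr// ltr1n.
  have := @taylor_series _ _ _ fE S (iterated_derivative S G) DD (z t) (z t + X) C0 A C00 A0.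
  rewrite zX; apply => //.
  - apply: le_trans (ler_wpM2l A0 X3) _; rewrite invfM mulrCA; apply: ler_piMr => //.
    by rewrite ler_pdivrMr// mul1r lerDl.
  - by move=> s s01; have := Sseg s s01; rewrite zX.
  - move=> s l s01; apply: (CBt t); first by have := Sseg s s01; rewrite zX.
    have -> : z t + s *: X - z t = s *: X by rewrite addrC addKr.
    rewrite normrZ; apply: le_lt_trans Xr; case/andP: s01 => s0 s1.
    by rewrite ger0_norm//; apply: ler_piMl.
(* the partial sums are at most ka in norm, hence stay where the expansion is
   valid *)
pose ka := Num.min K r2.
have ka0 : 0 < ka by rewrite lt_min K0.
have kaK : ka <= K by rewrite ge_min lexx.
have ka2 : ka <= r2 by rewrite ge_min lexx orbT.
have AkaK : A * ka <= 2^-1.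
  have : A * ka <= A * K by rewrite ler_wpM2l.
  by move: (A * K) (A * ka) AK => x y; lra.
exists (fun l => if l is [::] then h p else u l 0); split.
  by move=> [|w l1] l2; [exact: (coefficient_multilinear a0 c0 CL A0 C00 lP bP cP dP [::])|
    exact: (coefficient_multilinear a0 c0 CL A0 C00 lP bP cP dP (w :: l1))].
exists (`|h p| + K), b, (ka / (4 * K * (b + 1))); split.
- by rewrite addr_ge0 ?(ltW K0)// b0 divr_gt0// !mulr_gt0// ltr_wpDl.
- case=> [|v l]; first by rewrite expr0 norm_prod_nil !mulr1 lerDl ltW.
  have := bu (v :: l) 0 isT; rewrite prod_normE ge_max => /andP[hu _]; apply: le_trans hu _.
  rewrite -!mulrA; apply: ler_wpM2r; last by rewrite lerDr.
  by rewrite mulr_ge0 ?exprn_ge0 ?norm_prod_ge0.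
move=> eta; rewrite ltr_pdivlMr ?mulr_gt0 ?ltr_wpDl// => er Se.
have bW i t : `|block u t (nseq i.+1 eta)| <= ka * 4^-1 ^+ i.+1.
  apply: le_trans (bu _ _ _) _; first by rewrite size_nseq.
  rewrite size_nseq norm_prod_nseq -mulrA -exprMn.
  have be : b * `|eta| <= ka / K * 4^-1.
    rewrite !ler_pdivlMr//; apply: le_trans (ltW er).
    have := mulr_ge0 (ltW K0) (normr_ge0 eta); nra.
  have kK1 : 0 <= ka / K <= 1 by rewrite divr_ge0 ?(ltW ka0) ?(ltW K0)//= ler_pdivrMr// mul1r.
  apply: (@le_trans _ _ (K * (ka / K * 4^-1) ^+ i.+1)).
    have k4 : 0 <= ka / K / 4 by rewrite divr_ge0//; case/andP: kK1.
    have be0 : 0 <= b * `|eta| by rewrite mulr_ge0.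
    by apply: ler_wpM2l; [exact: ltW|apply: lerXn2r => //; rewrite nnegrE].
  rewrite exprMn mulrA; apply: ler_wpM2r; first by rewrite exprn_ge0.
  have -> : ka = K * (ka / K) by rewrite mulrCA mulfV ?gt_eqF// mulr1.
  rewrite [K * (ka / K) in X in X / K]mulrCA mulfV ?gt_eqF// mulr1.
  apply: ler_wpM2l; first exact: ltW.
  by rewrite exprS; apply: ler_piMr; [case/andP: kK1|apply: exprn_ile1; case/andP: kK1].
pose x1 M t := h (p + t *: om) + \sum_(0 <= i < M) u (nseq i.+1 eta) t.
pose x2 t := h (p + eta + t *: om).
have bX M t : `|\sum_(0 <= i < M) block u t (nseq i.+1 eta)| <= ka.
  apply: le_trans (ler_norm_sum _ _ _) _.
  apply: (@le_trans _ _ (\sum_(0 <= i < M) (ka / 2) * 2^-1 ^+ i)).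
    apply: ler_sum => i _; apply: le_trans (bW i t) _; rewrite -mulrA; apply: ler_wpM2l; first exact: ltW.
    rewrite -exprS; apply: lerXn2r; rewrite ?nnegrE//; lra.
  rewrite -mulr_sumr; have := @half_sum R M; set s := \sum_(_ <= _ < _) _ => hs.
  have := ler_wpM2l (ltW ka0) hs; lra.
have XE M t : (z t + \sum_(0 <= i < M.+1) block u t (nseq i.+1 eta)) =
    (x1 M.+1 t, p + eta + t *: om).
  apply: injective_projections => /=.
    by congr (_ + _); rewrite (big_morph fst (id1 := 0) (op1 := +%R)).
  rewrite (big_morph snd (id1 := 0) (op1 := +%R))//= big_nat_recl//= big1 ?addr0 => [|i _ //].
  by rewrite addrAC.
have Sq t : params (p + eta + t *: om) by exact: params_drift.
have x1rho M t : `|x1 M.+1 t| <= rho.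
  have -> : x1 M.+1 t = (z t).1 + (\sum_(0 <= i < M.+1) block u t (nseq i.+1 eta)).1.
    by have := congr1 fst (XE M t).
  apply: le_trans (ler_normD _ _) _; rewrite [rho]splitr; apply: lerD; first exact: zr.
  apply: le_trans (_ : _ <= r2) _; last by rewrite ge_min lexx.
  apply: le_trans ka2; apply: le_trans (bX M.+1 t); by rewrite prod_normE le_max lexx.
have x2rho t : `|x2 t| <= rho by apply: le_trans (hrho (Sq t)) (ltW rho2).
have Dx1 M (t : R) : is_derive t 1 (x1 M) (composition_partial (block u t) eta M (P t)).
  rewrite /composition_partial big_nat_recl// composition_sum_nil Pnil.
  apply: is_deriveD; first exact: hG.
  elim: M => [|M IH].
    rewrite [X in is_derive _ _ X](_ : _ = fun=> 0) ?big_geq//; first exact: is_derive_cst.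
    by apply/funext => s; rewrite big_geq.
  rewrite [X in is_derive _ _ X](_ : _ = (fun t => \sum_(0 <= i < M) u (nseq i.+1 eta) t) \+
     u (nseq M.+1 eta)); last by apply/funext => s; rewrite big_nat_recr.
  rewrite big_nat_recr//; apply: is_deriveD.
  have := coefficient_derive a0 c0 CL A0 C00 lP bP cP dP t (l := nseq M.+1 eta).
  rewrite size_nseq => /(_ isT) HH; exact: HH.
(* the partial sum solves the equation for p + eta up to this error *)
have err M t : `|composition_partial (block u t) eta M.+1 (P t) - G (x1 M.+1 t, p + eta + t *: om)|
    <= 2 * C0 * 2^-1 ^+ M.+1.
  rewrite distrC -XE.
  have := taylor t (\sum_(0 <= i < M.+1) block u t (nseq i.+1 eta)) (le_trans (bX _ t) ka2).
  rewrite {1}XE => /(_ (Sq t)); rewrite /power_sum -(cvg_shiftS (series _)) => cv.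
  apply: (cvg_norm_le (cvgB cv (cvg_cst _))).
  near=> n.
  apply: (truncation_error (M := M.+1) A0 (ltW ka0) AkaK (fun i => bW i t)) => //.
  by near: n; exact: nbhs_infty_ge.
have close M : `|x1 M.+1 0 - h (p + eta)| <= kap * (2 * C0) * 2^-1 ^+ M.+1.
  have := kapP (fun t => x1 M.+1 t - x2 t)
    (fun t => composition_partial (block u t) eta M.+1 (P t) - G (x2 t, p + eta + t *: om))
    (fun t => composition_partial (block u t) eta M.+1 (P t) - G (x1 M.+1 t, p + eta + t *: om))
    (2 * C0 * 2^-1 ^+ M.+1) (rho + rho).
  move=> /(_ _ _ _ (err M) 0); rewrite /x2 scale0r addr0 mulrA; apply.
  - by move=> t; apply: le_trans (ler_normB _ _) _; apply: lerD; [exact: x1rho|exact: x2rho].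
  - move=> t; have ? := Dx1 M.+1 t.
    have ? : is_derive t 1 x2 (G (x2 t, p + eta + t *: om)) by exact: hG.
    exact: is_deriveB.
  - move=> t; rewrite -lerBlDr.
    set w := x1 _ _ - _; set F := composition_partial _ _ _ _; set g1 := G (x1 _ _, _); set g2 := G _.
    have -> : lform C w (F - g2) - lform C w (F - g1) = lform C w (g1 - g2).
      have e2 : F - g2 = (F - g1) + (g1 - g2) by rewrite subrKA.
      by rewrite e2 (lformDr C (F - g1)) addrAC subrr add0r.
    rewrite /w /g1 /g2; apply: GD; [exact: x1rho|exact: x2rho|exact: Sq].
rewrite -(cvg_shiftS (series _)) -(cvg_shiftS (fun n => series _ n.+1)).
apply/cvgrPdist_le => e e1.
have /cvgrPdist_le/(_ _ e1) := cvg_half (kap * (2 * C0)).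
apply: filterS => n; rewrite sub0r normrN => hn.
rewrite distrC.
have E1 : series (fun n => if nseq n eta is [::] then h p else u (nseq n eta) 0) n.+2 = x1 n.+1 0.
  by rewrite /series /= big_nat_recl//= /x1 scale0r addr0.
have hc := close n; rewrite -E1 in hc; apply: (le_trans hc).
apply: le_trans hn; apply: le_trans (ler_norm _).
apply: ler_wpM2l; first by rewrite mulr_ge0 ?mulr_ge0// ltW.
by rewrite exprS; apply: ler_piMl; rewrite ?exprn_ge0//; lra.
Unshelve. all: by end_near. Qed.

End AnalyticSection.

(** * A positive trigonometric kernel *)

Section Kernel.
Context {R : realType}.
Local Open Scope complex_scope.
Local Notation expi := (@expi R).
Implicit Types (x y theta : R) (n M : nat).

Lemma expiD x y : expi (x + y) = expi x * expi y.
Proof. by rewrite /expi cosD sinD /GRing.mul /=; congr (_ +i* _); rewrite addrC. Qed.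

Lemma expi0 : expi 0 = 1.
Proof. by rewrite /expi cos0 sin0. Qed.

Lemma expi_sum I (r : seq I) (F : I -> R) :
  expi (\sum_(i <- r) F i) = \prod_(i <- r) expi (F i).
Proof. by apply: (big_morph expi) => [x y|]; [exact: expiD|exact: expi0]. Qed.

Lemma expiX n x : expi (n%:R * x) = expi x ^+ n.
Proof.
elim: n => [|n IH]; first by rewrite mul0r expi0 expr0.
by rewrite -natr1 mulrDl mul1r expiD IH exprSr.
Qed.

Lemma expi2pi (m : int) : expi (m%:~R * (2 * pi)) = 1.
Proof.
have h n : expi (n%:R * (2 * pi)) = 1.
  rewrite expiX; suff -> : expi (2 * pi) = 1 by rewrite expr1n.
  by rewrite mulr_natl /expi -[pi *+ 2]add0r cosD2pi sinD2pi cos0 sin0.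
case: m => n; first exact: h.
have := expiD (- (n.+1%:R * (2 * pi))) (n.+1%:R * (2 * pi)).
rewrite addNr expi0 h mulr1 => e; rewrite NegzE mulrNz mulNr; exact: esym e.
Qed.

Lemma cos_lt1 x : 0 < x < 2 * pi -> cos x < 1.
Proof.
move=> /andP[x0 x1]; have -> : x = x / 2 + x / 2 by field.
rewrite cosD -!expr2 cos2sin2.
have : 0 < sin (x / 2) by apply: sin_gt0_pi; rewrite divr_gt0//= ltr_pdivrMr// mulrC.
by move=> s0; have := exprn_gt0 2 s0; lra.
Qed.

Definition node M (j : nat) : R := 2 * pi * j%:R / M%:R.

(** A geometric sum over the powers of a nontrivial M-th root of unity. *)
Lemma expi_node_sum (m : int) M theta : (0 < `|m| < M)%N ->
  \sum_(j < M) expi (m%:~R * (theta - node M j)) = 0.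
Proof.
move=> /andP[m0 mM]; have M0 : 0 < M%:R :> R by rewrite ltr0n; apply: leq_ltn_trans mM.
pose x : R := - (m%:~R * (2 * pi) / M%:R).
have E j : expi (m%:~R * (theta - node M j)) = expi (m%:~R * theta) * expi x ^+ j.
  rewrite -expiX -expiD; congr expi; by rewrite /x /node; field; rewrite gt_eqF.
under eq_bigr => j _ do rewrite E.
rewrite -mulr_sumr.
have := subrX1 (expi x) M; rewrite -expiX.
have -> : M%:R * x = (- m)%:~R * (2 * pi).
  by rewrite /x mulrNz; field; rewrite gt_eqF.
rewrite expi2pi subrr => /esym/eqP; rewrite mulf_eq0 => /predU1P[|/eqP ->]; last by rewrite mulr0.
move/eqP; rewrite subr_eq0 => /eqP [ex _]; exfalso.
have : cos ((`|m|%N)%:R * (2 * pi) / M%:R : R) < 1.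
  have p0 : 0 < 2 * pi :> R by rewrite mulr_gt0// pi_gt0.
  apply: cos_lt1; apply/andP; split; first by rewrite divr_gt0// mulr_gt0// ltr0n.
  by rewrite ltr_pdivrMr// mulrC ltr_pM2l// ltr_nat.
suff -> : cos ((`|m|%N)%:R * (2 * pi) / M%:R : R) = 1 by rewrite ltxx.
transitivity (cos (m%:~R * (2 * pi) / M%:R : R)); last by rewrite -[LHS]cosN.
case: (m) => n //.
by rewrite NegzE mulrNz !mulNr cosN.
Qed.

(** With z = e^(i theta) this is z^(-n) (1 + z)^(2 n) / 4^n, which shows that it
is nonnegative, concentrated at 0, and a trigonometric polynomial of degree n. *)
Definition kern n theta : R := ((1 + cos theta) / 2) ^+ n.
Definition kern_coef n (p : nat) : R := ('C(n.*2, p))%:R / 4 ^+ n.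

Lemma kern_ge0 n theta : 0 <= kern n theta.
Proof. by apply: exprn_ge0; rewrite divr_ge0//; have := cos_geN1 theta; lra. Qed.

Lemma kern_fourier n theta : (kern n theta)%:C =
  \sum_(p < n.*2.+1) (kern_coef n p)%:C * expi ((p%:Z - n%:Z)%:~R * theta).
Proof.
pose z := expi theta; have zN : expi (- theta) * z = 1 by rewrite -expiD addNr expi0.
have E1 p : expi ((p%:Z - n%:Z)%:~R * theta) = expi (- theta) ^+ n * z ^+ p.
  rewrite -!expiX -expiD; congr expi; rewrite intrD mulrNz mulrDl addrC; congr (_ + _).
  by rewrite mulNr mulrN.
transitivity ((4 ^+ n)^-1%:C * (expi (- theta) * (1 + z) ^+ 2) ^+ n).
  have -> : expi (- theta) * (1 + z) ^+ 2 = (2 * (1 + cos theta))%:C.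
    have -> : expi (- theta) * (1 + z) ^+ 2 =
      expi (- theta) + (expi (- theta) * z) *+ 2 + (expi (- theta) * z) * z by ring.
    rewrite zN mul1r /z /expi cosN sinN /real_complex_def.
    apply/eqP; rewrite eq_complex /=; apply/andP; split; apply/eqP; ring.
  have -> : kern n theta = (4 ^+ n)^-1 * (2 * (1 + cos theta)) ^+ n.
    by rewrite /kern -exprVn -exprMn; congr (_ ^+ _); field.
  by rewrite rmorphM rmorphXn.
rewrite exprMn -exprM mul2n [(1 + z) ^+ _]exprDn !mulr_sumr; apply: eq_bigr => p _.
rewrite expr1n mul1r E1 /kern_coef rmorphM /= rmorph_nat -mulr_natl.
by rewrite -[(real_complex R) _]/(_%:C); ring.
Qed.

(** The mean value of the kernel. *)
Definition central n : R := kern_coef n n.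

Lemma central_gt0 n : 0 < central n.
Proof. by rewrite divr_gt0 ?exprn_gt0// ltr0n bin_gt0 -addnn leq_addr. Qed.

Lemma centralS n : central n.+1 * (2 * n.+1%:R) = central n * (2 * n%:R + 1).
Proof.
have e : (n.+1 * 'C(n.+1.*2, n.+1) = 2 * ((n.*2.+1) * 'C(n.*2, n)))%N.
  rewrite doubleS -[LHS]mul_bin_diag.
  have -> : 'C(n.*2.+1, n) = 'C(n.*2.+1, n.+1).
    have := @bin_sub n.*2.+1 n.+1; have -> : (n.*2.+1 - n.+1 = n)%N by rewrite subSS -addnn addKn.
    move=> -> //.
    by rewrite ltnS -addnn leq_addr.
  have -> : (n.*2.+2 = 2 * n.+1)%N by rewrite -doubleS mul2n.
  by rewrite -mulnA -mul_bin_diag.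
rewrite /central /kern_coef exprS.
have := congr1 (fun k => k%:R : R) e; rewrite /= !natrM.
have -> : n.*2.+1%:R = 2 * n%:R + 1 :> R by rewrite -natr1 -mul2n natrM.
move: ('C(_, _)%:R) ('C(_, _)%:R) => v u h.
have -> : u / (4 * 4 ^+ n) * (2 * n.+1%:R) = (n.+1%:R * u) * (2 / (4 * 4 ^+ n)) by ring.
rewrite h; field; rewrite expf_neq0//.
Qed.

(** Sums over M equidistant nodes are exact for trigonometric polynomials of
degree below M. *)
Lemma kern_sum n M theta : (n < M)%N ->
  \sum_(j < M) kern n (theta - node M j) = M%:R * central n.
Proof.
move=> nM; apply: complexI; rewrite rmorph_sum /=.
under eq_bigr => j _ do rewrite kern_fourier.
rewrite exchange_big /=.
have nn : (n < n.*2.+1)%N by rewrite ltnS -addnn leq_addr.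
rewrite (bigD1 (Ordinal nn))//= [X in _ + X]big1 ?addr0 => [|p pn].
  under eq_bigr => j _ do rewrite subrr mul0r expi0 mulr1.
  by rewrite sumr_const card_ord mulr_natl rmorphMn.
rewrite -mulr_sumr expi_node_sum ?mulr0//.
have pn' : (p : nat) != n by apply: contraNneq pn => e; apply/eqP/val_inj.
rewrite absz_gt0 subr_eq0 eqz_nat pn' /=.
by have := ltn_ord p; move: nM; lia.
Qed.

(** Since 1 - cos = 2 (1 - (1 + cos) / 2), the moment is the difference of the
sums of two successive kernels; n + 2 nodes are enough for both. *)
Lemma kern_moment n theta :
  \sum_(j < n.+2) kern n (theta - node n.+2 j) * (1 - cos (theta - node n.+2 j)) =
  n.+2%:R * central n / n.+1%:R.
Proof.
transitivity (2 * (\sum_(j < n.+2) kern n (theta - node n.+2 j) -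
                    \sum_(j < n.+2) kern n.+1 (theta - node n.+2 j))).
  rewrite -sumrB mulr_sumr; apply: eq_bigr => j _.
  by rewrite /kern exprS; field.
rewrite !kern_sum// -mulrBr.
have n1 : n.+1%:R != 0 :> R by rewrite pnatr_eq0.
have h := centralS n; apply: (mulIf n1).
have -> : 2 * (n.+2%:R * (central n - central n.+1)) * n.+1%:R =
  n.+2%:R * (2 * central n * n.+1%:R - central n.+1 * (2 * n.+1%:R)) by ring.
by rewrite h -[n.+1%:R]natr1; field; rewrite natr1.
Qed.

End Kernel.

(** * Uniform approximation by trigonometric polynomials *)

Section TrigonometricApproximation.
Context {R : realType} {k N : nat} (G : 'cV[R]_k -> 'cV[R]_N).
Local Open Scope complex_scope.
Local Notation expi := (@expi R).

Definition weight (n : nat) (phi : 'cV[R]_k) (J : {ffun 'I_k -> 'I_n.+2}) : R :=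
  \prod_i (kern n (phi i 0 - node n.+2 (J i)) / (n.+2%:R * central n)).

Definition node_point (n : nat) (J : {ffun 'I_k -> 'I_n.+2}) : 'cV[R]_k :=
  \col_i node n.+2 (J i).

Definition trigonometric_approximant (n : nat) (phi : 'cV[R]_k) : 'cV[R]_N :=
  \sum_(J : {ffun 'I_k -> 'I_n.+2}) weight phi J *: G (node_point J).

Let norm0 n : 0 < n.+2%:R * central n :> R.
Proof. by rewrite mulr_gt0// central_gt0. Qed.

Lemma weight_ge0 n (phi : 'cV[R]_k) (J : {ffun 'I_k -> 'I_n.+2}) : 0 <= weight phi J.
Proof. by apply: prodr_ge0 => i _; rewrite divr_ge0 ?kern_ge0// ltW. Qed.

Lemma kern_total n (x : R) :
  \sum_(j < n.+2) kern n (x - node n.+2 j) / (n.+2%:R * central n) = 1.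
Proof. by rewrite -mulr_suml kern_sum// mulfV// gt_eqF. Qed.

Lemma weight_total n (phi : 'cV[R]_k) : \sum_J @weight n phi J = 1.
Proof.
rewrite /weight -(bigA_distr_bigA (fun i (j : 'I_n.+2) => kern n (phi i 0 - node n.+2 j) / (n.+2%:R * central n))).
by rewrite big1// => i _; exact: kern_total.
Qed.

Lemma weight_moment n (phi : 'cV[R]_k) i :
  \sum_J @weight n phi J * (1 - cos (phi i 0 - node n.+2 (J i))) = n.+1%:R^-1.
Proof.
pose F i' (j : 'I_n.+2) := kern n (phi i' 0 - node n.+2 j) / (n.+2%:R * central n) *
   (if i' == i then 1 - cos (phi i' 0 - node n.+2 j) else 1).
transitivity (\sum_(J : {ffun 'I_k -> 'I_n.+2}) \prod_i' F i' (J i')).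
  apply: eq_bigr => J _; rewrite /F big_split /=; congr (_ * _).
  by rewrite -big_mkcond big_pred1_eq.
rewrite -(bigA_distr_bigA F) (bigD1 i)//= [X in _ * X]big1 => [|i' ii]; last first.
  by rewrite /F (negbTE ii); under eq_bigr do rewrite mulr1; exact: kern_total.
rewrite mulr1 /F eqxx.
under eq_bigr do rewrite mulrAC.
rewrite -mulr_suml kern_moment.
have c0 := central_gt0 (R := R) n; field.
by rewrite (gt_eqF c0) !gt_eqF// ltr_pwDl.
Qed.

(** The number m j + n is the digit that stands for m j in a box of size n. *)
Definition approximant_coef (n : nat) (m : {ffun 'I_k -> int}) : 'cV[R[i]]_N :=
  \col_i \sum_(J : {ffun 'I_k -> 'I_n.+2})
    (\prod_j ((kern_coef n (absz (m j + n%:Z)) / (n.+2%:R * central n))%:C *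
       expi (- ((m j)%:~R * node n.+2 (J j))))) * (G (node_point J) i 0)%:C.

Lemma approximant_fourier n (phi : 'cV[R]_k) i :
  (trigonometric_approximant n phi i 0)%:C =
  \sum_(p : {ffun 'I_k -> 'I_(n.*2.+1)})
    let m := [ffun j => (p j)%:Z - n%:Z] in
    expi (\sum_j (m j)%:~R * phi j 0) * approximant_coef n m i 0.
Proof.
rewrite /trigonometric_approximant summxE rmorph_sum /=.
under [RHS]eq_bigr do rewrite mxE mulr_sumr.
rewrite exchange_big /=; apply: eq_bigr => J _.
under [RHS]eq_bigr do rewrite mulrA.
rewrite -mulr_suml mxE rmorphM /=; congr (_ * _).
rewrite /weight rmorph_prod /=.
pose F i' (p : 'I_n.*2.+1) := ((n.+2%:R * central n)^-1)%:C *
  ((kern_coef n p)%:C * expi ((p%:Z - n%:Z)%:~R * (phi i' 0 - node n.+2 (J i')))).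
transitivity (\prod_i' \sum_p F i' p).
  by apply: eq_bigr => i' _; rewrite -mulr_sumr -kern_fourier rmorphM mulrC.
rewrite bigA_distr_bigA; apply: eq_bigr => p _.
rewrite expi_sum -big_split /=; apply: eq_bigr => j _; rewrite ffunE subrK absz_nat /F.
by rewrite mulrBr expiD [(kern_coef _ _ / _)%:C]rmorphM /=; ring.
Qed.

Context (B : R) (Gu : forall e : R, 0 < e -> exists2 d : R, 0 < d &
    forall phi psi : 'cV[R]_k, `|phi - psi| < d -> `|G phi - G psi| <= e)
  (GB : forall phi : 'cV[R]_k, `|G phi| <= B)
  (GP : forall (phi : 'cV[R]_k) m, G (phi + lattice m) = G phi).

Lemma cosD_int2pi (x : R) (m : int) : cos (x + m%:~R * (2 * pi)) = cos x.
Proof. by have := expiD x (m%:~R * (2 * pi)); rewrite expi2pi mulr1 => -[]. Qed.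

Lemma cos_abs (x : R) : cos `|x| = cos x.
Proof. by case: (ger0P x) => // _; rewrite cosN. Qed.

(** If the phases are not close modulo 2 pi in some coordinate, then 1 - cos of
the difference of that coordinate is bounded from below. *)
Lemma korovkin_modulus (e : R) : 0 < e -> exists2 c : R, 0 <= c &
  forall phi psi : 'cV[R]_k,
    `|G phi - G psi| <= e + c * \sum_i (1 - cos (phi i 0 - psi i 0)).
Proof.
move=> e0; have [d d0 Hd] := Gu e0.
have pi0 : 0 < pi :> R := pi_gt0 R.
pose d' := Num.min d pi; have d'0 : 0 < d' by rewrite lt_min d0.
have d'pi : d' <= pi by rewrite ge_min lexx orbT.
have cd : 0 < 1 - cos d'.
  rewrite subr_gt0; apply: cos_lt1; rewrite d'0 /=; apply: le_lt_trans d'pi _.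
  by rewrite ltr_pMl// ltr1n.
have B0 : 0 <= B by apply: le_trans (GB 0).
exists (2 * B / (1 - cos d')); first by rewrite divr_ge0 ?mulr_ge0// ltW.
move=> phi psi.
have [m mP] := lattice_reduce (phi - psi + const_mx pi).
pose x i := (phi + lattice m - psi) i 0.
have xpi i : `|x i| <= pi.
  by have := mP i; rewrite /x !mxE ler_norml => /andP[h1 h2]; apply/andP; split; lra.
have cx i : cos (phi i 0 - psi i 0) = cos (x i).
  by rewrite /x !mxE addrAC cosD_int2pi.
have pos i : 0 <= 1 - cos (phi i 0 - psi i 0) by rewrite subr_ge0 cos_le1.
have S0 : 0 <= \sum_i (1 - cos (phi i 0 - psi i 0)) by apply: sumr_ge0.
rewrite -(GP phi m).
have [near|/existsNP[i /negP]] := pselect (forall i, `|x i| < d').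
  apply: (@le_trans _ _ e); last by rewrite lerDl mulr_ge0// divr_ge0 ?mulr_ge0// ltW.
  apply: Hd; apply: cV_norm_lt => // i; apply: lt_le_trans (near i) _.
  by rewrite ge_min lexx.
rewrite -leNgt => far.
have far' : 1 - cos d' <= 1 - cos (phi i 0 - psi i 0).
  rewrite lerD2l lerN2 cx -cos_abs leNgt ltr_cos ?in_itv/= -?leNgt//.
  - by rewrite normr_ge0 xpi.
  - by rewrite (ltW d'0).
apply: (@le_trans _ _ (2 * B)).
  by apply: le_trans (ler_normB _ _) _; rewrite mulr_natl mulr2n lerD.
apply: le_trans (_ : _ <= 2 * B / (1 - cos d') * \sum_i (1 - cos (phi i 0 - psi i 0))) _; last first.
  by rewrite lerDr ltW.
rewrite mulrAC ler_pdivlMr//; apply: ler_wpM2l; first by rewrite mulr_ge0.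
apply: le_trans far' _; rewrite (bigD1 i)//= lerDl; exact: sumr_ge0.
Qed.

(** Korovkin's argument: the weights are nonnegative, have sum 1, and give a
second moment of order 1/n in each coordinate. *)
Lemma trigonometric_approximation (e : R) : 0 < e ->
  \forall n \near \oo, forall phi, `|trigonometric_approximant n phi - G phi| <= e.
Proof.
move=> e0; have [c c0 H] := korovkin_modulus (divr_gt0 e0 (ltr0n R 2)).
have ck : 0 <= c * k%:R by rewrite mulr_ge0.
near=> n => phi.
have -> : trigonometric_approximant n phi - G phi =
    \sum_J @weight n phi J *: (G (node_point J) - G phi).
  under [RHS]eq_bigr do rewrite scalerBr.
  by rewrite sumrB -scaler_suml weight_total scale1r.
apply: le_trans (ler_norm_sum _ _ _) _.
apply: (@le_trans _ _ (\sum_J @weight n phi J *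
    (e / 2 + c * \sum_i (1 - cos (phi i 0 - node n.+2 (J i)))))).
  apply: ler_sum => J _; rewrite normrZ ger0_norm ?weight_ge0//.
  apply: ler_wpM2l; first exact: weight_ge0.
  rewrite distrC; apply: le_trans (H _ _) _.
  by under eq_bigr do rewrite mxE.
under eq_bigr do rewrite mulrDr !mulr_sumr.
rewrite big_split /= -mulr_suml weight_total mul1r exchange_big /=.
rewrite [X in _ + X](eq_bigr (fun=> c * n.+1%:R^-1)) => [|i _]; last first.
  by rewrite -(weight_moment n phi i) mulr_sumr; apply: eq_bigr => J _; rewrite mulrCA.
rewrite sumr_const card_ord -[_ *+ k]mulr_natl mulrA [k%:R * c]mulrC [leRHS]splitr lerD2l.
rewrite ler_pdivrMr// [leRHS]mulrC -ler_pdivrMr ?divr_gt0//.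
apply: (@le_trans _ _ n%:R); last by rewrite ler_nat.
by near: n; exact: nbhs_infty_ger.
Unshelve. all: by end_near. Qed.

End TrigonometricApproximation.

Section MultiFrequency.
Context {R : realType} {k N : nat} (Omega : 'cV[R]_k).
Local Open Scope complex_scope.
Local Notation expi := (@expi R).

Definition extended_frequency : 'cV[R]_k.+1 :=
  \col_i (if unlift ord0 i is Some j then Omega j 0 else 0).

(** Multiples q of the frequency 0 do not change the exponential. They carry the
differences between successive trigonometric polynomials a q, so that the n-th box
sums up to a n, although a n is not a partial sum of a n.+1. *)
Definition telescoped_coef (a : nat -> {ffun 'I_k -> int} -> 'cV[R[i]]_N)
    (m : {ffun 'I_k.+1 -> int}) : 'cV[R[i]]_N :=
  let m' := [ffun j => m (lift ord0 j)] in
  if 0 <= m ord0 then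
    a (absz (m ord0)) m' - (if absz (m ord0) is q.+1 then a q m' else 0)
  else 0.

Lemma telescoped_fourier_sum a n t i :
  fourier_sum extended_frequency (telescoped_coef a) n t i 0 =
  \sum_(p : {ffun 'I_k -> 'I_(n.*2.+1)})
    let m := [ffun j => (p j)%:Z - n%:Z] in
    expi (\sum_j (m j)%:~R * (t *: Omega) j 0) * a n m i 0.
Proof.
pose D := n.*2.+1.
pose glue (x : 'I_D * {ffun 'I_k -> 'I_D}) : {ffun 'I_k.+1 -> 'I_D} :=
  [ffun i => if unlift ord0 i is Some j then x.2 j else x.1].
have glue0 x : glue x ord0 = x.1 by rewrite ffunE unlift_none.
have glueS x j : glue x (lift ord0 j) = x.2 j by rewrite ffunE liftK.
have glue_bij : bijective glue.
  exists (fun p : {ffun 'I_k.+1 -> 'I_D} => (p ord0, [ffun j => p (lift ord0 j)])) => [[y q]|p].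
    by congr (_, _); [rewrite glue0|apply/ffunP => j; rewrite ffunE glueS].
  apply/ffunP => j; rewrite ffunE; case: unliftP => [j' ->|->] //=.
  by rewrite ffunE.
rewrite /fourier_sum summxE (reindex glue) /=; last exact: onW_bij.
rewrite -(pair_bigA _ (fun y q => (expi (pairing [ffun j => (glue (y, q) j)%:Z - n%:Z]
   extended_frequency * t) *: telescoped_coef a [ffun j => (glue (y, q) j)%:Z - n%:Z]) i 0)) /=.
rewrite exchange_big /=; apply: eq_bigr => q _.
set m := [ffun j => _].
have pairE y : pairing [ffun j => (glue (y, q) j)%:Z - n%:Z] extended_frequency * t =
    \sum_j (m j)%:~R * (t *: Omega) j 0.
  rewrite /pairing big_ord_recl !mxE unlift_none mulr0 add0r mulr_suml.
  by apply: eq_bigr => j _; rewrite !ffunE liftK !mxE liftK /= -mulrA [_ * t]mulrC.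
under eq_bigr do rewrite mxE pairE.
rewrite -mulr_sumr; congr (_ * _).
pose f y := if (n <= y)%N then a (y - n)%N m i 0 - (if (y - n)%N is r.+1 then a r m i 0 else 0) else 0.
transitivity (\sum_(y < D) f y).
  apply: eq_bigr => y _; rewrite /telescoped_coef /f ffunE glue0 /= subr_ge0 lez_nat.
  case: ifP => [ny|_]; last by rewrite mxE.
  have -> : [ffun j => [ffun j0 => (glue (y, q) j0)%:Z - n%:Z] (lift ord0 j)] = m.
    by apply/ffunP => j; rewrite !ffunE liftK.
  have -> : absz (y%:Z - n%:Z) = (y - n)%N by rewrite subzn.
  by rewrite !mxE; case: (y - n)%N => [|r]; rewrite ?mxE.
rewrite -(big_mkord predT f) /D -addnn -addnS (@big_cat_nat _ _ _ n)//= ?leq_addr//.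
rewrite big_nat big1 ?add0r => [|y /andP[_ yn]]; last by rewrite /f leqNgt yn.
rewrite -{1}[n]add0n [(n + n.+1)%N]addnC big_addn addnK.
transitivity (\sum_(0 <= y < n.+1) (a y m i 0 - (if y is r.+1 then a r m i 0 else 0))).
  by apply: eq_big_nat => y _; rewrite /f leq_addl addnK.
elim: (n) => [|r IH]; first by rewrite big_nat1 subr0.
by rewrite big_nat_recr//= IH addrC subrK.
Qed.

Lemma multi_frequency_quasiperiodic (G : 'cV[R]_k -> 'cV[R]_N) (B : R) :
  (forall e : R, 0 < e -> exists2 d : R, 0 < d &
    forall phi psi : 'cV[R]_k, `|phi - psi| < d -> `|G phi - G psi| <= e) ->
  (forall phi : 'cV[R]_k, `|G phi| <= B) ->
  (forall (phi : 'cV[R]_k) m, G (phi + lattice m) = G phi) ->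
  multi_frequency (fun t => G (t *: Omega)).
Proof.
move=> Gu GB GP.
exists k.+1, extended_frequency, (telescoped_coef (approximant_coef G)) => e e0.
have e20 : 0 < e / 2 by rewrite divr_gt0.
have := trigonometric_approximation Gu GB GP e20; apply: filterS => n H t i.
rewrite telescoped_fourier_sum -approximant_fourier -rmorphB normc_def /= expr0n addr0.
rewrite sqrtr_sqr ltcR.
apply: (@le_lt_trans _ _ (e / 2)); last by rewrite ltr_pdivrMr// ltr_pMr// ltr1n.
apply: le_trans (H (t *: Omega)).
by have := cV_coord_le (trigonometric_approximant G n (t *: Omega) - G (t *: Omega)) i; rewrite !mxE.
Qed.

End MultiFrequency.

(** * The classes of regularity and the smallness of the forcing *)

Section RegularityClasses.
Context {R : realType}.
Implicit Types r : regularity.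

Lemma C_on_ext (V W : normedModType R) r (S : set V) (f g : V -> W) :
  (forall x, S x -> f x = g x) -> C_on r S f -> C_on r S g.
Proof.
case: r => [n||] fg /=; [exact: Cn_on_ext|by move=> h n; exact: Cn_on_ext (h n)|].
by move=> h x Sx; exact: analytic_within_ext fg (h x Sx).
Qed.

Lemma C_on_subset (V W : normedModType R) r (S S' : set V) (f : V -> W) :
  S' `<=` S -> C_on r S f -> C_on r S' f.
Proof.
case: r => [n||] SS /=; [exact: Cn_on_subset|by move=> h n; exact: Cn_on_subset (h n)|].
by move=> h x Sx; apply: (analytic_within_subset SS (h x _)); exact: SS.
Qed.

Lemma C_onD (V W : normedModType R) r (S : set V) (f g : V -> W) :
  C_on r S f -> C_on r S g -> C_on r S (fun x => f x + g x).
Proof.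
case: r => [n||] /=; [exact: Cn_onD|by move=> h h' n; exact: Cn_onD (h n) (h' n)|].
by move=> h h' x Sx; exact: analytic_withinD (h x Sx) (h' x Sx).
Qed.

Lemma C_on_linear (V W : normedModType R) r (S : set V) (f : V -> W) :
  fin_dim V -> linear f -> C_on r S f.
Proof.
by case: r => [n||] fV lf /=; [|move=> n|move=> x _]; [exact: Cn_on_linear|exact: Cn_on_linear|exact: analytic_within_linear].
Qed.

Lemma C_on_precomp (U V W : normedModType R) r (S : set U) (T : set V)
    (f : V -> W) (L : U -> V) : fin_dim U -> fin_dim V -> linear L ->
  (forall y, S y -> T (L y)) -> C_on r T f -> C_on r S (f \o L).
Proof.
move=> fU fV lL ST; case: r => [n||] /= h.
- exact: (Cn_on_comp fU fV ST h (Cn_on_linear n S fU lL)).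
- by move=> n; exact: (Cn_on_comp fU fV ST (h n) (Cn_on_linear n S fU lL)).
- by move=> x Sx; apply: (analytic_within_precomp fU lL ST); apply: h; exact: ST.
Qed.

Lemma C_on_scale (V W : normedModType R) r (S : set V) (k : V -> R) (f : V -> W) :
  fin_dim V -> linear k -> C_on r S f -> C_on r S (fun y => k y *: f y).
Proof.
move=> fV lk; case: r => [n||] /= h.
- exact: (Cn_on_scale fV (Cn_on_linear n S fV lk) h).
- by move=> n; exact: (Cn_on_scale fV (Cn_on_linear n S fV lk) (h n)).
- by move=> x Sx; exact: (analytic_within_scale fV lk (h x Sx)).
Qed.

Lemma C_on_C1 (V : normedModType R) N r (S : set V) (f : V -> 'cV[R]_N) :
  fin_dim V -> (forall x, S x -> thick_at S x) -> regularity_pos r ->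
  C_on r S f -> Cn_on 1 S f.
Proof.
move=> fV thS; case: r => [n||] rp h.
- case: n rp h => [//|n] _; rewrite /C_on; elim: n => // n IH h.
  exact: (IH (Cn_on_le fV h)).
- exact: (h 1%N).
- exact: (analytic_Cn fV thS 1 [::] h).
Qed.

End RegularityClasses.

Lemma pair_addE (R : realType) (V W : normedModType R) (x y : V) (z w : W) :
  (x + y, z + w) = (x, z) + (y, w).
Proof. by []. Qed.

Lemma pair_scaleE (R : realType) (V W : normedModType R) (a : R) (x : V) (z : W) :
  (a *: x, a *: z) = a *: (x, z).
Proof. by []. Qed.

Section SmallForcing.
Context {R : realType} {N k : nat} (U : set 'cV[R]_N) (oU : open U) (U0 : U 0)
  (Omega : 'cV[R]_k) (e1 : R) (e10 : 0 < e1).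
Local Notation Lam := ('cV[R]_k * R)%type.
Local Notation E := ('cV[R]_N * Lam)%type.
Context (g : E -> 'cV[R]_N) (g1 : Cn_on 1 (U `*` params e1) g)
  (gP : torus_periodic e1 U g)
  (gO : exists C : R, \forall x \near (0 : 'cV[R]_N), forall phi,
     `|g (x, (phi, 0))| <= C * `|x| ^+ 2).

Let fE : fin_dim (E : normedModType R).
Proof.
apply: fin_dim_pair; first exact: fin_dim_cV.
by apply: fin_dim_pair; [exact: fin_dim_cV|exact: fin_dim_real].
Qed.

Lemma forcing_continuous x p (e : R) : U x -> e <= e1 -> params e p ->
  continuous (fun t : R => g (x, p + t *: drift Omega)).
Proof.
move=> Ux ee Sp.
have Sp1 t : params e1 (p + t *: drift Omega).
  apply: params_drift; case: p Sp => phi q [_ /=]; rewrite in_itv/= => /andP[q0 qe].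
  by split => //=; rewrite in_itv/= q0 (le_trans qe).
have cg : {within U `*` params e1, continuous g} := Cn_on_continuous fE g1.
apply: (continuous_in_domain cg (c := fun t => (x, p + t *: drift Omega))) => [t|t]; last first.
  by split => //=; exact: Sp1.
have h : {for t, continuous (fun t : R => p + t *: drift Omega)}.
  by apply: cvgD; [exact: cvg_cst|apply: cvgZ; [exact: cvg_id|exact: cvg_cst]].
exact: (cvg_pair (cvg_cst x) h).
Qed.

(** At x = 0 and epsilon = 0 the derivative of g in x vanishes, because g is
O(|x|^2) for epsilon = 0. By uniform continuity it stays below ka for small x and
epsilon and for all phases. The radius rho is found before the bound B on the size
of the forcing is prescribed, since that bound has to depend on rho. *)
Lemma small_forcing (ka : R) : 0 < ka -> exists2 rho : R, 0 < rho &
  (forall x : 'cV[R]_N, `|x| <= rho -> U x) /\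
  forall B : R, 0 < B -> exists2 e0 : R, 0 < e0 <= e1 &
    (forall x y p, `|x| <= rho -> `|y| <= rho -> params e0 p ->
       `|g (x, p) - g (y, p)| <= ka * `|x - y|) /\
    forall p, params e0 p -> `|g (0, p)| <= B.
Proof.
move=> ka0; have [dg [Dg dgc]] := g1.
have [C /nbhs_ballP[d1 /= d10 gC]] := gO.
have /nbhs_ballP[d2 /= d20 Ud] := open_nbhs_nbhs (conj oU U0).
pose rho1 := d2 / 2; have rho10 : 0 < rho1 by rewrite divr_gt0.
have rho1U (x : 'cV[R]_N) : `|x| <= rho1 -> U x.
  move=> xr; apply: Ud; rewrite -ball_normE /ball_ /= sub0r normrN.
  by apply: le_lt_trans xr _; rewrite ltr_pdivrMr// ltr_pMr// ltr1n.
have S0 (phi : 'cV[R]_k) : params e1 (phi, 0) by split => //=; rewrite in_itv/= lexx ltW.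
have dg0 phi u : dg (0, (phi, 0)) (u, 0) = 0.
  have Sz : (U `*` params e1) (0, (phi, 0)) by split => //; exact: S0.
  apply/eqP; rewrite -normr_le0; apply/ler_addgt0Pl => B B0; rewrite addr0.
  have u1 : 0 < `|u| + 1 by rewrite ltr_wpDl.
  have C1 : 0 < `|C| + 1 by rewrite ltr_wpDl.
  have small : forall t : R, 0 < t -> t < Num.min d1 rho1 / (`|u| + 1) ->
      [/\ U (t *: u), ball (0 : 'cV[R]_N) d1 (t *: u) & `|t *: u| = t * `|u|].
    move=> t t0; rewrite ltr_pdivlMr// lt_min => /andP[h1 h2].
    have nt : `|t *: u| = t * `|u| by rewrite normrZ gtr0_norm.
    have le1 : t * `|u| <= t * (`|u| + 1) by rewrite ler_wpM2l ?lerDl// ltW.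
    split => //.
      by apply: rho1U; rewrite nt; apply: le_trans le1 (ltW h2).
    by rewrite -ball_normE /ball_ /= sub0r normrN nt; apply: le_lt_trans le1 h1.
  have tE (t : R) : (0, (phi, 0)) + t *: (u, 0) = (t *: u, (phi, 0)) :> E.
    by rewrite -pair_scaleE !scaler0 -pair_addE add0r addr0.
  have t00 : 0 < Num.min d1 rho1 / (`|u| + 1) by rewrite divr_gt0// lt_min d10.
  apply: (derivative_within_feasible (Dg _ Sz)); last 2 first.
  - exact: ltW.
  - pose q := B / ((`|C| + 1) * (`|u| + 1) ^+ 2).
    exists (Num.min (Num.min d1 rho1 / (`|u| + 1)) q).
      by rewrite lt_min t00 divr_gt0// mulr_gt0// exprn_gt0.
    move=> t /andP[t0]; rewrite lt_min => /andP[tq1]; rewrite ltr_pdivlMr ?mulr_gt0 ?exprn_gt0// => tq2 _.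
    rewrite tE; have [_ bt nt] := small t t0 tq1.
    have g00 : g (0, (phi, 0)) = 0.
      apply/eqP; rewrite -normr_le0; apply: le_trans (gC 0 _ phi) _; first exact: ballxx.
      by rewrite normr0 expr0n /= mulr0.
    rewrite g00 subr0; apply: le_trans (gC _ bt phi) _; rewrite nt.
    have := ler_norm C; have := normr_ge0 C; have := normr_ge0 u.
    move: tq2; move: (`|C|) (`|u|) => y x tq2 x0 y0 Cy.
    apply: (@le_trans _ _ (t * (t * ((y + 1) * (x + 1) ^+ 2)))); last first.
      by rewrite [leRHS]mulrC; apply: ler_wpM2l; exact: ltW.
    have -> : C * (t * x) ^+ 2 = t * (t * (C * x ^+ 2)) by ring.
    apply: ler_wpM2l; first exact: ltW.
    apply: ler_wpM2l; first exact: ltW.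
    apply: le_trans (ler_wpM2r (sqr_ge0 x) Cy) _.
    by apply: ler_pM; rewrite ?sqr_ge0 ?lerDl//; apply: lerXn2r; rewrite ?nnegrE ?addr_ge0 ?lerDl.
  - exists (Num.min d1 rho1 / (`|u| + 1)) => // t /andP[t0 tq]; rewrite tE.
    by have [Ut _ _] := small t t0 tq; split => //; exact: S0.
pose dG (z : E) (u : 'cV[R]_N) := dg z (u, 0).
have Lin z : (U `*` params e1) z -> linear (dG z).
  move=> Sz b u v; have [lin _] := Dg z Sz; rewrite /dG -lin; congr (dg z _).
  by rewrite -pair_scaleE -pair_addE scaler0 addr0.
have dGc u : {within U `*` params e1, continuous (dG^~ u)} := dgc (u, 0).
have dgP : torus_periodic e1 U dg := torus_periodic_derivative e10 oU gP Dg.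
have dGP : torus_periodic e1 U dG.
  by move=> x p j Ux Sp; apply/funext => u; rewrite /dG dgP.
have [d d0 Hd] := operator_uniform rho1U (fin_dim_cV N) Lin dGc dGP ka0.
pose rho := Num.min rho1 (d / 2).
have rho0 : 0 < rho by rewrite lt_min rho10 divr_gt0.
have rhorho1 (x : 'cV[R]_N) : `|x| <= rho -> `|x| <= rho1.
  by move=> h; apply: le_trans h _; rewrite ge_min lexx.
have rhod (x : 'cV[R]_N) : `|x| <= rho -> `|x| < d.
  move=> h; apply: le_lt_trans h _; apply: (@le_lt_trans _ _ (d / 2)).
    by rewrite ge_min lexx orbT.
  by rewrite ltr_pdivrMr// ltr_pMr// ltr1n.
exists rho => //; split; first by move=> x /rhorho1/rho1U.
move=> B B0.
have cg : {within U `*` params e1, continuous g} := Cn_on_continuous fE g1.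
have [d3 d30 H3] := periodic_uniform rho1U cg gP B0.
pose e0 := Num.min e1 (Num.min d d3 / 2).
have dd3 : 0 < Num.min d d3 by rewrite lt_min d0.
have e00 : 0 < e0 by rewrite lt_min e10 divr_gt0.
have e0e1 : e0 <= e1 by rewrite ge_min lexx.
have near0 (p : Lam) : params e0 p -> [/\ params e1 p, `|p - (p.1, 0)| < d & `|p - (p.1, 0)| < d3].
  case: p => phi q [_ /=]; rewrite in_itv/= => /andP[q0 qe].
  have qd : q < Num.min d d3.
    apply: le_lt_trans qe _; apply: (@le_lt_trans _ _ (Num.min d d3 / 2)).
      by rewrite ge_min lexx orbT.
    by rewrite ltr_pdivrMr// ltr_pMr// ltr1n.
  have -> : `|(phi, q) - (phi, 0)| = q.
    by rewrite prod_normE /= subrr normr0 subr0 ger0_norm// max_r.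
  move: qd; rewrite lt_min => /andP[-> ->]; split => //.
  by split => //=; rewrite in_itv/= q0 (le_trans qe).
have z1 : `|0 : 'cV[R]_N| <= rho1 by rewrite normr0 ltW.
exists e0; first by rewrite e00.
split; last first.
  move=> p Sp; have [Sp1 _ pd3] := near0 p Sp.
  have g00 : g (0, (p.1, 0)) = 0.
    apply/eqP; rewrite -normr_le0; apply: le_trans (gC 0 _ p.1) _; first exact: ballxx.
    by rewrite normr0 expr0n /= mulr0.
  have := H3 0 0 p (p.1, 0) z1 z1 Sp1 (S0 _); rewrite subrr normr0 g00 subr0.
  exact.
move=> x y p xr yr Sp; have [Sp1 pd _] := near0 p Sp.
have E1 : ((x, p) : E) - (y, p) = (x - y, 0) by rewrite -[LHS]/(x - y, p - p) subrr.
have segE (s : R) : ((y, p) : E) + s *: ((x, p) - (y, p)) = (y + s *: (x - y), p).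
  by rewrite E1 -pair_scaleE -pair_addE scaler0 addr0.
have segr s : 0 <= s <= 1 -> `|y + s *: (x - y)| <= rho.
  move=> /andP[s0 s1].
  have -> : y + s *: (x - y) = (1 - s) *: y + s *: x.
    by rewrite scalerBl scale1r scalerBr addrA addrAC.
  apply: le_trans (ler_normD _ _) _; rewrite !normrZ (ger0_norm s0) ger0_norm ?subr_ge0//.
  have := ler_wpM2l s0 xr; have s1' : 0 <= 1 - s by rewrite subr_ge0.
  have := ler_wpM2l s1' yr; lra.
have := @segment_mean_value _ _ _ (U `*` params e1) g dg (y, p) (x, p) 0 (ka * `|x - y|) fE.
rewrite subr0; apply => //.
- by move=> s s01; rewrite segE; split => //=; apply: rho1U; apply: rhorho1; exact: segr.
- by rewrite mulr_ge0 ?(ltW ka0).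
- move=> s /andP[s0 s1]; rewrite segE E1 subr0.
  have sr : `|y + s *: (x - y)| <= rho by apply: segr; rewrite !ltW.
  have := Hd (y + s *: (x - y)) 0 p (p.1, 0) (x - y) (rhorho1 _ sr) z1 Sp1 (S0 _).
  rewrite subr0 => /(_ (rhod _ sr) pd).
  by rewrite /dG dg0 subr0.
Qed.

End SmallForcing.

(** * The nonlinear normal mode *)

Section GraphDistance.
Context {R : realType} {N k : nat}.

Lemma edist_inf_graph (h : 'cV[R]_k -> 'cV[R]_N) x phi (e : R) : `|x - h phi| < e ->
  (edist_inf (range (fun phi => (h phi, phi))) (x, phi) <= e%:E)%E.
Proof.
move=> xe; have e0 : 0 < e := le_lt_trans (normr_ge0 _) xe.
apply: le_trans (ereal_inf_lbound (x := edist ((x, phi), (h phi, phi))) _) _.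
  by exists (h phi, phi) => //; exists phi.
by apply: edist_fin => //; split => /=; [rewrite -ball_normE|exact: ballxx].
Qed.

Lemma near_graph (h : 'cV[R]_k -> 'cV[R]_N) x phi (e : R) :
  (edist_inf (range (fun phi => (h phi, phi))) (x, phi) < e%:E)%E ->
  exists psi, `|x - h psi| < e.
Proof.
move=> /ereal_inf_lt[y [z [psi _ <-] <-]] /edist_lt_ball[/= b _]; exists psi.
by move: b; rewrite -ball_normE.
Qed.

End GraphDistance.

Lemma section_C_on (R : realType) (m N k : nat) (C : 'M[R]_(m, N)) (a c : R) :
  0 < a -> 0 < c -> (forall x : 'cV[R]_N, c * `|x| ^+ 2 <= lform C x x) ->
  forall (Omega : 'cV[R]_k) (e0 : R), 0 < e0 ->
  forall (r : regularity) (U : set 'cV[R]_N) (rho : R) G (h : 'cV[R]_k * R -> 'cV[R]_N),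
  open U -> 0 < rho -> (forall x : 'cV[R]_N, `|x| <= rho -> U x) ->
  C_on r (U `*` params e0) G -> torus_periodic e0 U G -> dissipative C a e0 G rho ->
  (forall p, params e0 p -> `|h p| <= rho / 2) ->
  invariant_section Omega e0 G h -> C_on r (params e0) h.
Proof.
move=> a0 c0 CL Omega e0 e00 r U rho G h oU rho0 rhoU GC GP GD hr hG.
have hr' p : params e0 p -> `|h p| < rho.
  by move=> Sp; apply: le_lt_trans (hr p Sp) _; rewrite ltr_pdivrMr// ltr_pMr// ltr1n.
case: r GC => [n||] GC /=.
- exact: (section_Cn a0 c0 CL e00 oU rhoU GC GP GD hr' hG).
- by move=> n; exact: (section_Cn a0 c0 CL e00 oU rhoU (GC n) GP GD hr' hG).
- exact: (section_analytic a0 c0 CL e00 oU rho0 rhoU GC GP GD hr hG).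
Qed.

Theorem theorem2 (R : realType) (r : regularity) (hr : regularity_pos r)
    (N k : nat) (hk : (0 < k)%N) (Omega : 'cV[R]_k) (A : 'M[R]_N)
    (U : set 'cV[R]_N) (hU : open U) (hU0 : U 0)
    (f0 : 'cV[R]_N -> 'cV[R]_N) (hf0 : C_on r U f0)
    (hf0O : exists C : R, \forall x \near (0 : 'cV[R]_N),
       `|f0 x| <= C * `|x| ^+ 2)
    (eps1 : R) (heps1 : 0 < eps1)
    (f1 : 'cV[R]_N -> 'cV[R]_k -> R -> 'cV[R]_N)
    (hf1per : forall x eps, U x -> 0 <= eps < eps1 ->
       periodic2pi (fun phi => f1 x phi eps))
    (hf1 : C_on r (U `*` setT `*` `[0, eps1[)
       (fun p : 'cV[R]_N * 'cV[R]_k * R => f1 p.1.1 p.1.2 p.2))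
    (hA : forall lambda : R[i],
       eigenvalue (map_mx (real_complex R) A) lambda ->
       complex.Re lambda < 0) :
  exists (tau : 'cV[R]_k -> R -> 'cV[R]_N) (delta eps0 : R),
    [/\ 0 < delta, 0 < eps0 <= eps1,
        C_on r (setT `*` `[0, eps0[)
          (fun p : 'cV[R]_k * R => p.2 *: tau p.1 p.2) &
        forall eps, 0 < eps < eps0 ->
          let F := forced_field A f0 f1 eps in
          let xeps phi0 t := eps *: tau (phi0 + t *: Omega) eps in
          [/\ periodic2pi (fun phi => tau phi eps),
              forall phi0, multi_frequency_solution U Omega F phi0 (xeps phi0)
                /\ nnm (xeps phi0) `<=` ball 0 delta,
              forall phi0 y, multi_frequency_solution U Omega F phi0 y ->
                nnm y `<=` ball 0 delta -> y = xeps phi0 &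
              attracts_nearby U Omega F
                (range (fun phi => (eps *: tau phi eps, phi)))]].
Proof.
have [C [a [c [a0 c0 CA CL]]]] := exists_lyapunov hA.
have [ka ka0 kaP] := small_perturbation a0 c0 CL.
have b0 : 0 < a / 2 by rewrite divr_gt0.
have [c' c'0 CU] := lform_le C.
(* a closed interval of values of epsilon, on which compactness can be used *)
pose e1 := eps1 / 2; have e10 : 0 < e1 by rewrite divr_gt0.
have e11 : e1 < eps1 by rewrite ltr_pdivrMr// ltr_pMr// ltr1n.
pose Lam := ('cV[R]_k * R)%type; pose E := ('cV[R]_N * Lam)%type.
have fL : fin_dim (Lam : normedModType R) by apply: fin_dim_pair; [exact: fin_dim_cV|exact: fin_dim_real].
have fE : fin_dim (E : normedModType R) by apply: fin_dim_pair; [exact: fin_dim_cV|exact: fL].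
pose g (z : E) : 'cV[R]_N := f0 z.1 + z.2.2 *: f1 z.1 z.2.1 z.2.2.
have gC : C_on r (U `*` params e1) g.
  apply: C_onD.
    apply: (@C_on_precomp _ _ _ _ r (U `*` params e1) U f0 (fun z : E => z.1) fE (fin_dim_cV N)) => //.
    by move=> z [].
  apply: C_on_scale => //.
  pose swap (z : E) : 'cV[R]_N * 'cV[R]_k * R := (z.1, z.2.1, z.2.2).
  apply: (@C_on_precomp _ _ _ _ r (U `*` params e1) (U `*` setT `*` `[0, eps1[) _ swap fE) hf1 => //.
    by apply: fin_dim_pair; [apply: fin_dim_pair; exact: fin_dim_cV|exact: fin_dim_real].
  move=> [x [phi e]] [/= Ux [_ /=]]; rewrite in_itv/= => /andP[q0 qe]; split => //=.
  by rewrite in_itv/= q0 (le_lt_trans qe).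
have thS (e : R) : 0 < e -> forall z, (U `*` params e) z -> thick_at (U `*` @params R k e) z.
  by move=> e0 z; exact: thick_params.
have g1 := C_on_C1 fE (thS e1 e10) hr gC.
have f1P x p j : U x -> params e1 p -> f1 x (p + period j).1 (p + period j).2 = f1 x p.1 p.2.
  case: p => phi e Ux [_ /=]; rewrite in_itv/= => /andP[q0 qe].
  by rewrite addr0 (hf1per _ _ Ux)// q0 (le_lt_trans qe).
have gP : torus_periodic e1 U g.
  by move=> x p j Ux Sp; rewrite /g f1P// /period /= addr0.
have gO : exists K : R, \forall x \near (0 : 'cV[R]_N), forall phi : 'cV[R]_k,
     `|g (x, (phi, 0))| <= K * `|x| ^+ 2.
  have [K HK] := hf0O; exists K; apply: filterS HK => x hx phi.
  by rewrite /g /= scale0r addr0.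
have [rho rho0 [rhoU small]] := small_forcing hU hU0 e10 g1 gP gO ka0.
have rho2 : rho / 2 < rho by rewrite ltr_pdivrMr// ltr_pMr// ltr1n.
have [kap kap0 kapP] := bounded_response b0 c0 CL.
pose rb := basin_radius c rho c'.
have rb0 : 0 < rb by rewrite sqrtr_gt0 !divr_gt0// mulr_gt0// exprn_gt0.
(* makes the section smaller than half of the radii rho of the ball and rb of
   the basin, and lets the basin be forward invariant *)
pose B := Num.min (Num.min rho rb / 2 / kap) (a / 2 * rb / 2).
have B0 : 0 < B by rewrite lt_min !divr_gt0 ?mulr_gt0// lt_min rho0.
have kB : kap * B <= Num.min rho rb / 2.
  by rewrite mulrC -ler_pdivlMr// ge_min lexx.
have kBr : kap * B <= rho / 2.
  by apply: le_trans kB _; rewrite ler_pM2r// ge_min lexx.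
have kBb : kap * B <= rb / 2.
  by apply: le_trans kB _; rewrite ler_pM2r// ge_min lexx orbT.
have [e0 /andP[e00 e0e1] [gL gB]] := small B B0.
have gc x (p : Lam) : `|x| <= rho -> params e0 p -> continuous (fun t : R => g (x, p + t *: drift Omega)).
  have := @forcing_continuous _ _ _ U Omega e1 g g1 x p e0 => H xr Sp; apply: H => //; exact: rhoU.
have kBlt : kap * B < rho := le_lt_trans kBr rho2.
have [h [hG hB]] := forced_section a0 c0 CL CA ka0 kaP rho0 gL gc gB kapP kBlt.
have GD := forced_dissipative CA kaP gL.
have Sdr p t : params e0 p -> params e0 (p + t *: drift Omega) by exact: params_drift.
have hB2 p : params e0 p -> `|h p| <= kap * B.
  by move=> Sp; apply: hB => // t; apply: gB; exact: Sdr.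
have hr2 p : params e0 p -> `|h p| <= rho / 2 by move=> Sp; exact: le_trans (hB2 p Sp) kBr.
have hlt p : params e0 p -> `|h p| < rho by move=> Sp; exact: le_lt_trans (hr2 p Sp) rho2.
have sub01 : U `*` @params R k e0 `<=` U `*` params e1.
  move=> [x [phi e]] [/= Ux [_ /=]]; rewrite in_itv/= => /andP[q0 qe].
  by split => //; split => //=; rewrite in_itv/= q0 (le_trans qe).
have GC : C_on r (U `*` params e0) (forced A g).
  apply: C_onD; last exact: C_on_subset sub01 gC.
  by apply: C_on_linear => // b x y /=; rewrite mulmxDr scalemxAr.
have GP : torus_periodic e0 U (forced A g).
  move=> x p j Ux Sp; rewrite /forced gP//.
  by have [] := sub01 (x, p) (conj Ux Sp).
have hC : C_on r (params e0) h.
  exact: (section_C_on b0 c0 CL e00 hU rho0 rhoU GC GP GD hr2 hG).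
have hper p j : params e0 p -> h (p + period j) = h p.
  by move=> Sp; exact: (section_periodic b0 c0 CL rhoU GP GD hlt hG j Sp).
(* without forcing the bounded solution is the equilibrium; thus dividing by
   epsilon and multiplying again loses nothing at epsilon = 0 *)
have h0 phi : h (phi, 0) = 0.
  have S0 : params e0 (phi, 0) by split => //=; rewrite in_itv/= lexx ltW.
  apply/eqP; rewrite -normr_le0; have := hB (phi, 0) 0 S0; rewrite mulr0; apply=> t.
  have f00 : f0 0 = 0.
    have [K HK] := hf0O; apply/eqP; rewrite -normr_le0.
    by apply: le_trans (nbhs_singleton HK) _; rewrite normr0 expr0n /= mulr0.
  by rewrite /g /= f00 scaler0 addr0 scale0r addr0 normr0.
have hc : {within params e0, continuous h}.
  have thE := thS e0 e00.
  apply: (section_continuous b0 c0 CL rhoU GP GD hlt hG).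
  exact: (Cn_on_continuous fE (C_on_C1 fE thE hr GC)).
pose tau (phi : 'cV[R]_k) (eps : R) : 'cV[R]_N := eps^-1 *: h (phi, eps).
have tauE phi eps : eps *: tau phi eps = h (phi, eps).
  have [->|ne] := eqVneq eps 0; first by rewrite scale0r h0.
  by rewrite /tau scalerA mulfV// scale1r.
exists tau, rho, e0; split => //.
- by rewrite e00 (le_trans e0e1 (ltW e11)).
- apply: (@C_on_ext _ _ _ r _ h); first by move=> [phi eps] _; rewrite /= tauE.
  apply: C_on_subset hC => -[phi eps] [_ /=]; rewrite in_itv/= => /andP[q0 qe].
  by split => //=; rewrite in_itv/= q0 ltW.
move=> eps /andP[eps0 epse] F xeps.
have Sp (phi : 'cV[R]_k) : params e0 (phi, eps) by split => //=; rewrite in_itv/= !ltW.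
have driftE phi0 t : (phi0, eps) + t *: drift Omega = (phi0 + t *: Omega, eps).
  by rewrite /drift -pair_scaleE -pair_addE scaler0 addr0.
have FE x phi : F x phi = forced A g (x, (phi, eps)) by rewrite /F /forced_field /forced /g addrA.
have xE phi0 t : xeps phi0 t = h (phi0 + t *: Omega, eps) by rewrite /xeps tauE.
have Dx phi0 (t : R) : is_derive t 1 (xeps phi0) (F (xeps phi0 t) (phi0 + t *: Omega)).
  have := hG _ (Sp phi0) t; rewrite driftE xE FE.
  by congr (is_derive _ _ _ _); apply/funext => s; rewrite driftE xE.
have xr phi0 t : `|xeps phi0 t| <= rho / 2 by rewrite xE; exact: hr2.
have sol phi0 : solution U Omega F setT phi0 (xeps phi0).
  split => [|t _|t _]; last exact: Dx.
  - by apply: continuous_subspaceT => t; have ? := Dx phi0 t; apply: is_derive_continuous.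
  - by apply: rhoU; exact: le_trans (xr phi0 t) (ltW rho2).
pose hz (z : E) := h z.2.
have hzP : torus_periodic e0 (@setT 'cV[R]_N) hz by move=> x p j _ Spp; exact: hper.
have hzc : {within setT `*` params e0, continuous hz}.
  move/within_continuousP: hc => hc; apply/within_continuousP => -[x p] [_ Spp] e e_0.
  have [d d0 Hd] := hc p Spp e e_0; exists d => // -[y q] [_ Sq]; rewrite prod_normE gt_max => /andP[_ pq].
  exact: Hd.
have mf phi0 : multi_frequency (xeps phi0).
  have -> : xeps phi0 = fun t => (fun phi => h (phi0 + phi, eps)) (t *: Omega).
    by apply/funext => t; rewrite xE.
  apply: (@multi_frequency_quasiperiodic _ _ _ Omega (fun phi => h (phi0 + phi, eps)) (rho / 2)).
  - move=> e e_0.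
    have [d d0 Hd] := periodic_uniform (rho := 1) (fun x _ => I) hzc hzP e_0.
    exists d => // phi psi pp.
    apply: (Hd 0 0 (phi0 + phi, eps) (phi0 + psi, eps)); rewrite ?normr0 ?subrr ?normr0//.
    by rewrite prod_normE /= subrr normr0 gt_max d0 andbT opprD addrACA subrr add0r.
  - by move=> phi; exact: hr2.
  - move=> phi n; have := torus_periodic_lattice (x := 0) (p := (phi0 + phi, eps)) n hzP I (Sp _).
    by rewrite /hz /= -pair_addE addr0 addrA.
have bnd y : nnm y `<=` ball 0 rho -> forall t, `|y t| < rho.
  move=> yb t; have := yb (y t); rewrite -ball_normE /ball_ /= sub0r normrN; apply.
  by apply: subset_closure; exists t.
split.
- move=> phi j; rewrite /tau; congr (_ *: _).
  by have := hper (phi, eps) j (Sp phi); rewrite /period -pair_addE addr0.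
- move=> phi0; split; first by split.
  move=> z zc; rewrite -ball_normE /ball_ /= sub0r normrN.
  have r20 : 0 < rho / 2 by rewrite divr_gt0.
  have [_ [[t _ <-]]] := zc _ (nbhsx_ballx z _ r20).
  rewrite -ball_normE /ball_ /= => zx.
  have -> : z = (z - xeps phi0 t) + xeps phi0 t by rewrite subrK.
  apply: le_lt_trans (ler_normD _ _) _; rewrite [rho]splitr; exact: ltr_leD.
- move=> phi0 y [[_ yU Dy] _] /bnd yr.
  have Dy' (t : R) : is_derive t 1 y (F (y t) (phi0 + t *: Omega)).
    by apply: Dy; rewrite interiorT.
  apply: (@bounded_solution_unique _ _ _ C (a / 2) c b0 c0 CL _ _ _ _ rho _ _ Dy' (Dx phi0)).
  + by move=> t; exact: ltW.
  + by move=> t; exact: le_trans (xr phi0 t) (ltW rho2).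
  + move=> t; rewrite !FE; apply: GD; [exact: ltW|exact: le_trans (xr phi0 t) (ltW rho2)|exact: Sp].
have ME : range (fun phi => (eps *: tau phi eps, phi)) = range (fun phi => (h (phi, eps), phi)).
  by have -> : (fun phi => (eps *: tau phi eps, phi)) = (fun phi => (h (phi, eps), phi)) by apply/funext => phi; rewrite tauE.
(* points of the torus are in the ball of radius rb / 2 *)
rewrite ME; exists (rb / 2); first by rewrite divr_gt0.
move=> x0 phi0 /near_graph[psi xpsi].
have x0r : `|x0| < rb.
  have -> : x0 = (x0 - h (psi, eps)) + h (psi, eps) by rewrite subrK.
  apply: le_lt_trans (ler_normD _ _) _; rewrite [rb]splitr; apply: ltr_leD => //.
  exact: le_trans (hB2 _ (Sp psi)) kBb.
have BB : B <= a / 2 * rb / 2 by rewrite ge_min lexx orbT.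
have [[x [xx0 xrho Dxx]] stay] := forced_forward a0 c0 CL CA ka0 kaP rho0 gL gc gB c'0 CU BB (Sp phi0) x0r.
have inI (t : R) : 0 < t -> interior (`[0, +oo[%classic : set R) t.
  by move=> t0; rewrite interior_itv_bndy /= in_itv/= t0.
split.
  exists x => //; split.
  - apply/within_continuousP => t; rewrite /= in_itv/= andbT => t0 e e_0.
    have ? := Dxx t t0; have /cvgrPdist_le/(_ _ e_0) : {for t, continuous x} by exact: is_derive_continuous.
    move=> /nbhs_ballP[d /= d0 Hd]; exists d => // s _ st; rewrite distrC; apply: Hd.
    by rewrite -ball_normE /ball_ /= distrC.
  - by move=> t; rewrite /= in_itv/= andbT => t0; apply: rhoU; exact: ltW (xrho t t0).
  - move=> t /interior_subset; rewrite /= in_itv/= andbT => t0; rewrite FE -driftE; exact: Dxx.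
move=> y [yc yU Dy] y0.
have Dy' (t : R) : 0 < t -> is_derive t 1 y (forced A g (y t, (phi0, eps) + t *: drift Omega)).
  by move=> t0; have := Dy t (inI t t0); rewrite FE driftE.
have yrho := stay y y0 yc Dy'.
have att := forced_attraction a0 c0 CL CA kaP gL (Sp phi0) hG (fun q Sq => ltW (hlt q Sq)) yc Dy'
  (fun t t0 => ltW (yrho t t0)).
apply: (@squeeze_cvge _ _ _ _ (fun=> 0%E) _
  (fun t => `|y t - h ((phi0, eps) + t *: drift Omega)|%:E)); last 2 first.
- exact: cvg_cst.
- by apply/fine_cvgP; split; [exact: nearW|exact: att].
near=> t; rewrite edist_inf_ge0 /=; apply/lee_addgt0Pr => e e_0.
by rewrite -EFinD; apply: edist_inf_graph; rewrite driftE ltrDl.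
Unshelve. all: by end_near. Qed.
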